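(* Let $A$ be a derived Poincaré duality (DPD) algebra of dimension $d$ over a field $\mathbf{k}$, with class $[\psi]\in HH^*(A,A^\vee)$. Let $D=(-\cap[\psi])^{-1}:HH^*(A,A^\vee)\to HH^*(A,A)$ be the isomorphism induced by the derived equivalence, and let $\Delta:=D\circ B^\vee\circ D^{-1}$. Then $(HH^*(A,A),\cup,\Delta)$ is a BV-algebra whose bracket is the Gerstenhaber bracket of $HH^*(A,A)$, i.e. for all homogeneous $f,g\in HH^*(A,A)$ $$[f,g]=(-1)^{|f|}\Delta(f\cup g)-(-1)^{|f|}\Delta(f)\cup g-f\cup\Delta(g).$$
   Context: **Hochschild complexes.** $\mathbf{k}$ is a field, $A$ is an augmented unital differential graded (DG) $\mathbf{k}$-algebra with differential of degree $+1$, $\bar A=A/\mathbf{k}$, $s\bar A$ is $\bar A$ with degrees lowered by one, $A^e=A\otimes A^{op}$, $A^\vee=\mathrm{Hom}_{\mathbf{k}}(A,\mathbf{k})$; $A$-bimodules are DG $A^e$-modules. $C_*(A,A)=A\otimes T(s\bar A)$ is the normalized Hochschild chain complex. For a bimodule $M$, $C^*(A,M)=\mathrm{Hom}_{\mathbf{k}}(T(s\bar A),M)$ is the normalized Hochschild cochain complex, graded by the degree of linear maps, with cohomology $HH^*(A,M)=\mathrm{Ext}^*_{A^e}(A,M)$. One identifies $C^*(A,A^\vee)=\mathrm{Hom}_{\mathbf{k}}(A\otimes T(s\bar A),\mathbf{k})$, the dual of $C_*(A,A)$. Cup product: for $x\in C^m(A,A)$, $y\in C^n(A,A)$ ($m,n$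 = number of arguments), $(x\cup y)(a_1,\dots,a_{m+n})=(-1)^{|y|\sum_{i\le m}(|a_i|+1)}x(a_1,\dots,a_m)\,y(a_{m+1},\dots,a_{m+n})$. Gerstenhaber bracket: $[x,y]=x\circ y-(-1)^{(|x|+1)(|y|+1)}y\circ x$, $x\circ y=\sum_j x\circ_j y$, $(x\circ_j y)(a_1,\dots,a_{m+n-1})=(-1)^{(|y|+1)\sum_{i\le j}(|a_i|+1)}x(a_1,\dots,a_j,y(a_{j+1},\dots,a_{j+n}),\dots)$. These make $HH^*(A,A)$ a Gerstenhaber algebra. Connes operator: $B(a_0[a_1,\dots,a_n])=\sum_{i=1}^{n+1}(-1)^{\epsilon_i}1[a_i,\dots,a_n,a_0,\dots,a_{i-1}]$, $\epsilon_i=(|a_0|+\dots+|a_{i-1}|-i)(|a_i|+\dots+|a_n|-n+i-1)$; on the dual complex, $B^\vee(\phi)=(-1)^{|\phi|}\phi\circ B$. Contraction: for $f\in C^k(A,A)$, $i_f(a_0[a_1,\dots,a_n])=(-1)^{|f|\sum_{i=1}^k(|a_i|+1)}a_0f(a_1,\dots,a_k)[a_{k+1},\dots,a_n]$ (zero if $n<k$), and on $C^*(A,A^\vee)$, $i_f(\phi)=(-1)^{|f||\phi|}\phi\circ i_f$. **BV-algebra.** A Gerstenhaber algebra $(V,\cdot,[-,-])$ with an operator $\Delta$ of degree $\pm1$ (the sign depending on grading conventions) such that $\Delta^2=0$ and $[a,b]=(-1)^{|a|}\Delta(ab)-(-1)^{|a|}\Delta(a)b-a\Delta(b)$. **DPD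 algebra.** Suppose $A$ is equivalent to $A^\vee[d]$ in the derived category of $A$-bimodules, i.e. there is a quasi-isomorphism of $A$-bimodules $\psi:P\to A^\vee[d]$ with $P\to A$ a semi-free resolution of $A$ as a bimodule. Then $\psi$ is a cocycle in $\mathrm{Hom}_{A^e}(P,A^\vee)$, with class $[\psi]\in HH^*(A,A^\vee)$, and $-\cap[\psi]:HH^*(A,A)\to HH^*(A,A^\vee)$, $f\mapsto i_f[\psi]$ (equivalently, the map induced by composition with $\psi$, $\mathrm{Hom}_{A^e}(P,P)\to\mathrm{Hom}_{A^e}(P,A^\vee)$), is an isomorphism. $A$ is a derived Poincaré duality algebra of dimension $d\in\mathbb{Z}$ if moreover $B^\vee([\psi])=0$.
   Formalization: The contraction i_f is taken with sign (-1)^{|f|(|a_0|+1)} instead of the printed (-1)^{|f|Σ(|a_i|+1)}; with the printed sign the BV identity fails, e.g. for A=H^*(S^1), d=1, char k≠2. The two agree for A in degree 0. *)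

(* Defs.v *)
From HB Require Import structures.
From mathcomp Require Import all_boot all_order all_algebra.
From mathcomp Require Import boolp functions.
From mathcomp Require Import ring.

Set Implicit Arguments.
Unset Strict Implicit.
Unset Printing Implicit Defensive.

Import GRing.Theory.
Local Open Scope ring_scope.

(* Augmented DG algebras.  [gpr p] is the projection of A = (+)_p A^p onto
   A^p, so that "a is homogeneous of degree p" is [gpr p a = a]. *)
Record augDGA (k : fieldType) := AugDGA {
  dga_car :> algType k;
  gpr : int -> {linear dga_car -> dga_car};
  gprK : forall p q a, gpr p (gpr q a) = if p == q then gpr q a else 0;
  gpr_sum : forall a, exists2 s : seq int, uniq s & a = \sum_(p <- s) gpr p a;
  gpr1 : gpr 0 1 = 1;
  gprM : forall p q a b,
    gpr p a = a -> gpr q b = b -> gpr (p + q) (a * b) = a * b;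
  dga_d : {linear dga_car -> dga_car};
  dga_d_deg : forall p a, gpr p a = a -> gpr (p + 1) (dga_d a) = dga_d a;
  dga_dd : forall a, dga_d (dga_d a) = 0;
  dga_dM : forall p a b, gpr p a = a ->
    dga_d (a * b) = dga_d a * b + (-1) ^ p *: (a * dga_d b);
  dga_aug : {lrmorphism dga_car -> k^o};
  dga_aug_deg : forall p a, p != 0 -> dga_aug (gpr p a) = 0;
  dga_aug_d : forall a, dga_aug (dga_d a) = 0 }.

Arguments gpr {k} A p : rename.
Arguments dga_d {k} A : rename.

Section Homogeneous.
Variables (k : fieldType) (A : augDGA k).

Record helt := Helt {
  hdeg : int;
  hval : A;
  hvalP : gpr A hdeg hval = hval }.

Lemma gpr_idem q (a : A) : gpr A q (gpr A q a) = gpr A q a.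
Proof. by rewrite gprK eqxx. Qed.

Definition hpr (q : int) (a : A) : helt := Helt (gpr_idem q a).

Definition hone : helt := hpr 0 1.
(* The projections below do nothing: the products and differentials are
   already homogeneous of the indicated degree. *)
Definition hmul (a b : helt) : helt := hpr (hdeg a + hdeg b) (hval a * hval b).
Definition hd (a : helt) : helt := hpr (hdeg a + 1) (dga_d A (hval a)).

(* The degree of [a_1, ..., a_n] in T(sA), where |sa| = |a| - 1. *)
Definition sdeg (s : seq helt) : int := \sum_(a <- s) (hdeg a - 1).

End Homogeneous.

Arguments hone {k A}.
Arguments hpr {k A} q a.

(* A graded bimodule is the direct sum of a linearly independent family of
   subspaces M^q = { x | bhom q x } of an ambient space; elements of the
   ambient space outside this sum play no role.  The action is that of the
   homogeneous elements of A. *)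
Record grbimod (k : fieldType) (A : augDGA k) := GrBimod {
  gb_car :> lmodType k;
  bhom : int -> gb_car -> Prop;
  bhom0 : forall q, bhom q 0;
  bhomL : forall q c x y, bhom q x -> bhom q y -> bhom q (c *: x + y);
  bhom_indep : forall (s : seq int) (x : int -> gb_car), uniq s ->
    (forall q, bhom q (x q)) -> \sum_(q <- s) x q = 0 ->
    forall q, q \in s -> x q = 0;
  lact : helt A -> gb_car -> gb_car;
  ract : gb_car -> helt A -> gb_car;
  lact_hom : forall a q x, bhom q x -> bhom (hdeg a + q) (lact a x);
  ract_hom : forall a q x, bhom q x -> bhom (q + hdeg a) (ract x a);
  lactL : forall a q c x y, bhom q x -> bhom q y ->
    lact a (c *: x + y) = c *: lact a x + lact a y;
  ractL : forall a q c x y, bhom q x -> bhom q y ->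
    ract (c *: x + y) a = c *: ract x a + ract y a;
  lactDl : forall p (c : k) (a b : A) q x, bhom q x ->
    lact (hpr p (c *: a + b)) x = c *: lact (hpr p a) x + lact (hpr p b) x;
  ractDr : forall p (c : k) (a b : A) q x, bhom q x ->
    ract x (hpr p (c *: a + b)) = c *: ract x (hpr p a) + ract x (hpr p b);
  lactA : forall a b q x, bhom q x -> lact (hmul a b) x = lact a (lact b x);
  ractA : forall a b q x, bhom q x -> ract x (hmul a b) = ract (ract x a) b;
  lractA : forall a b q x, bhom q x -> ract (lact a x) b = lact a (ract x b);
  lact1 : forall q x, bhom q x -> lact hone x = x;
  ract1 : forall q x, bhom q x -> ract x hone = x }.

Arguments bhom {k A M} q x : rename.
Arguments lact {k A M} a x : rename.
Arguments ract {k A M} x a : rename.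

(* [bd q] is the component M^q -> M^(q+1) of the differential. *)
Record dgbimod (k : fieldType) (A : augDGA k) := DGBimod {
  dgb_gr :> grbimod A;
  bd : int -> dgb_gr -> dgb_gr;
  bd_hom : forall q x, bhom q x -> bhom (q + 1) (bd q x);
  bdL : forall q c x y, bhom q x -> bhom q y ->
    bd q (c *: x + y) = c *: bd q x + bd q y;
  bdd : forall q x, bhom q x -> bd (q + 1) (bd q x) = 0;
  bd_lact : forall a q x, bhom q x ->
    bd (hdeg a + q) (lact a x) =
    lact (hd a) x + (-1) ^ (hdeg a) *: lact a (bd q x);
  bd_ract : forall a q x, bhom q x ->
    bd (q + hdeg a) (ract x a) =
    ract (bd q x) a + (-1) ^ q *: ract x (hd a) }.

Arguments bd {k A M} q x : rename.

Section Regular.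
Variables (k : fieldType) (A : augDGA k).

Lemma helt_inj (a b : helt A) : hdeg a = hdeg b -> hval a = hval b -> a = b.
Proof.
case: a b => [p a Ha] [q b Hb] /= E1 E2; move: Ha Hb; rewrite E1 E2 => Ha Hb.
by rewrite (Prop_irrelevance Ha Hb).
Qed.

Lemma hval_pr (a : helt A) : gpr A (hdeg a) (hval a) = hval a.
Proof. exact: hvalP. Qed.

Lemma hvalM (a b : helt A) : hval (hmul a b) = hval a * hval b.
Proof. by rewrite /hmul /= gprM ?hval_pr. Qed.

Lemma hvald (a : helt A) : hval (hd a) = dga_d A (hval a).
Proof. by rewrite /hd /= (dga_d_deg (hval_pr a)). Qed.

Lemma hval1 : hval (@hone k A) = 1.
Proof. by rewrite /hone /= gpr1. Qed.

Definition reg_hom (q : int) (x : A) : Prop := gpr A q x = x.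

Lemma reg_indep (s : seq int) (x : int -> A) : uniq s ->
  (forall q, reg_hom q (x q)) -> \sum_(q <- s) x q = 0 ->
  forall q, q \in s -> x q = 0.
Proof.
move=> us hx s0 q qs; have := congr1 (gpr A q) s0.
rewrite linear0 linear_sum (bigD1_seq q) //= hx big1 ?addr0 // => i iq.
by rewrite -hx gprK eq_sym (negbTE iq).
Qed.

Program Definition reg_gr : grbimod A := @GrBimod k A A reg_hom _ _ reg_indep
  (fun a x => hval a * x) (fun x a => x * hval a) _ _ _ _ _ _ _ _ _ _ _.
Next Obligation. exact: linear0. Qed.
Next Obligation. by rewrite /reg_hom linearP H H0. Qed.
Next Obligation. by apply: gprM => //; apply: hval_pr. Qed.
Next Obligation. by apply: gprM => //; apply: hval_pr. Qed.
Next Obligation. by rewrite mulrDr scalerAr. Qed.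
Next Obligation. by rewrite mulrDl scalerAl. Qed.
Next Obligation. by rewrite linearP mulrDl scalerAl. Qed.
Next Obligation. by rewrite linearP mulrDr scalerAr. Qed.
Next Obligation. by have := hvalM a b; rewrite /hmul /= => ->; rewrite mulrA. Qed.
Next Obligation. by have := hvalM a b; rewrite /hmul /= => ->; rewrite mulrA. Qed.
Next Obligation. by rewrite mulrA. Qed.
Next Obligation. by have := hval1; rewrite /hone /= => ->; rewrite mul1r. Qed.
Next Obligation. by have := hval1; rewrite /hone /= => ->; rewrite mulr1. Qed.

Program Definition reg : dgbimod A :=
  @DGBimod k A reg_gr (fun _ x => dga_d A x) _ _ _ _ _.
Next Obligation. exact: dga_d_deg. Qed.
Next Obligation. by rewrite linearP. Qed.
Next Obligation. exact: dga_dd. Qed.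
Next Obligation.
have := hvald a; rewrite /hd /= => ->.
by rewrite (dga_dM _ (hval_pr a)).
Qed.
Next Obligation.
have := hvald a; rewrite /hd /= => ->.
by rewrite (dga_dM _ H).
Qed.

End Regular.

(* A^vee is the graded dual: (A^vee)^q consists of the linear forms on A that
   vanish on A^p for p <> -q.  The bimodule structure and differential are
     (a.l)(x) = (-1)^(|a| (|l| + |x|)) l(x a),   (l.a)(x) = l(a x),
     (d l)(x) = - (-1)^|l| l(d x);
   the first sign equals (-1)^|a|, since l(x a) = 0 unless
   |l| + |x| = - |a|. *)
Section Dual.
Variables (k : fieldType) (A : augDGA k).

Definition dual_hom (q : int) (l : A -> k^o) : Prop :=
  (forall c a b, l (c *: a + b) = c * l a + l b) /\
  (forall a, l a = l (gpr A (- q) a)).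

Definition dual_lact (a : helt A) (l : A -> k^o) : A -> k^o :=
  fun x => (-1) ^ (hdeg a) * l (x * hval a).
Definition dual_ract (l : A -> k^o) (a : helt A) : A -> k^o :=
  fun x => l (hval a * x).
Definition dual_d (q : int) (l : A -> k^o) : A -> k^o :=
  fun x => - ((-1) ^ q * l (dga_d A x)).

Lemma gpr_Mr p (x : A) (a : helt A) :
  gpr A p (x * hval a) = gpr A (p - hdeg a) x * hval a.
Proof.
have [s us ->] := gpr_sum x.
rewrite [in RHS]linear_sum !mulr_suml linear_sum /=.
apply: eq_bigr => i _; have E := gprM (gpr_idem i x) (hval_pr a).
rewrite -[in LHS]E !gprK subr_eq.
by case: ifP => _; rewrite ?mul0r ?E.
Qed.

Lemma gpr_Ml p (a : helt A) (x : A) :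
  gpr A p (hval a * x) = hval a * gpr A (p - hdeg a) x.
Proof.
have [s us ->] := gpr_sum x.
rewrite [in RHS]linear_sum !mulr_sumr linear_sum /=.
apply: eq_bigr => i _; have E := gprM (hval_pr a) (gpr_idem i x).
rewrite -[in LHS]E !gprK subr_eq [i + _]addrC.
by case: ifP => _; rewrite ?mulr0 ?E.
Qed.

Lemma gpr_d p (x : A) : gpr A p (dga_d A x) = dga_d A (gpr A (p - 1) x).
Proof.
have [s us ->] := gpr_sum x; rewrite !linear_sum /=.
apply: eq_bigr => i _; have E := dga_d_deg (gpr_idem i x).
rewrite -[in LHS]E !gprK subr_eq.
by case: ifP => _; rewrite ?linear0 ?E.
Qed.

Lemma sgnM (p q : int) : (-1) ^ (p + q) = (-1) ^ p * (-1) ^ q :> k.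
Proof. by rewrite expfzDr // oppr_eq0 oner_eq0. Qed.

Lemma sgn2 (p : int) : (-1) ^ p * (-1) ^ p = 1 :> k.
Proof. by rewrite -expfzMl mulrNN mulr1 exp1rz. Qed.

Lemma sgnN (p : int) : (-1) ^ (- p) = (-1) ^ p :> k.
Proof.
transitivity ((-1) ^ (- p) * ((-1) ^ p * (-1) ^ p) : k).
  by rewrite sgn2 mulr1.
by rewrite mulrA -sgnM addNr expr0z mul1r.
Qed.

Lemma dual_homD q l x y : dual_hom q l -> l (x + y) = l x + l y.
Proof. by case=> L _; have := L 1 x y; rewrite scale1r mul1r. Qed.

Lemma dual_homZ q l c x : dual_hom q l -> l (c *: x) = c * l x.
Proof.
move=> H; have l0 : l 0 = 0.
  by apply: (addrI (l 0)); rewrite -(dual_homD 0 0 H) !addr0.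
by have [L _] := H; have := L c x 0; rewrite !addr0 l0 addr0.
Qed.

Lemma dual_indep (s : seq int) (x : int -> A -> k^o) : uniq s ->
  (forall q, dual_hom q (x q)) -> \sum_(q <- s) x q = 0 ->
  forall q, q \in s -> x q = 0.
Proof.
move=> us hx s0 q qs; apply/funext => a.
have := congr1 (fun f : A -> k^o => f (gpr A (- q) a)) s0.
rewrite fct_sumE (bigD1_seq q) //= -(proj2 (hx q)) big1 ?addr0 // => i iq.
rewrite (proj2 (hx i)) gprK eqr_opp (negbTE iq).
by rewrite -(scale0r 0) (dual_homZ 0 0 (hx i)) mul0r.
Qed.

Program Definition dual_gr : grbimod A :=
  @GrBimod k A (A -> k^o) dual_hom _ _ dual_indep dual_lact dual_ract
    _ _ _ _ _ _ _ _ _ _ _.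
Next Obligation. by split=> // *; rewrite mulr0 addr0. Qed.
Next Obligation.
have [[L1 E1] [L2 E2]] := (H, H0); split=> [e a b|a].
  rewrite !fctE L1 L2 /GRing.scale /=.
  by rewrite !mulrDr !mulrA [c * e]mulrC addrACA.
by rewrite !fctE E1 E2.
Qed.
Next Obligation.
have [L E] := H; split=> [e b c|b]; rewrite /dual_lact.
  by rewrite mulrDl -scalerAl L mulrDr mulrCA.
by rewrite E gpr_Mr opprD [- hdeg a + _]addrC.
Qed.
Next Obligation.
have [L E] := H; split=> [e b c|b]; rewrite /dual_ract.
  by rewrite mulrDr -scalerAr L.
by rewrite E gpr_Ml opprD.
Qed.
Next Obligation.
apply/funext => b; rewrite /dual_lact !fctE /GRing.scale /=.
by rewrite mulrDr mulrCA.
Qed.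
Next Obligation.
by apply/funext => z; rewrite /dual_lact !fctE /= linearP mulrDr
  -scalerAr (proj1 H) mulrDr mulrCA.
Qed.
Next Obligation.
by apply/funext => z; rewrite /dual_ract !fctE /= linearP mulrDl -scalerAl
  (proj1 H).
Qed.
Next Obligation.
apply/funext => z; rewrite /dual_lact.
have := hvalM a b; rewrite /hmul /= => ->.
by rewrite sgnM -!mulrA.
Qed.
Next Obligation.
apply/funext => z; rewrite /dual_ract.
by have := hvalM a b; rewrite /hmul /= => ->; rewrite mulrA.
Qed.
Next Obligation. by apply/funext => z; rewrite /dual_ract /dual_lact mulrA. Qed.
Next Obligation.
apply/funext => z; rewrite /dual_lact.
by have := @hval1 k A; rewrite /hone /= => ->; rewrite expr0z mul1r mulr1.
Qed.
Next Obligation.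
apply/funext => z; rewrite /dual_ract.
by have := @hval1 k A; rewrite /hone /= => ->; rewrite mul1r.
Qed.

Lemma dual_d_lact (a : helt A) q l : dual_hom q l ->
  dual_d (hdeg a + q) (dual_lact a l) =
  dual_lact (hd a) l + (-1) ^ (hdeg a) *: dual_lact a (dual_d q l).
Proof.
move=> hl; have [L E] := hl; apply/funext => x.
rewrite !fctE /dual_d /dual_lact /GRing.scale /=.
have := hvald a; rewrite /hd /= => ->.
have -> : l (dga_d A x * hval a) =
    l (dga_d A (gpr A (- q - hdeg a - 1) x) * hval a).
  by rewrite E gpr_Mr gpr_d.
have -> : l (x * dga_d A (hval a)) =
    l (gpr A (- q - hdeg a - 1) x * dga_d A (hval a)).
  by rewrite E -[dga_d A (hval a)]hvald gpr_Mr /= opprD addrA.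
have -> : l (dga_d A (x * hval a)) =
    l (dga_d A (gpr A (- q - hdeg a - 1) x * hval a)).
  by rewrite E gpr_d gpr_Mr addrAC.
rewrite (dga_dM _ (gpr_idem _ _)) (dual_homD _ _ hl) (dual_homZ _ _ hl).
rewrite !sgnM !sgnN expr1z.
have := sgn2 (hdeg a); have := sgn2 q.
move: ((-1) ^ q) ((-1) ^ (hdeg a)) => v u v2 u2.
ring: u2 v2.
Qed.

Lemma dual_d_ract (a : helt A) q l : dual_hom q l ->
  dual_d (q + hdeg a) (dual_ract l a) =
  dual_ract (dual_d q l) a + (-1) ^ q *: dual_ract l (hd a).
Proof.
move=> hl; have [L E] := hl; apply/funext => x.
rewrite !fctE /dual_d /dual_ract /GRing.scale /=.
have := hvald a; rewrite /hd /= => ->.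
rewrite (dga_dM _ (hval_pr a)) (dual_homD _ _ hl) (dual_homZ _ _ hl) sgnM.
by rewrite mulrDr opprD addrAC addNr add0r mulrA.
Qed.

Program Definition dual : dgbimod A := @DGBimod k A dual_gr dual_d _ _ _ _ _.
Next Obligation.
have [L E] := H; split=> [e b c|b]; rewrite /dual_d.
  by rewrite linearP L mulrDr opprD mulrCA mulrN.
by rewrite E gpr_d opprD.
Qed.
Next Obligation.
by apply/funext => z; rewrite /dual_d !fctE /GRing.scale /= mulrDr opprD
  mulrN mulrCA.
Qed.
Next Obligation.
apply/funext => z; rewrite /dual_d dga_dd -(scale0r 0).
by rewrite (dual_homZ 0 0 H) mul0r mulr0 oppr0 mulr0 oppr0.
Qed.
Next Obligation. exact: dual_d_lact. Qed.
Next Obligation. exact: dual_d_ract. Qed.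
End Dual.

Section Maps.
Variables (k : fieldType) (A : augDGA k).

(* Maps of graded (resp. DG) bimodules of degree m; a closed map M -> N of
   degree m is the same as a morphism of DG bimodules from M to the shift of N
   by m. *)
Definition grmap (M N : grbimod A) (m : int) (g : M -> N) : Prop :=
  [/\ forall q x, bhom q x -> bhom (q + m) (g x),
      forall q c x y, bhom q x -> bhom q y -> g (c *: x + y) = c *: g x + g y,
      forall a q x, bhom q x ->
        g (lact a x) = (-1) ^ (m * hdeg a) *: lact a (g x)
    & forall a q x, bhom q x -> g (ract x a) = ract (g x) a].

Definition dgmap (M N : dgbimod A) (m : int) (g : M -> N) : Prop :=
  grmap m g /\
  forall q x, bhom q x -> g (bd q x) = (-1) ^ m *: bd (q + m) (g x).

Definition quasi_iso (M N : dgbimod A) (m : int) (g : M -> N) : Prop :=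
  [/\ dgmap m g,
      forall q x y, bhom q x -> bd q x = 0 -> bhom (q + m - 1) y ->
        g x = bd (q + m - 1) y ->
        exists2 z, bhom (q - 1) z & x = bd (q - 1) z
    & forall q y, bhom (q + m) y -> bd (q + m) y = 0 ->
        exists x, exists w, [/\ bhom q x, bd q x = 0, bhom (q + m - 1) w
                              & y - g x = bd (q + m - 1) w]].

(* Freeness as a graded A^e-module, by the universal property. *)
Definition free_on (P : grbimod A) (I : Type) (deg : I -> int) (e : I -> P) :
    Prop :=
  (forall i, bhom (deg i) (e i)) /\
  forall (N : grbimod A) (n : I -> N), (forall i, bhom (deg i) (n i)) ->
  exists g : P -> N,
    [/\ grmap 0 g, forall i, g (e i) = n i
      & forall g' : P -> N, grmap 0 g' -> (forall i, g' (e i) = n i) ->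
        forall q x, bhom q x -> g' x = g x].

Definition subbimod (P : grbimod A) (Q : int -> P -> Prop) : Prop :=
  [/\ forall q, Q q 0,
      forall q c x y, Q q x -> Q q y -> Q q (c *: x + y),
      forall a q x, Q q x -> Q (hdeg a + q) (lact a x)
    & forall a q x, Q q x -> Q (q + hdeg a) (ract x a)].

(* P has a homogeneous A^e-basis (e i) filtered by rk : I -> nat, such that
   d (e i) lies in the graded sub-bimodule generated by the e j with
   rk j < rk i. *)
Definition semifree (P : dgbimod A) : Prop :=
  exists (I : Type) (deg : I -> int) (rk : I -> nat) (e : I -> P),
    free_on deg e /\
    forall i (Q : int -> P -> Prop), subbimod Q ->
      (forall j, (rk j < rk i)%N -> Q (deg j) (e j)) ->
      Q (deg i + 1) (bd (deg i) (e i)).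

End Maps.

Arguments grmap {k A M N} m g.
Arguments dgmap {k A M N} m g.
Arguments quasi_iso {k A M N} m g.

Section Cochains.
Variables (k : fieldType) (A : augDGA k) (M : dgbimod A).

(* An element of C^p(A, M) = Hom^p(T(sA-bar), M) is encoded by its values on
   the tensors [a_1, ..., a_n], n >= 0, of homogeneous elements; it has
   components in all arities n.  It factors through A-bar = A / k since it
   vanishes as soon as some a_i is 1. *)
Definition cochain (p : int) (f : seq (helt A) -> M) : Prop :=
  [/\ forall s, bhom (p + sdeg s) (f s),
      forall s1 s2 q c (a b : A),
        f (s1 ++ hpr q (c *: a + b) :: s2) =
        c *: f (s1 ++ hpr q a :: s2) + f (s1 ++ hpr q b :: s2)
    & forall s1 s2, f (s1 ++ hone :: s2) = 0].

(* The Hochschild differential on C^p(A, M), with the Koszul signs coming from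
   Hom_{A^e}(B(A, A, A), M), B(A, A, A) being the normalized bar resolution. *)
Definition delta (p : int) (f : seq (helt A) -> M) (s : seq (helt A)) : M :=
  bd (p + sdeg s) (f s)
  + \sum_(0 <= i < size s) (-1) ^ (p + sdeg (take i s)) *:
      f (take i s ++ hd (nth hone s i) :: drop i.+1 s)
  - \sum_(0 <= i < (size s).-1) (-1) ^ (p + sdeg (take i.+1 s)) *:
      f (take i s ++ hmul (nth hone s i) (nth hone s i.+1) :: drop i.+2 s)
  + match s with
    | [::] => 0
    | a :: s' =>
        (-1) ^ (p + sdeg (belast a s')) *: ract (f (belast a s')) (last a s')
        - (-1) ^ (p * (hdeg a + 1)) *: lact a (f s')
    end.

Definition cocycle (p : int) (f : seq (helt A) -> M) : Prop :=
  cochain p f /\ delta p f = 0.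

Definition coboundary (p : int) (f : seq (helt A) -> M) : Prop :=
  exists2 h, cochain (p - 1) h & f = delta (p - 1) h.

Lemma delta_lin p c f g : cochain p f -> cochain p g ->
  delta p (c *: f + g) = c *: delta p f + delta p g.
Proof.
move=> [hf _ _] [hg _ _]; apply/funext => s.
have fgE t : (c *: f + g) t = c *: f t + g t by [].
transitivity (c *: delta p f s + delta p g s); last by [].
have sumE n (u : nat -> k) (t : nat -> seq (helt A)) :
    \sum_(0 <= i < n) u i *: (c *: f + g) (t i) =
    c *: (\sum_(0 <= i < n) u i *: f (t i)) + \sum_(0 <= i < n) u i *: g (t i).
  rewrite scaler_sumr -big_split; apply: eq_bigr => i _.
  by rewrite fgE scalerDr !scalerA mulrC.
have D4 (x1 y1 x2 y2 x3 y3 x4 y4 : M) :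
    x1 + y1 + (x2 + y2) + (x3 + y3) + (x4 + y4) =
    x1 + x2 + x3 + x4 + (y1 + y2 + y3 + y4).
  by rewrite (addrACA x1) (addrACA (x1 + x2)) (addrACA (x1 + x2 + x3)).
rewrite /delta !sumE fgE (bdL _ (hf s) (hg s)) opprD -scalerN.
rewrite [X in _ + X = _](_ : _ = c *: match s with
    | [::] => 0
    | a :: s' =>
        (-1) ^ (p + sdeg (belast a s')) *: ract (f (belast a s')) (last a s')
        - (-1) ^ (p * (hdeg a + 1)) *: lact a (f s')
    end + match s with
    | [::] => 0
    | a :: s' =>
        (-1) ^ (p + sdeg (belast a s')) *: ract (g (belast a s')) (last a s')
        - (-1) ^ (p * (hdeg a + 1)) *: lact a (g s')
    end); first by rewrite D4 !scalerDr.
case: (s) => [|a t]; first by rewrite scaler0 addr0.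
rewrite !fgE (lactL _ _ (hf t) (hg t)) (ractL _ _ (hf _) (hg _)).
rewrite !scalerDr scalerN !scalerA opprD ![_ * c]mulrC addrACA.
by rewrite -!scalerA.
Qed.

Lemma cochain0 p : cochain p 0.
Proof.
split=> // [s|s1 s2 q c a b]; first exact: bhom0.
by rewrite [RHS](_ : _ = c *: 0 + 0) // scaler0 addr0.
Qed.

Lemma cochainL p c f g : cochain p f -> cochain p g -> cochain p (c *: f + g).
Proof.
have fgE t : (c *: f + g) t = c *: f t + g t by [].
move=> [hf lf nf] [hg lg ng]; split=> [s|s1 s2 q e a b|s1 s2].
- exact: bhomL.
- rewrite !fgE lf lg !scalerDr !scalerA [e * c]mulrC addrACA.
  by [].
- by rewrite fgE nf ng scaler0 addr0.
Qed.

Lemma delta0 p : delta p 0 = 0.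
Proof.
have := delta_lin 1 (cochain0 p) (cochain0 p).
rewrite !scale1r addr0 => /(congr1 (fun f => f - delta p 0)).
by rewrite subrr addrK.
Qed.

Definition cocycle_pred (p : int) : {pred seq (helt A) -> M} :=
  fun f => `[< cocycle p f >].

Lemma cocycle_closed p : submod_closed (cocycle_pred p).
Proof.
split=> [|c f g /asboolP[Cf df] /asboolP[Cg dg]]; apply/asboolP.
  by split; [exact: cochain0|exact: delta0].
by split; [exact: cochainL|rewrite delta_lin // df dg scaler0 addr0].
Qed.

HB.instance Definition _ p :=
  GRing.isSubmodClosed.Build k (seq (helt A) -> M) (cocycle_pred p)
    (cocycle_closed p).

Record cocycles (p : int) := Cocycle {
  cocycle_val :> seq (helt A) -> M;
  cocycle_valP : cocycle_val \in cocycle_pred p }.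

HB.instance Definition _ p := [isSub for @cocycle_val p].
HB.instance Definition _ p := [Choice of cocycles p by <:].
HB.instance Definition _ p := [SubChoice_isSubLmodule of cocycles p by <:].

Definition coboundary_pred (p : int) : {pred cocycles p} :=
  fun f => `[< coboundary p f >].

Lemma coboundary_closed p : submod_closed (@coboundary_pred p).
Proof.
split=> [|c f g /asboolP[h Ch fh] /asboolP[h' Ch' gh']]; apply/asboolP.
  by exists 0; [exact: cochain0|rewrite delta0].
exists (c *: h + h'); first exact: cochainL.
by rewrite delta_lin // -fh -gh'.
Qed.

HB.instance Definition _ p :=
  GRing.isSubmodClosed.Build k (cocycles p) (@coboundary_pred p)
    (coboundary_closed p).

Definition HH (p : int) : Type := Quotient.quot (@coboundary_pred p).

HB.instance Definition _ p := GRing.Zmodule.on (HH p).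
HB.instance Definition _ p := EqQuotient.on (HH p).

Definition HH_scale p (c : k) (x : HH p) : HH p :=
  (\pi_(HH p) (c *: repr x))%qT.

Lemma HH_piE p (f g : cocycles p) :
  (\pi_(HH p) f = \pi_(HH p) g)%qT <-> f - g \in @coboundary_pred p.
Proof. by rewrite Quotient.idealrBE; split=> [/eqP|/eqP]. Qed.

Lemma HH_piD p (f g : cocycles p) :
  (\pi_(HH p) (f + g) = \pi_(HH p) f + \pi_(HH p) g)%qT.
Proof. by rewrite [LHS]Quotient.pi_add. Qed.

Lemma HH_piZ p c (f : cocycles p) :
  (\pi_(HH p) (c *: f) = HH_scale c (\pi_(HH p) f))%qT.
Proof.
apply/HH_piE; rewrite -scalerBr rpredZ //.
by apply/HH_piE; rewrite reprK.
Qed.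

Lemma HH_scaleA p a b (x : HH p) :
  HH_scale a (HH_scale b x) = HH_scale (a * b) x.
Proof. by rewrite -[x]reprK -(HH_piZ b (repr x)) -!HH_piZ scalerA. Qed.

Lemma HH_scale1 p : left_id 1 (@HH_scale p).
Proof. by move=> x; rewrite -[x]reprK -HH_piZ scale1r. Qed.

Lemma HH_scaleDr p : right_distributive (@HH_scale p) +%R.
Proof.
move=> c x y; rewrite -[x]reprK -[y]reprK -HH_piD -!HH_piZ.
by rewrite scalerDr HH_piD.
Qed.

Lemma HH_scaleDl p (x : HH p) :
  {morph (@HH_scale p)^~ x : a b / a + b}.
Proof. by move=> a b; rewrite -[x]reprK -!HH_piZ scalerDl HH_piD. Qed.

HB.instance Definition _ p := GRing.Zmodule_isLmodule.Build k (HH p)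
  (@HH_scaleA p) (@HH_scale1 p) (@HH_scaleDr p) (@HH_scaleDl p).

Definition class p f (Zf : cocycle p f) : HH p :=
  (\pi_(HH p) (@Cocycle p f (asboolT Zf)))%qT.

End Cochains.

Arguments cochain {k A} M p f.
Arguments delta {k A} M p f s.
Arguments cocycle {k A} M p f.
Arguments coboundary {k A} M p f.
Arguments HH {k A} M p.
Arguments class {k A M p f} Zf.

(* Operations on C^*(A, A).  The numbers p and q are the degrees of x and y.
   As cochains have components in all arities, each formula is summed over the
   numbers of arguments; sdeg s has the same parity as the sum of the
   |a_i| + 1. *)
Section Operations.
Variables (k : fieldType) (A : augDGA k).
Implicit Types (x y : seq (helt A) -> A) (s : seq (helt A)).

Definition unit_cochain s : A := if s is [::] then 1 else 0.

Definition cup (q : int) x y s : A :=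
  \sum_(0 <= m < (size s).+1)
    (-1) ^ (q * sdeg (take m s)) *: (x (take m s) * y (drop m s)).

Definition circ (q : int) x y s : A :=
  \sum_(0 <= j < (size s).+1) \sum_(0 <= n < (size s - j).+1)
    let t := take n (drop j s) in
    (-1) ^ ((q + 1) * sdeg (take j s)) *:
      x (take j s ++ hpr (q + sdeg t) (y t) :: drop (j + n) s).

Definition gerst (p q : int) x y s : A :=
  circ q x y s - (-1) ^ ((p + 1) * (q + 1)) *: circ p y x s.

End Operations.

(* Operations on C^*(A, A^vee), identified with the dual of
   C_*(A, A) = A (x) T(sA-bar). *)
Section DualOperations.
Variables (k : fieldType) (A : augDGA k).
Implicit Types (f : seq (helt A) -> dual A) (a : helt A) (s : seq (helt A)).

(* A formal linear combination of tensors a_0[a_1, ..., a_n]. *)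
Definition chain := seq (k * (helt A * seq (helt A))).

Definition eval_chain (phi : helt A -> seq (helt A) -> k) (c : chain) : k :=
  \sum_(t <- c) t.1 * phi t.2.1 t.2.2.

(* Hom(T(sA-bar), A^vee) = Hom(A (x) T(sA-bar), k), with the Koszul sign:
   phi(a_0[a_1, ..., a_n]) = (-1)^(|a_0| |[a_1, ..., a_n]|) f(a_1, ..., a_n)(a_0).
   In [of_form], m is the degree of phi; only the component of b of degree
   -(m + sdeg s) contributes. *)
Definition to_form f a s : k := (-1) ^ (hdeg a * sdeg s) * f s (hval a).

Definition of_form (m : int) (phi : helt A -> seq (helt A) -> k) :
    seq (helt A) -> dual A :=
  fun s (b : A) => let a0 := hpr (- (m + sdeg s)) b in
    (-1) ^ (hdeg a0 * sdeg s) * phi a0 s.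

Definition connes a s : chain :=
  let w := a :: s in
  [seq ((-1) ^ (sdeg (take i w) * sdeg (drop i w)),
        (hone, drop i w ++ take i w)) | i <- iota 1 (size s).+1].

Definition connes_dual (m : int) f : seq (helt A) -> dual A :=
  of_form (m - 1)
    (fun a s => (-1) ^ m * eval_chain (to_form f) (connes a s)).

(* The sign (-1)^(|x| (|a_0| + 1)) is the one for which x |-> i_x is compatible
   with the differentials over a graded algebra and the BV identity holds with
   the signs below; for A concentrated in degree 0 it is
   (-1)^(|x| sum_(1 <= i <= n) (|a_i| + 1)) for x of arity n. *)
Definition contr (p : int) (x : seq (helt A) -> A) a s : chain :=
  [seq ((-1) ^ (p * (hdeg a + 1)),
        (hpr (hdeg a + (p + sdeg (take n s))) (hval a * x (take n s)),
         drop n s)) | n <- iota 0 (size s).+1].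

Definition cap (p m : int) (x : seq (helt A) -> A) f : seq (helt A) -> dual A :=
  of_form (p + m)
    (fun a s => (-1) ^ (p * m) * eval_chain (to_form f) (contr p x a s)).

End DualOperations.

Definition castd (k : fieldType) (V : int -> lmodType k) (p q : int)
  (e : p = q) (x : V p) : V q := eq_rect p (fun i => V i : Type) x q e.

Arguments castd {k V p q} e x.

(* Equalities between elements whose degrees are only provably equal are
   stated for all proofs e of the equality of degrees. *)
Section BV.
Variables (k : fieldType) (V : int -> lmodType k).

Definition bilinear2 (s : int -> int -> int)
    (op : forall p q, V p -> V q -> V (s p q)) : Prop :=
  forall p q,
    (forall c x y (z : V q),
       op p q (c *: x + y) z = c *: op p q x z + op p q y z) /\
    (forall c (z : V p) x y,
       op p q z (c *: x + y) = c *: op p q z x + op p q z y).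

Variables (mul : forall p q, V p -> V q -> V (p + q)).
Variables (brk : forall p q, V p -> V q -> V (p + q - 1)).
Variables (Delta : forall p, V p -> V (p - 1)).

Definition is_gerstenhaber : Prop :=
  (bilinear2 mul /\ bilinear2 brk) /\
  [/\ forall p q r (x : V p) (y : V q) (z : V r)
        (e : p + q + r = p + (q + r)),
        mul x (mul y z) = castd e (mul (mul x y) z),
      forall p q (x : V p) (y : V q) (e : q + p = p + q),
        mul x y = (-1) ^ (p * q) *: castd e (mul y x),
      forall p q (x : V p) (y : V q) (e : q + p - 1 = p + q - 1),
        brk x y = - ((-1) ^ ((p - 1) * (q - 1)) *: castd e (brk y x)),
      forall p q r (x : V p) (y : V q) (z : V r)
        (e1 : p + q - 1 + r - 1 = p + (q + r - 1) - 1)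
        (e2 : q + (p + r - 1) - 1 = p + (q + r - 1) - 1),
        brk x (brk y z) = castd e1 (brk (brk x y) z)
          + (-1) ^ ((p - 1) * (q - 1)) *: castd e2 (brk y (brk x z))
    & forall p q r (x : V p) (y : V q) (z : V r)
        (e1 : p + q - 1 + r = p + (q + r) - 1)
        (e2 : q + (p + r - 1) = p + (q + r) - 1),
        brk x (mul y z) = castd e1 (mul (brk x y) z)
          + (-1) ^ ((p - 1) * q) *: castd e2 (mul y (brk x z))].

Definition is_BV : Prop :=
  [/\ is_gerstenhaber,
      forall p c (x y : V p), Delta (c *: x + y) = c *: Delta x + Delta y,
      forall p (x : V p), Delta (Delta x) = 0
    & forall p q (x : V p) (y : V q)
        (e1 : p - 1 + q = p + q - 1) (e2 : p + (q - 1) = p + q - 1),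
        brk x y = (-1) ^ p *: Delta (mul x y)
          - (-1) ^ p *: castd e1 (mul (Delta x) y)
          - castd e2 (mul x (Delta y))].

End BV.

Section DPD.
Variables (k : fieldType) (A : augDGA k).

(* The class of A <-eps- P -psi-> A^vee[d] in
   Ext^{-d}_{A^e}(A, A^vee) = HH^{-d}(A, A^vee), namely psi_* eps_*^{-1} [1]:
   a 0-cocycle t of C^*(A, P) is a morphism of DG bimodules from the bar
   resolution of A to P, and t lifts the identity of A up to homotopy when
   eps t is cohomologous to the unit cochain. *)
Definition roof_class (P : dgbimod A) (d : int) (eps : P -> reg A)
    (psi : P -> dual A) (c : HH (dual A) (- d)) : Prop :=
  exists t : seq (helt A) -> P,
    [/\ cocycle P 0 t,
        coboundary (reg A) 0 (fun s => eps (t s) - unit_cochain s)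
      & exists Z : cocycle (dual A) (- d) (fun s => psi (t s)), c = class Z].

(* A is a derived Poincare duality algebra of dimension d with class c.
   (A^vee[d])^n = (A^vee)^(n - d), so that A^vee[d] lives in degrees 0, ..., d
   when A does. *)
Definition DPD (d : int) (c : HH (dual A) (- d)) : Prop :=
  (exists (P : dgbimod A) (eps : P -> reg A) (psi : P -> dual A),
     [/\ semifree P, quasi_iso 0 eps, quasi_iso (- d) psi
       & roof_class eps psi c]) /\
  (exists f (Z : cocycle (dual A) (- d) f),
     c = class Z /\
     coboundary (dual A) (- d - 1) (connes_dual (- d) f)).

(* The operation on cohomology is well defined and given on representatives
   by the one on cochains. *)
Definition induced_cup (mul : forall p q,
    HH (reg A) p -> HH (reg A) q -> HH (reg A) (p + q)) : Prop :=
  forall p q x y (Zx : cocycle (reg A) p x) (Zy : cocycle (reg A) q y),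
  exists Z : cocycle (reg A) (p + q) (cup q x y),
    mul p q (class Zx) (class Zy) = class Z.

Definition induced_gerst (brk : forall p q,
    HH (reg A) p -> HH (reg A) q -> HH (reg A) (p + q - 1)) : Prop :=
  forall p q x y (Zx : cocycle (reg A) p x) (Zy : cocycle (reg A) q y),
  exists Z : cocycle (reg A) (p + q - 1) (gerst p q x y),
    brk p q (class Zx) (class Zy) = class Z.

Definition induced_connes (Bv : forall m,
    HH (dual A) m -> HH (dual A) (m - 1)) : Prop :=
  forall m f (Zf : cocycle (dual A) m f),
  exists Z : cocycle (dual A) (m - 1) (connes_dual m f),
    Bv m (class Zf) = class Z.

Definition induced_cap (d : int) (c : HH (dual A) (- d))
    (capc : forall p, HH (reg A) p -> HH (dual A) (p - d)) : Prop :=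
  forall p x f (Zx : cocycle (reg A) p x) (Zf : cocycle (dual A) (- d) f),
  c = class Zf ->
  exists Z : cocycle (dual A) (p - d) (cap p (- d) x f),
    capc p (class Zx) = class Z.

End DPD.

Arguments DPD {k A} d c.

(* Main.v *)
(* On C^*(A, A^vee), seen as forms on A (x) T(sA), Cartan's calculus holds up to
   the explicit homotopies of Rinehart, Getzler and Daletskii-Tsygan:
   [B, i_x] ~ +- L_x and [L_x, i_y] ~ +- i_[x, y].  Hence
   i_[x, y] = (-1)^|x| [[B, i_x], i_y] on HH^*(A, A^vee).

   The map x |-> i_x c is bijective.  If a morphism t from the bar resolution to
   P lifts the unit, then eps (x . t) ~ x and psi (x . t) = +- i_x (psi t), so it
   suffices that quasi-isomorphisms of bimodules induce bijections on HH^*(A, -).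
   Over a field their acyclic cones are contractible as graded vector spaces,
   and a contraction kills a cocycle arity by arity.

   Identities in HH^*(A, A) may therefore be checked on i_(-) c.  The Poisson and
   Jacobi identities become identities between words in B, i_x, i_y, i_z, which
   follow from B^2 = 0 and i_(x u y) = i_x i_y; the BV identity is Cartan's
   formula together with B c = 0 and the graded commutativity of the cup
   product. *)

(* One operation carries the computation: [insop], which inserts a cochain into the subwords of a
   word. The differential of [C^*(A, A)] is an insertion bracket with the structure cochain [mu],
   and on forms the differential becomes, up to sign, the Lie derivative along [mu]; facts about the
   differential are thus insertion identities for [mu], and the cocycle condition says that an
   insertion commutes with that of [mu]. Sums over positions become sums over cuts of words,
   reindexed by coassociativity of deconcatenation; signs are checked by running over the parities
   of the degrees. Capping with [x] is, up to sign, a left cup product with values in the bimodule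
   [dual A], so the Leibniz rule and the compatibility with bimodule maps are proved once for all
   bimodules. Cochains have components in all arities, hence an infinite sum of corrections of
   growing arity is again a cochain. Operations of different degrees act between different types.
   They are turned into endomorphisms of one space of families indexed by the degree, where the
   Poisson and Jacobi identities are linear algebra. *)
Require Import Defs.
From mathcomp Require Import all_boot all_order all_algebra.
From mathcomp Require Import boolp functions classical_sets.
From mathcomp Require Import ring zify.

Set Implicit Arguments.
Unset Strict Implicit.
Unset Printing Implicit Defensive.

Import GRing.Theory.
Local Open Scope ring_scope.

(* [lc_prepare R V] reduces an equation in the module [V] to one equation in [R]
   per atom. *)
Section LinearCombinations.
Variables (R : comPzRingType) (V : lmodType R).

Inductive lincomb :=
| LVar of nat | LZero | LAdd of lincomb & lincomb | LOpp of lincomb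
| LScale of R & lincomb.

Fixpoint lc_eval (env : seq V) e : V :=
  match e with
  | LVar n => nth 0 env n
  | LZero => 0
  | LAdd a b => lc_eval env a + lc_eval env b
  | LOpp a => - lc_eval env a
  | LScale c a => c *: lc_eval env a
  end.

Fixpoint lc_coef e (n : nat) : R :=
  match e with
  | LVar m => if eqn m n then 1 else 0
  | LZero => 0
  | LAdd a b => lc_coef a n + lc_coef b n
  | LOpp a => - lc_coef a n
  | LScale c a => c * lc_coef a n
  end.

Fixpoint lc_same e1 e2 (n : nat) : Prop :=
  if n is n'.+1 then lc_coef e1 n' = lc_coef e2 n' /\ lc_same e1 e2 n'
  else True.

Lemma lc_evalE env e :
  lc_eval env e = \sum_(i < size env) lc_coef e i *: nth 0 env i.
Proof.
elim: e => [m||a IHa b IHb|a IH|c a IH] /=.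
- case: (ltnP m (size env)) => [lt_m|le_m].
    rewrite (bigD1 (Ordinal lt_m)) //= big1 => [|i /eqP ne_im].
      by case: eqnP => // _; rewrite addr0 scale1r.
    by case: eqnP => [E|]; [case: ne_im; apply: val_inj | rewrite scale0r].
  rewrite nth_default // big1 // => i _.
  case: eqnP => [mi|_]; last by rewrite scale0r.
  by move: le_m; rewrite mi leqNgt ltn_ord.
- by rewrite big1 // => i _; rewrite scale0r.
- by rewrite IHa IHb -big_split; apply: eq_bigr => i _; rewrite /= -scalerDl.
- by rewrite IH -sumrN; apply: eq_bigr => i _; rewrite -scaleNr.
- by rewrite IH scaler_sumr; apply: eq_bigr => i _; rewrite scalerA.
Qed.

Lemma lc_eq env e1 e2 : lc_same e1 e2 (size env) ->
  lc_eval env e1 = lc_eval env e2.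
Proof.
move=> E; rewrite !lc_evalE; apply: eq_bigr => i _; congr (_ *: _).
elim: (size env) i E => [|n IH] [i /= lt_i] // [En Es].
by move: lt_i; rewrite ltnS leq_eqVlt => /predU1P[->|lt_i] //; apply: (IH (Ordinal lt_i)).
Qed.

End LinearCombinations.

Ltac lc_mem x env :=
  lazymatch env with
  | nil => false
  | cons x _ => true
  | cons _ ?env' => lc_mem x env'
  end.

Ltac lc_atoms V t env :=
  lazymatch t with
  | @GRing.add _ ?a ?b => let env := lc_atoms V a env in lc_atoms V b env
  | @GRing.opp _ ?a => lc_atoms V a env
  | @GRing.scale _ _ _ ?a => lc_atoms V a env
  | @GRing.zero _ => env
  | _ => match lc_mem t env with
         | true => env
         | false => constr:(@cons V t env)
         end
  end.

Ltac lc_index x env :=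
  lazymatch env with
  | cons x _ => constr:(O)
  | cons _ ?env' => let n := lc_index x env' in constr:(S n)
  end.

Ltac lc_reify R t env :=
  lazymatch t with
  | @GRing.add _ ?a ?b =>
      let a := lc_reify R a env in let b := lc_reify R b env in
      constr:(@LAdd R a b)
  | @GRing.opp _ ?a => let a := lc_reify R a env in constr:(@LOpp R a)
  | @GRing.scale _ _ ?c ?a =>
      let a := lc_reify R a env in constr:(@LScale R c a)
  | @GRing.zero _ => constr:(@LZero R)
  | _ => let n := lc_index t env in constr:(@LVar R n)
  end.

Ltac lc_prepare R V :=
  lazymatch goal with
  | |- @eq _ ?l ?r =>
      let env := lc_atoms V l (@nil V) in
      let env := lc_atoms V r env in
      let e1 := lc_reify R l env in
      let e2 := lc_reify R r env in
      apply: (@lc_eq R V env e1 e2);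
      cbn [lc_same lc_coef size eqn]; repeat split
  end.

(** * Signs, splittings of words and insertions *)

Section Parity.

(** Sign exponents are integer polynomials in degrees, and only their class modulo 2 matters. As a
    boolean it allows an identity of signs to be proved by cases on the parities of its atoms. *)
Definition par (z : int) : bool := odd `|z|%N.

Lemma parD a b : par (a + b) = par a (+) par b.
Proof. by rewrite /par; lia. Qed.

Lemma parN a : par (- a) = par a.
Proof. by rewrite /par abszN. Qed.

Lemma parM a b : par (a * b) = par a && par b.
Proof. by rewrite /par abszM oddM. Qed.

Lemma par0 : par 0 = false. Proof. by []. Qed.
Lemma par1 : par 1 = true. Proof. by []. Qed.
Lemma par2 : par 2 = false. Proof. by []. Qed.

Variable k : fieldType.

Lemma sg_par (z : int) : (-1) ^ z = (-1) ^+ (par z) :> k.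
Proof.
case: z => n; first by rewrite -exprnP -[LHS]signr_odd.
by rewrite NegzE sgnN parN -exprnP -[LHS]signr_odd.
Qed.

Lemma sg_eq (a b : int) : par a = par b -> (-1) ^ a = (-1) ^ b :> k.
Proof. by rewrite !sg_par => ->. Qed.

Lemma sg_opp (a : int) : - (-1) ^ a = (-1) ^ (a + 1) :> k.
Proof. by rewrite sgnM expr1z mulrN1. Qed.

End Parity.

Definition parE := (parD, parN, parM, par0, par1, par2).

Ltac par_cases :=
  repeat match goal with
  | |- context [par ?z] => let b := fresh "b" in set b := par z; case: b
  end.

Ltac par_solve := rewrite ?parE; par_cases; reflexivity.

(** * Sums over the cuts of a word *)

Section Splittings.
Variables (T : Type).
Implicit Types (s u v w : seq T).

Definition splits s : seq (seq T * seq T) :=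
  [seq (take i s, drop i s) | i <- iota 0 (size s).+1].

Lemma splits_nil : splits [::] = [:: ([::], [::])].
Proof. by []. Qed.

Lemma splits_cons a s :
  splits (a :: s) = ([::], a :: s) :: [seq (a :: t.1, t.2) | t <- splits s].
Proof.
rewrite /splits -[(size (a :: s)).+1]/(1 + (size s).+1)%N iotaD map_cat.
by rewrite (iotaDl 1 0) -!map_comp.
Qed.

Section Sums.
Variable V : zmodType.
Implicit Types (G H : seq T -> seq T -> V).

(** The summand receives the two halves instead of a position, so that reindexing needs no
    arithmetic on indices, only the structural rules below. *)
Definition spl s G : V := \sum_(t <- splits s) G t.1 t.2.

Lemma spl_nil G : spl [::] G = G [::] [::].
Proof. by rewrite /spl splits_nil big_seq1. Qed.

Lemma spl_cons a s G :
  spl (a :: s) G = G [::] (a :: s) + spl s (fun u v => G (a :: u) v).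
Proof. by rewrite /spl splits_cons big_cons big_map. Qed.

Lemma eq_spl s G H : (forall u v, u ++ v = s -> G u v = H u v) ->
  spl s G = spl s H.
Proof.
elim: s G H => [|a s IH] G H E; first by rewrite !spl_nil E.
rewrite !spl_cons E //; congr (_ + _); apply: IH => u v uv.
by apply: E; rewrite /= uv.
Qed.

Lemma spl_0 s : spl s (fun _ _ => 0) = 0.
Proof. exact: big1. Qed.

Lemma spl_add s G H : spl s (fun u v => G u v + H u v) = spl s G + spl s H.
Proof. exact: big_split. Qed.

Lemma spl_opp s G : spl s (fun u v => - G u v) = - spl s G.
Proof. exact: sumrN. Qed.

Lemma spl_cat_cons u x w G :
  spl (u ++ x :: w) G = spl u (fun u1 u2 => G u1 (u2 ++ x :: w))
                      + spl w (fun w1 w2 => G (u ++ x :: w1) w2).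
Proof.
elim: u G => [|a u IH] G /=; first by rewrite spl_nil spl_cons.
by rewrite !spl_cons IH addrA.
Qed.

Lemma spl_rcons s a G : spl (rcons s a) G =
  spl s (fun u v => G u (rcons v a)) + G (rcons s a) [::].
Proof.
rewrite -cats1 spl_cat_cons spl_nil; congr (_ + _).
by apply: eq_spl => u v _; rewrite cats1.
Qed.

(** Coassociativity of deconcatenation: a word is cut in three by cutting again either its first or
    its second half. With [spl_exchange] it accounts for most changes of summation order below. *)
Lemma spl_assoc s (G : seq T -> seq T -> seq T -> V) :
  spl s (fun r w => spl r (fun u v => G u v w)) =
  spl s (fun u r => spl r (fun v w => G u v w)).
Proof.
elim: s G => [|a s IH] G; first by rewrite !spl_nil.
rewrite !spl_cons spl_nil.
under [X in _ + X = _]eq_spl => u v _ do rewrite spl_cons.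
by rewrite spl_add IH addrA.
Qed.

(** Cuts with a marked letter. They serve to compare two sums over cuts in which one letter passes
    across the cut: [spl_spl1_r] marks the letter after the cut, [spl_spl1_l] the letter before it,
    each setting one extreme cut apart. *)
Definition spl1 s (K : seq T -> T -> seq T -> V) : V :=
  spl s (fun u v => if v is c :: v' then K u c v' else 0).

Lemma spl1_nil K : spl1 [::] K = 0.
Proof. by rewrite /spl1 spl_nil. Qed.

Lemma spl1_cons a s K :
  spl1 (a :: s) K = K [::] a s + spl1 s (fun u c v => K (a :: u) c v).
Proof. by rewrite /spl1 spl_cons. Qed.

Lemma eq_spl1 s K K2 :
  (forall u c v, u ++ c :: v = s -> K u c v = K2 u c v) ->
  spl1 s K = spl1 s K2.
Proof. by move=> E; apply: eq_spl => u [|c v] // uv; apply: E. Qed.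

Lemma spl_spl1_r s G :
  spl s G = G s [::] + spl1 s (fun u c v => G u (c :: v)).
Proof.
elim: s G => [|a s IH] G; first by rewrite spl_nil spl1_nil addr0.
by rewrite spl_cons spl1_cons IH addrCA.
Qed.

Lemma spl_spl1_l s G :
  spl s G = G [::] s + spl1 s (fun u c v => G (rcons u c) v).
Proof.
elim: s G => [|a s IH] G; first by rewrite spl_nil spl1_nil addr0.
by rewrite spl_cons spl1_cons IH.
Qed.

Lemma spl_only_nil s G : (forall u v, u <> [::] -> G u v = 0) ->
  spl s G = G [::] s.
Proof.
move=> E; rewrite spl_spl1_l -[RHS]addr0 -(spl_0 s); congr (_ + _).
by apply: eq_spl => u [|c v] //= _; rewrite E //; case: u.
Qed.

End Sums.

Lemma spl_additive (V W : zmodType) (h : V -> W) s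
    (G : seq T -> seq T -> V) :
  h 0 = 0 -> (forall x y, h (x + y) = h x + h y) ->
  h (spl s G) = spl s (fun u v => h (G u v)).
Proof. by move=> h0 hD; apply: (big_morph h hD h0). Qed.

Lemma spl_scale (R : pzRingType) (V : lmodType R) s (c : R)
    (G : seq T -> seq T -> V) :
  spl s (fun u v => c *: G u v) = c *: spl s G.
Proof. by rewrite /spl scaler_sumr. Qed.

Lemma spl_exchange (V : zmodType) s t
    (G : seq T -> seq T -> seq T -> seq T -> V) :
  spl s (fun u v => spl t (G u v)) = spl t (fun u' v' => spl s (fun u v => G u v u' v')).
Proof. exact: exchange_big. Qed.

End Splittings.

Section Insertion.
Variables (k : fieldType) (A : augDGA k).
Implicit Types (s u v w : seq (helt A)).

Lemma sdeg_nil : @sdeg k A [::] = 0.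
Proof. exact: big_nil. Qed.

Lemma sdeg_cons (a : helt A) s : sdeg (a :: s) = hdeg a - 1 + sdeg s.
Proof. exact: big_cons. Qed.

Lemma sdeg_cat u v : sdeg (u ++ v) = sdeg u + sdeg v.
Proof. exact: big_cat. Qed.

Lemma sdeg_rcons s (a : helt A) : sdeg (rcons s a) = sdeg s + (hdeg a - 1).
Proof. by rewrite -cats1 sdeg_cat sdeg_cons sdeg_nil addr0. Qed.

(** The value of [y] as a homogeneous letter. For a cochain of degree [q] the projection does
    nothing, see [hval_ins]; it makes the insertion defined for every function [y]. *)
Definition ins (q : int) (y : seq (helt A) -> A) s : helt A :=
  hpr (q + sdeg s) (y s).

Lemma hdeg_ins q y s : hdeg (ins q y s) = q + sdeg s.
Proof. by []. Qed.

Lemma hdeg_mul (a b : helt A) : hdeg (hmul a b) = hdeg a + hdeg b.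
Proof. by []. Qed.

Lemma hdeg_d (a : helt A) : hdeg (hd a) = hdeg a + 1.
Proof. by []. Qed.

Lemma hdeg_one : hdeg (@hone k A) = 0.
Proof. by []. Qed.

Lemma hdeg_pr q (x : A) : hdeg (hpr q x) = q.
Proof. by []. Qed.

End Insertion.

Definition sdegE := (sdeg_cat, sdeg_rcons, sdeg_cons, sdeg_nil, hdeg_ins,
  hdeg_mul, hdeg_d, hdeg_one, hdeg_pr).

Ltac sg_solve := apply: sg_eq; rewrite ?sdegE; par_solve.

Ltac sg_collect := rewrite ?scalerA -?sgnM; congr (_ *: _); first sg_solve.

(** Once the parities of the degrees are fixed every sign is 1 or -1, which leaves finitely many
    identities for [ring]. *)
Ltac sg_ring :=
  rewrite ?sdegE ?sg_par ?parE; par_cases; rewrite /= ?expr0 ?expr1; ring.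

Ltac lincomb R V := lc_prepare R V; sg_ring.

(** * Insertion operators and the pre-Lie identity *)

Section InsertionOperator.
Variables (k : fieldType) (A : augDGA k).
Implicit Types (s u v w : seq (helt A)) (y z : seq (helt A) -> A).

Section Values.
Variable V : lmodType k.
Implicit Types F G : seq (helt A) -> V.

Definition multilinear F : Prop := forall s1 s2 q c (a b : A),
  F (s1 ++ hpr q (c *: a + b) :: s2) =
  c *: F (s1 ++ hpr q a :: s2) + F (s1 ++ hpr q b :: s2).

(* [circ q x y] for an arbitrary function [F] of words in place of [x]. *)
Definition insop (q : int) y F s : V :=
  spl s (fun u r => spl r (fun v w =>
    (-1) ^ ((q + 1) * sdeg u) *: F (u ++ ins q y v :: w))).

Section Multilinear.
Variables (F : seq (helt A) -> V).
Hypothesis mF : multilinear F.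

Lemma multilinearD s1 s2 q (a b : A) : F (s1 ++ hpr q (a + b) :: s2) =
  F (s1 ++ hpr q a :: s2) + F (s1 ++ hpr q b :: s2).
Proof. by have := mF s1 s2 q 1 a b; rewrite !scale1r. Qed.

Lemma multilinear0 s1 s2 q : F (s1 ++ hpr q 0 :: s2) = 0.
Proof.
by apply: (addrI (F (s1 ++ hpr q 0 :: s2))); rewrite -multilinearD !addr0.
Qed.

Lemma multilinearZ s1 s2 q c (a : A) :
  F (s1 ++ hpr q (c *: a) :: s2) = c *: F (s1 ++ hpr q a :: s2).
Proof. by have := mF s1 s2 q c a 0; rewrite !addr0 multilinear0 addr0. Qed.

Lemma multilinear_spl T (t : seq T) s1 s2 q (G : seq T -> seq T -> A) :
  F (s1 ++ hpr q (spl t G) :: s2) =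
  spl t (fun i j => F (s1 ++ hpr q (G i j) :: s2)).
Proof.
apply: (spl_additive (h := fun x => F (s1 ++ hpr q x :: s2))).
  exact: multilinear0.
by move=> a b; rewrite multilinearD.
Qed.

Lemma multilinear_catl s1 : multilinear (fun s => F (s1 ++ s)).
Proof. by move=> t1 t2 q c a b; rewrite !(catA s1) mF. Qed.

End Multilinear.

Lemma insop_nil q y F : insop q y F [::] = F [:: ins q y [::]].
Proof. by rewrite /insop !spl_nil sdeg_nil mulr0 expr0z scale1r. Qed.

Lemma eq_insop q y F G s : F =1 G -> insop q y F s = insop q y G s.
Proof. by move/funext->. Qed.

Lemma insopD q y F G s :
  insop q y (fun s => F s + G s) s = insop q y F s + insop q y G s.
Proof.
rewrite /insop -spl_add; apply: eq_spl => u r _; rewrite -spl_add.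
by apply: eq_spl => v w _; rewrite scalerDr.
Qed.

Lemma insopZ q y F c s :
  insop q y (fun s => c *: F s) s = c *: insop q y F s.
Proof.
rewrite /insop -spl_scale; apply: eq_spl => u r _; rewrite -spl_scale.
by apply: eq_spl => v w _; rewrite !scalerA mulrC.
Qed.

Lemma insop0 q y s : insop q y (fun _ => 0) s = 0.
Proof.
rewrite /insop -[RHS](spl_0 V s); apply: eq_spl => u r _.
by rewrite -[RHS](spl_0 V r); apply: eq_spl => v w _; rewrite scaler0.
Qed.

Lemma insop_cons q y F a s : insop q y F (a :: s) =
  spl (a :: s) (fun v w => F (ins q y v :: w))
  + (-1) ^ ((q + 1) * (hdeg a - 1)) *: insop q y (fun t => F (a :: t)) s.
Proof.
rewrite {1}/insop spl_cons; congr (_ + _).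
  by apply: eq_spl => v w _; rewrite sdeg_nil mulr0 expr0z scale1r.
rewrite /insop -spl_scale; apply: eq_spl => u r _; rewrite -spl_scale.
by apply: eq_spl => v w _; sg_collect.
Qed.

(** The inserted block lies before the letter [a], after it, or contains it. *)
Lemma insop_cat_cons q y F v (a : helt A) u :
  insop q y F (v ++ a :: u) =
    insop q y (fun v' => F (v' ++ a :: u)) v
  + (-1) ^ ((q + 1) * sdeg (rcons v a)) *:
      insop q y (fun u' => F (v ++ a :: u')) u
  + spl v (fun v1 v2 => spl u (fun u1 u2 =>
      (-1) ^ ((q + 1) * sdeg v1) *: F (v1 ++ ins q y (v2 ++ a :: u1) :: u2))).
Proof.
rewrite {1}/insop spl_cat_cons.
under eq_spl => v1 v2 _ do rewrite spl_cat_cons.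
rewrite spl_add addrAC; congr (_ + _ + _).
  apply: eq_spl => v1 v2 _; apply: eq_spl => x x' _.
  by rewrite -catA cat_cons.
rewrite /insop -spl_scale; apply: eq_spl => u1 u2 _; rewrite -spl_scale.
by apply: eq_spl => x x' _; rewrite -catA cat_cons; sg_collect.
Qed.

(** Insertion is dual to the coderivation that [y] defines on the tensor coalgebra: after the block
    has collapsed to one letter, that letter falls into one of the two halves of the cut. *)
Lemma insop_spl q y (G : seq (helt A) -> seq (helt A) -> V) s :
  insop q y (fun t => spl t G) s =
  spl s (fun u v => insop q y (fun u' => G u' v) u)
  + spl s (fun u v => (-1) ^ ((q + 1) * sdeg u) *: insop q y (G u) v).
Proof.
rewrite {1}/insop.
under eq_spl => u r _ do under eq_spl => v w _ do
  rewrite spl_cat_cons scalerDr -!spl_scale.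
under eq_spl => u r _ do rewrite spl_add.
rewrite spl_add addrC; congr (_ + _).
  rewrite /insop spl_assoc; apply: eq_spl => u r _.
  by rewrite spl_assoc.
transitivity (spl s (fun u r => spl u (fun u1 u2 => spl r (fun v w =>
    (-1) ^ ((q + 1) * (sdeg u1 + sdeg u2)) *: G u1 (u2 ++ ins q y v :: w))))).
  apply: eq_spl => u r _; rewrite spl_exchange; apply: eq_spl => u1 u2 <-.
  by apply: eq_spl => v w _; sg_collect.
rewrite spl_assoc; apply: eq_spl => u1 r1 _.
rewrite /insop -spl_scale; apply: eq_spl => u2 r _; rewrite -spl_scale.
by apply: eq_spl => v w _; sg_collect.
Qed.

End Values.

Lemma circE q y z s : circ q y z s = insop q z y s.
Proof.
rewrite /circ /insop /spl big_map /index_iota subn0; apply: eq_bigr => j _.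
rewrite big_map subn0 size_drop; apply: eq_bigr => n _ /=.
by rewrite drop_drop addnC.
Qed.

(** The part of the double insertion in which the block of [z] lies to the left of that of [y]. *)
Definition insop2 (V : lmodType k) q y r z (F : seq (helt A) -> V) s : V :=
  spl s (fun u t => spl t (fun v w => (-1) ^ ((q + 1) * sdeg u) *:
    insop r z (fun u' => F (u' ++ ins q y v :: w)) u)).

(** The second block, that of [z], is to the left of the letter produced by [y], to its right, or
    contains it; in the last case both together form one insertion of [circ q z y]. *)
Lemma insop_insopE (V : lmodType k) q r y z (F : seq (helt A) -> V) s :
  multilinear F ->
  insop q y (insop r z F) s =
    insop2 q y r z F s + (-1) ^ ((q + 1) * (r + 1)) *: insop2 r z q y F s
  + insop (q + r - 1) (circ q z y) F s.
Proof.
move=> mF.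
(* [P] and [Q] collect the disjoint blocks, the second insertion being on the left in [P] and on the
   right in [Q]. *)
pose P q y r z := insop2 q y r z F s.
pose Q q y r z := spl s (fun u t => spl t (fun v w =>
  (-1) ^ ((q + 1) * sdeg u + (r + 1) * sdeg (rcons u (ins q y v))) *:
    insop r z (fun w' => F (u ++ ins q y v :: w')) w)).
have E p x p' x' : insop p x (insop p' x' F) s =
    P p x p' x' + Q p x p' x' + insop (p + p' - 1) (circ p x' x) F s.
  rewrite {1}/insop.
  under eq_spl => u t _ do under eq_spl => v w _ do
    rewrite insop_cat_cons !scalerDr scalerA -sgnM.
  under eq_spl => u t _ do rewrite !spl_add.
  rewrite !spl_add; congr (_ + _ + _).
  transitivity (spl s (fun u1 t1 => spl t1 (fun u2 t => spl t (fun v t2 =>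
      spl t2 (fun w1 w2 => (-1) ^ ((p + 1) * (sdeg u1 + sdeg u2)
        + (p' + 1) * sdeg u1) *:
          F (u1 ++ ins p' x' (u2 ++ ins p x v :: w1) :: w2)))))).
    rewrite -[RHS]spl_assoc; apply: eq_spl => u t _.
    rewrite [RHS]spl_exchange; apply: eq_spl => v w _.
    rewrite -spl_scale; apply: eq_spl => u1 u2 E1; rewrite -spl_scale.
    by apply: eq_spl => w1 w2 _; rewrite -E1; sg_collect.
  rewrite /insop; apply: eq_spl => U R ER.
  transitivity (spl R (fun T W => spl T (fun u2 r => spl r (fun v w1 =>
     (-1) ^ ((p + 1) * (sdeg U + sdeg u2) + (p' + 1) * sdeg U) *:
       F (U ++ ins p' x' (u2 ++ ins p x v :: w1) :: W))))).
    rewrite spl_assoc; apply: eq_spl => u2 X _.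
    by rewrite spl_assoc.
  apply: eq_spl => T W _.
  rewrite /ins circE /insop multilinear_spl // -spl_scale.
  apply: eq_spl => u2 r2 E1; rewrite multilinear_spl // -spl_scale.
  apply: eq_spl => v w1 E2; rewrite multilinearZ // scalerA -sgnM.
  have -> : p + p' - 1 + sdeg T = p' + sdeg (u2 ++ ins p x v :: w1).
    by rewrite -E1 -E2 !sdegE; ring.
  by congr (_ *: _); apply: sg_eq; rewrite ?sdegE; par_solve.
(* Both sides run over the same words with two outputs. They differ in which block is cut out first,
   hence by the sign of exchanging the two insertions. *)
have QP p x p' x' : Q p x p' x' = (-1) ^ ((p + 1) * (p' + 1)) *: P p' x' p x.
  rewrite /P /insop2 /Q -spl_scale.
  transitivity (spl s (fun u t => spl t (fun v w => spl w (fun w1 w' =>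
    spl w' (fun w2 w3 =>
    (-1) ^ ((p + 1) * sdeg u + (p' + 1) * (sdeg (rcons u (ins p x v)) + sdeg w1))
       *: F (u ++ ins p x v :: w1 ++ ins p' x' w2 :: w3)))))).
    apply: eq_spl => u t _; apply: eq_spl => v w _.
    rewrite /insop -spl_scale; apply: eq_spl => w1 w' _; rewrite -spl_scale.
    by apply: eq_spl => w2 w3 _; sg_collect.
  transitivity (spl s (fun U t => spl U (fun u u' => spl u' (fun v w1 =>
    spl t (fun w2 w3 =>
    (-1) ^ ((p + 1) * sdeg u + (p' + 1) * (sdeg (rcons u (ins p x v)) + sdeg w1))
       *: F (u ++ ins p x v :: w1 ++ ins p' x' w2 :: w3)))))).
    rewrite spl_assoc; apply: eq_spl => u t _.
    by rewrite spl_assoc.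
  apply: eq_spl => U t EU; rewrite -spl_scale.
  under eq_spl => u u' _ do rewrite spl_exchange.
  rewrite spl_exchange; apply: eq_spl => w2 w3 _.
  rewrite /insop scalerA -spl_scale; apply: eq_spl => u u' E1; rewrite -spl_scale.
  apply: eq_spl => v w1 E2.
  by rewrite -catA cat_cons -E1 -E2; sg_collect.
by rewrite E QP.
Qed.

(** The disjoint insertions are symmetric in the two cochains, so they cancel in the graded
    commutator and only the nested ones remain: the pre-Lie identity, which makes insertion an
    action of the bracket. *)
Lemma insop_insop (V : lmodType k) q r y z (F : seq (helt A) -> V) s :
  multilinear F ->
  insop q y (insop r z F) s =
    (-1) ^ ((q + 1) * (r + 1)) *: insop r z (insop q y F) s
  + insop (q + r - 1) (circ q z y) F s
  - (-1) ^ ((q + 1) * (r + 1)) *: insop (q + r - 1) (circ r y z) F s.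
Proof.
move=> mF; rewrite !insop_insopE //; have -> : r + q - 1 = q + r - 1 by ring.
lincomb k V.
Qed.

End InsertionOperator.

Section MoreSplittings.
Variables (T : Type) (V : zmodType).

Lemma spl_eq0 (s : seq T) (G : seq T -> seq T -> V) :
  (forall u v, u ++ v = s -> G u v = 0) -> spl s G = 0.
Proof. by move=> E; rewrite -[RHS](spl_0 _ s); apply: eq_spl. Qed.

Lemma spl_only_nil_r (s : seq T) (G : seq T -> seq T -> V) :
  (forall u v, v <> [::] -> G u v = 0) -> spl s G = G s [::].
Proof.
move=> E; rewrite spl_spl1_r -[RHS]addr0 -(spl_0 _ s); congr (_ + _).
by apply: eq_spl => u [|c v] //= _; rewrite E.
Qed.

Lemma spl1_first a (s : seq T) (G : seq T -> T -> seq T -> V) :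
  (forall u c v, u <> [::] -> G u c v = 0) -> spl1 (a :: s) G = G [::] a s.
Proof.
move=> E; rewrite spl1_cons -[RHS]addr0 -(spl_0 _ s); congr (_ + _).
by apply: eq_spl => u [|c v] //= _; rewrite E.
Qed.

Lemma spl1_rcons (s : seq T) a (G : seq T -> T -> seq T -> V) :
  spl1 (rcons s a) G = spl1 s (fun u c v => G u c (rcons v a)) + G s a [::].
Proof.
elim: s G => [|b s IH] G; first by rewrite /= spl1_cons !spl1_nil addrC.
by rewrite rcons_cons !spl1_cons IH addrA.
Qed.

Lemma spl1_last (s : seq T) a (G : seq T -> T -> seq T -> V) :
  (forall u c v, v <> [::] -> G u c v = 0) -> spl1 (rcons s a) G = G s a [::].
Proof.
move=> E; rewrite spl1_rcons -[RHS]add0r -(spl_0 _ s); congr (_ + _).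
by apply: eq_spl => u [|c v] //= _; rewrite E //; case: (v).
Qed.

End MoreSplittings.

(** * The bar differential as insertion of the structure cochain *)

Section BarDifferential.
Variables (k : fieldType) (A : augDGA k).
Implicit Types (s u v w : seq (helt A)) (a b : helt A).

Lemma hval_hpr q (x : A) : hval (hpr q x) = gpr A q x.
Proof. by []. Qed.

Lemma hmul_1l (c : helt A) : hmul hone c = c.
Proof. by apply: helt_inj; [rewrite /= add0r | rewrite hvalM hval1 mul1r]. Qed.

Lemma hmul_1r (c : helt A) : hmul c hone = c.
Proof. by apply: helt_inj; [rewrite /= addr0 | rewrite hvalM hval1 mulr1]. Qed.

Lemma hd_one : @hd k A hone = hpr 1 0.
Proof.
apply: helt_inj => //; rewrite hvald hval1 hval_hpr linear0.
have := dga_dM (1 : A) (gpr1 A); rewrite mul1r expr0z scale1r mulr1 mul1r.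
by move=> E; apply: (addrI (dga_d A 1)); rewrite addr0 -E.
Qed.

Lemma hprK a : hpr (hdeg a) (hval a) = a.
Proof. by apply: helt_inj => //=; rewrite hval_pr. Qed.

(* The A-infinity structure of [A]: the Hochschild differential of C^*(A, A) is
   the bracket with [mu]. *)
Definition mu s : A :=
  match s with
  | [:: a] => dga_d A (hval a)
  | [:: a; b] => (-1) ^ (hdeg a) *: (hval a * hval b)
  | _ => 0
  end.

Lemma multilinear_mu : multilinear mu.
Proof.
move=> [|a [|b s1]] [|c s2] q e x y //=; rewrite ?scaler0 ?addr0 //.
- by rewrite !linearP.
- case: s2 => [|? ?]; last by rewrite scaler0 addr0.
  by rewrite linearP mulrDl scalerDr -scalerAl !scalerA mulrC.
- by rewrite linearP mulrDr scalerDr -scalerAr !scalerA mulrC.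
- by case: s1 => [|? ?] /=; rewrite scaler0 addr0.
- by case: s1 => [|? ?] /=; rewrite scaler0 addr0.
Qed.

Lemma mu_gt2 s : (2 < size s)%N -> mu s = 0.
Proof. by case: s => [|? [|? [|? ?]]]. Qed.

Lemma ins_mu1 a : ins 2 mu [:: a] = hd a.
Proof.
have E : 2 + sdeg [:: a] = hdeg a + 1 by rewrite !sdegE; ring.
by apply: helt_inj; [exact: E | rewrite /ins !hval_hpr E].
Qed.

Section Values.
Variables (V : lmodType k) (F : seq (helt A) -> V).
Hypothesis mF : multilinear F.

Lemma multilinear_mu2 s1 a b s2 : F (s1 ++ ins 2 mu [:: a; b] :: s2) =
  (-1) ^ (hdeg a) *: F (s1 ++ hmul a b :: s2).
Proof.
rewrite /ins /= multilinearZ //; congr (_ *: F (_ ++ hpr _ _ :: _)).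
by rewrite !sdegE; ring.
Qed.

Lemma multilinear_mu_gt2 s1 a b c t s2 :
  F (s1 ++ ins 2 mu [:: a, b, c & t] :: s2) = 0.
Proof. exact: multilinear0. Qed.

Lemma multilinear_mu_nil s1 s2 : F (s1 ++ ins 2 mu [::] :: s2) = 0.
Proof. exact: multilinear0. Qed.

Lemma multilinear_behead a : multilinear (fun s => F (a :: s)).
Proof. exact: (multilinear_catl mF [:: a]). Qed.

Lemma insop_rcons q y s a : insop q y F (rcons s a) =
  insop q y (fun t => F (rcons t a)) s
  + spl (rcons s a) (fun u v =>
      (-1) ^ ((q + 1) * sdeg u) *: F (rcons u (ins q y v))).
Proof.
rewrite /insop -[in LHS]spl_assoc spl_rcons; congr (_ + _).
  rewrite spl_assoc; apply: eq_spl => u r _; apply: eq_spl => v w _.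
  by rewrite -rcons_cons -rcons_cat.
by apply: eq_spl => u v _; rewrite cats1.
Qed.

Lemma insop_mu_nil : insop 2 mu F [::] = 0.
Proof. by rewrite insop_nil (multilinear_mu_nil [::]). Qed.

(** [mu] vanishes on the empty word and on more than two letters, so only the blocks of length one
    and two can start at the first letter. *)
Lemma insop_mu_cons a s : insop 2 mu F (a :: s) =
  F (hd a :: s)
  + (if s is b :: s' then (-1) ^ (hdeg a) *: F (hmul a b :: s') else 0)
  + (-1) ^ (hdeg a - 1) *: insop 2 mu (fun t => F (a :: t)) s.
Proof.
rewrite insop_cons; congr (_ + _); last by sg_collect.
rewrite !spl_cons (multilinear_mu_nil [::]) add0r.
case: s => [|b s]; first by rewrite spl_nil ins_mu1 addr0.
rewrite spl_cons ins_mu1; congr (_ + _).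
rewrite spl_only_nil => [|u v]; first exact: (multilinear_mu2 [::]).
by case: u => // c u _; apply: (multilinear_mu_gt2 [::]).
Qed.

End Values.

(** The blocks of length one of [mu] give the sum over the differentials of the letters, those of
    length two the sum over products of neighbours. *)
Lemma delta_sumE (V : lmodType k) p (F : seq (helt A) -> V) s : multilinear F ->
  \sum_(0 <= i < size s) (-1) ^ (p + sdeg (take i s)) *:
      F (take i s ++ hd (nth hone s i) :: drop i.+1 s)
  - \sum_(0 <= i < (size s).-1) (-1) ^ (p + sdeg (take i.+1 s)) *:
      F (take i s ++ hmul (nth hone s i) (nth hone s i.+1) :: drop i.+2 s) =
  (-1) ^ p *: insop 2 mu F s.
Proof.
elim: s p F => [|a s IH] p F mF.
  by rewrite !big_nil insop_mu_nil // scaler0 subr0.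
rewrite insop_mu_cons // big_nat_recl //= drop0 sdeg_nil addr0.
(* The letter [a] belongs to every nonempty prefix of the remaining terms; its shifted degree is
   absorbed in [p], hence the induction over all [p]. *)
have := IH (p + (hdeg a - 1)) _ (multilinear_behead mF a).
set I := insop _ _ _ _; rewrite scalerDr scalerA -sgnM => <-.
under eq_bigr => i _ do rewrite sdeg_cons addrA.
case: s {IH I} => [|b s].
  by rewrite /= !big_nil; lincomb k V.
rewrite [in X in _ - X]big_nat_recl //= ?take0 ?drop0.
under [X in _ - (_ + X)]eq_bigr => i _ do rewrite sdeg_cons addrA.
rewrite sdeg_cons sdeg_nil.

set X := \sum_(_ <= i < _) _; set Y := \sum_(_ <= i < _) _.
lincomb k V.
Qed.

End BarDifferential.

Arguments mu {k A} s.

(** * The Hochschild differential and the operations on C^*(A, A) *)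

Section Differential.
Variables (k : fieldType) (A : augDGA k) (M : dgbimod A).
Implicit Types (s u v w : seq (helt A)) (a b : helt A) (F : seq (helt A) -> M).

Definition bdop p F s : M := bd (p + sdeg s) (F s).

Definition lop p F s : M :=
  if s is a :: s' then - ((-1) ^ (p * (hdeg a + 1)) *: lact a (F s')) else 0.

Definition rop p F s : M :=
  if s is a :: s' then
    (-1) ^ (p + sdeg (belast a s')) *: ract (F (belast a s')) (last a s')
  else 0.

Lemma rop_rcons p F s a :
  rop p F (rcons s a) = (-1) ^ (p + sdeg s) *: ract (F s) a.
Proof. by case: s => [|b s] //=; rewrite belast_rcons last_rcons. Qed.

(** The pieces are the differential of [M], the bar differential and the two outer actions. From
    here on each of them is moved past other operations separately. *)
Lemma deltaE p F s : multilinear F -> delta M p F s =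
  bdop p F s + (-1) ^ p *: insop 2 mu F s + rop p F s + lop p F s.
Proof.
move=> mF; rewrite /delta -addrA -[_ + (- _ + _)]addrA -(delta_sumE p s mF).
rewrite /bdop -!addrA; congr (_ + (_ + (_ + _))).
by case: s => [|a s] //=; rewrite addr0.
Qed.

End Differential.

Section RegularCochains.
Variables (k : fieldType) (A : augDGA k).
Implicit Types (s u v w : seq (helt A)) (a b : helt A).
Implicit Types (x y z : seq (helt A) -> A).

Lemma cochain_multilinear (M : dgbimod A) p f :
  cochain M p f -> multilinear f.
Proof. by case. Qed.

Lemma cochain_reg_hom p x s : cochain (reg A) p x -> gpr A (p + sdeg s) (x s) = x s.
Proof. by case=> hx _ _; apply: hx. Qed.

Lemma hval_ins p x s : cochain (reg A) p x -> hval (ins p x s) = x s.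
Proof. exact: cochain_reg_hom. Qed.

Lemma bhom_spl (M : grbimod A) q s (G : seq (helt A) -> seq (helt A) -> M) :
  (forall u v, u ++ v = s -> bhom q (G u v)) -> bhom q (spl s G).
Proof.
elim: s G => [|a s IH] G hG; first by rewrite spl_nil; apply: hG.
rewrite spl_cons -[G _ _]scale1r; apply: bhomL; first exact: hG.
by apply: IH => u v uv; apply: hG; rewrite /= uv.
Qed.

Lemma bhomZ (M : grbimod A) q c (x : M) : bhom q x -> bhom q (c *: x).
Proof. by move=> hx; rewrite -[_ *: _]addr0; apply: bhomL => //; apply: bhom0. Qed.

Lemma bhomD (M : grbimod A) q (x y : M) : bhom q x -> bhom q y -> bhom q (x + y).
Proof. by move=> hx hy; rewrite -[x]scale1r; apply: bhomL. Qed.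

Lemma bhomN (M : grbimod A) q (x : M) : bhom q x -> bhom q (- x).
Proof. by rewrite -scaleN1r; apply: bhomZ. Qed.

Lemma cochainZ (M : dgbimod A) p (e : k) (F : seq (helt A) -> M) :
  cochain M p F -> cochain M p (e *: F).
Proof.
by move=> hF; rewrite -[_ *: _]addr0; apply: cochainL => //; apply: cochain0.
Qed.

Lemma cochainD (M : dgbimod A) p (F G : seq (helt A) -> M) :
  cochain M p F -> cochain M p G -> cochain M p (F + G).
Proof. by move=> hF hG; rewrite -[F]scale1r; apply: cochainL. Qed.

Lemma spl_homogeneous (M : grbimod A) (V : zmodType) q (h : M -> V) s
    (G : seq (helt A) -> seq (helt A) -> M) :
  (forall x y : M, bhom q x -> bhom q y -> h (x + y) = h x + h y) ->
  (forall u v, u ++ v = s -> bhom q (G u v)) ->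
  h (spl s G) = spl s (fun u v => h (G u v)).
Proof.
move=> hD; elim: s G => [|b s IH] G hG; first by rewrite !spl_nil.
have hG' u v : u ++ v = s -> bhom q (G (b :: u) v).
  by move=> uv; apply: hG; rewrite /= uv.
rewrite !spl_cons hD ?IH //; first exact: hG.
exact: bhom_spl.
Qed.

Lemma multilinear_insop (V : lmodType k) q (F : seq (helt A) -> V) y :
  multilinear F -> multilinear y -> multilinear (insop q y F).
Proof.
move=> mF my s1 s2 e c a b; rewrite !insop_cat_cons.
have -> : insop q y (fun v => F (v ++ hpr e (c *: a + b) :: s2)) s1 =
  c *: insop q y (fun v => F (v ++ hpr e a :: s2)) s1
    + insop q y (fun v => F (v ++ hpr e b :: s2)) s1.
  by rewrite -insopZ -insopD; apply: eq_insop => v; rewrite mF.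
have -> : insop q y (fun u => F (s1 ++ hpr e (c *: a + b) :: u)) s2 =
  c *: insop q y (fun u => F (s1 ++ hpr e a :: u)) s2
    + insop q y (fun u => F (s1 ++ hpr e b :: u)) s2.
  by rewrite -insopZ -insopD; apply: eq_insop => v; rewrite mF.
set S := spl s1 _; set Sa := spl s1 _; set Sb := spl s1 _.
suff -> : S = c *: Sa + Sb by rewrite !sdegE; lincomb k V.
rewrite -spl_scale -spl_add; apply: eq_spl => v1 v2 _.
rewrite -spl_scale -spl_add; apply: eq_spl => u1 u2 _.
rewrite /ins my mF !sdegE scalerDr !scalerA.
by rewrite [c * _]mulrC.
Qed.

Lemma insop_cochain (M : dgbimod A) p q F y :
  cochain M p F -> cochain (reg A) q y -> cochain M (p + q - 1) (insop q y F).
Proof.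
move=> [hF mF nF] [hy my ny]; split=> [s|s1 s2 e c a b|s1 s2].
- apply: bhom_spl => u r ur; apply: bhom_spl => v w vw; apply: bhomZ.
  have -> : p + q - 1 + sdeg s = p + sdeg (u ++ ins q y v :: w).
    by rewrite -ur -vw !sdegE; ring.
  exact: hF.
- exact: multilinear_insop.
rewrite insop_cat_cons.
rewrite [insop q y _ s1](_ : _ = 0); last first.
  by rewrite -[RHS](insop0 M q y s1); apply: eq_insop => v; rewrite nF.
rewrite [insop q y _ s2](_ : _ = 0); last first.
  by rewrite -[RHS](insop0 M q y s2); apply: eq_insop => v; rewrite nF.
rewrite scaler0 !add0r -[RHS](spl_0 M s1); apply: eq_spl => v1 v2 _.
rewrite -[RHS](spl_0 M s2); apply: eq_spl => u1 u2 _.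
by rewrite /ins ny (multilinear0 mF) scaler0.
Qed.

Lemma circ_cochain p q x y : cochain (reg A) p x -> cochain (reg A) q y ->
  cochain (reg A) (p + q - 1) (circ q x y).
Proof.
move=> hx hy; have -> : circ q x y = insop q y x by apply/funext => s; rewrite circE.
exact: insop_cochain.
Qed.

(** A word fed to [mu] has one or two letters, one of them the output of [x]. So the block of [x] is
    the whole word, or misses just its last or just its first letter. *)
Lemma circ_mu p x s : cochain (reg A) p x ->
  circ p mu x s = dga_d A (x s) + rop (M := reg A) p x s + lop (M := reg A) p x s.
Proof.
move=> hx; rewrite circE /insop spl_spl1_l.
have -> : spl s (fun v w => (-1) ^ ((p + 1) * @sdeg k A [::]) *:
    mu ([::] ++ ins p x v :: w)) = dga_d A (x s) + rop (M := reg A) p x s.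

  rewrite spl_spl1_r; congr (_ + _).
    by rewrite sdeg_nil mulr0 expr0z scale1r /= (cochain_reg_hom _ hx).
  case/lastP: s => [|s a]; first by rewrite spl1_nil.
  rewrite spl1_last => [|u c [|c' v]] //; last by rewrite /= scaler0.
  rewrite rop_rcons sdeg_nil mulr0 expr0z scale1r.
  by rewrite /= (cochain_reg_hom _ hx).
congr (_ + _); case: s => [|a s]; first by rewrite spl1_nil.
rewrite spl1_first => [|[|c u] c' t] //; last first.
  move=> _; rewrite -[RHS](spl_0 _ t); apply: eq_spl => v w _.
  rewrite mu_gt2 ?scaler0 // size_cat size_rcons /=; lia.
rewrite spl_only_nil_r => [|u [|c v]] //; last by rewrite /= scaler0.
rewrite /= (cochain_reg_hom _ hx) scalerA -scaleNr -mulN1r; congr (_ *: _).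
by rewrite mulN1r sg_opp -sgnM; sg_solve.
Qed.

Lemma delta_reg p x s : cochain (reg A) p x ->
  delta (reg A) p x s = circ p mu x s + (-1) ^ p *: circ 2 x mu s.
Proof.
move=> hx; rewrite deltaE ?circ_mu ?circE //; last exact: cochain_multilinear hx.
by rewrite -addrA addrAC addrA.
Qed.

End RegularCochains.

Section Actions.
Variables (k : fieldType) (A : augDGA k) (M : grbimod A) (q : int).
Implicit Types (a : helt A) (x y : M).

Lemma lact0 a : lact a (0 : M) = 0.
Proof.
have := lactL a (-1) (bhom0 M 0) (bhom0 M 0).
by rewrite scaler0 addr0 scaleN1r addNr.
Qed.

Lemma ract0 a : ract (0 : M) a = 0.
Proof.
have := ractL a (-1) (bhom0 M 0) (bhom0 M 0).
by rewrite scaler0 addr0 scaleN1r addNr.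
Qed.

Lemma lactZ a c x : bhom q x -> lact a (c *: x) = c *: lact a x.
Proof. by move=> hx; have := lactL a c hx (bhom0 M q); rewrite lact0 !addr0. Qed.

Lemma ractZ a c x : bhom q x -> ract (c *: x) a = c *: ract x a.
Proof. by move=> hx; have := ractL a c hx (bhom0 M q); rewrite ract0 !addr0. Qed.

Lemma lactD a x y : bhom q x -> bhom q y -> lact a (x + y) = lact a x + lact a y.
Proof. by move=> hx hy; have := lactL a 1 hx hy; rewrite !scale1r. Qed.

Lemma ractD a x y : bhom q x -> bhom q y -> ract (x + y) a = ract x a + ract y a.
Proof. by move=> hx hy; have := ractL a 1 hx hy; rewrite !scale1r. Qed.

Lemma lact_vD p (a b : A) x : bhom q x ->
  lact (hpr p (a + b)) x = lact (hpr p a) x + lact (hpr p b) x.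
Proof. by move=> hx; have := lactDl p 1 a b hx; rewrite !scale1r. Qed.

Lemma ract_vD p (a b : A) x : bhom q x ->
  ract x (hpr p (a + b)) = ract x (hpr p a) + ract x (hpr p b).
Proof. by move=> hx; have := ractDr p 1 a b hx; rewrite !scale1r. Qed.

Lemma lact_v0 p x : bhom q x -> lact (hpr p 0) x = 0.
Proof.
move=> hx; apply: (addrI (lact (hpr p 0) x)).
by rewrite -(lact_vD _ _ _ hx) !addr0.
Qed.

Lemma ract_v0 p x : bhom q x -> ract x (hpr p 0) = 0.
Proof.
move=> hx; apply: (addrI (ract x (hpr p 0))).
by rewrite -(ract_vD _ _ _ hx) !addr0.
Qed.

Lemma lact_vZ p c (a : A) x : bhom q x ->
  lact (hpr p (c *: a)) x = c *: lact (hpr p a) x.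
Proof.
by move=> hx; have := lactDl p c a 0 hx; rewrite (lact_v0 _ hx) !addr0.
Qed.

Lemma ract_vZ p c (a : A) x : bhom q x ->
  ract x (hpr p (c *: a)) = c *: ract x (hpr p a).
Proof.
by move=> hx; have := ractDr p c a 0 hx; rewrite (ract_v0 _ hx) !addr0.
Qed.

Lemma lact_spl a s (G : seq (helt A) -> seq (helt A) -> M) :
  (forall u v, u ++ v = s -> bhom q (G u v)) ->
  lact a (spl s G) = spl s (fun u v => lact a (G u v)).
Proof. exact: (spl_homogeneous (h := lact a) (@lactD a)). Qed.

Lemma ract_spl a s (G : seq (helt A) -> seq (helt A) -> M) :
  (forall u v, u ++ v = s -> bhom q (G u v)) ->
  ract (spl s G) a = spl s (fun u v => ract (G u v) a).
Proof. exact: (spl_homogeneous (h := fun x => ract x a) (@ractD a)). Qed.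

Lemma lact_vspl p T (s : seq T) (G : seq T -> seq T -> A) x : bhom q x ->
  lact (hpr p (spl s G)) x = spl s (fun u v => lact (hpr p (G u v)) x).
Proof.
move=> hx; apply: (@spl_additive _ A M (fun a : A => lact (hpr p a) x)).
  exact: lact_v0 hx.
by move=> a b; rewrite (lact_vD _ _ _ hx).
Qed.

End Actions.

Section BimoduleDifferential.
Variables (k : fieldType) (A : augDGA k) (M : dgbimod A) (q : int).
Implicit Types (x y : M).

Lemma bd0 : bd q (0 : M) = 0.
Proof.
have := bdL (-1) (bhom0 M q) (bhom0 M q).
by rewrite scaler0 addr0 scaleN1r addNr.
Qed.

Lemma bdZ c x : bhom q x -> bd q (c *: x) = c *: bd q x.
Proof. by move=> hx; have := bdL c hx (bhom0 M q); rewrite bd0 !addr0. Qed.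

Lemma bdD x y : bhom q x -> bhom q y -> bd q (x + y) = bd q x + bd q y.
Proof. by move=> hx hy; have := bdL 1 hx hy; rewrite !scale1r. Qed.

Lemma bd_spl s (G : seq (helt A) -> seq (helt A) -> M) :
  (forall u v, u ++ v = s -> bhom q (G u v)) ->
  bd q (spl s G) = spl s (fun u v => bd q (G u v)).
Proof. exact: (spl_homogeneous (h := bd q) (@bdD)). Qed.

End BimoduleDifferential.

(** * Cup products with values in a bimodule *)

Section Cups.
Variables (k : fieldType) (A : augDGA k) (M : dgbimod A).
Implicit Types (s u v w : seq (helt A)) (a b : helt A).
Implicit Types (x y z : seq (helt A) -> A) (F f g : seq (helt A) -> M).

Definition lcup p q x f s : M :=
  spl s (fun u v => (-1) ^ (q * sdeg u) *: lact (ins p x u) (f v)).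

Definition rcup q f x s : M :=
  spl s (fun u v => (-1) ^ (q * sdeg u) *: ract (f u) (ins q x v)).

Lemma cochain_hom p f s q : cochain M p f -> q = p + sdeg s -> bhom q (f s).
Proof. by case=> hf _ _ ->; apply: hf. Qed.

Lemma insop_hom p q y f s : cochain M p f ->
  bhom (p + q - 1 + sdeg s) (insop q y f s).
Proof.
move=> hf; apply: bhom_spl => u r <-; apply: bhom_spl => v w <-; apply: bhomZ.
by apply: (cochain_hom hf); rewrite !sdegE; ring.
Qed.

Lemma insop_bdop p q y f s : cochain M p f ->
  insop q y (bdop p f) s = bdop (p + q - 1) (insop q y f) s.
Proof.
move=> hf; rewrite /bdop /insop bd_spl => [|u r ur]; last first.
  apply: bhom_spl => v w vw; apply: bhomZ; apply: (cochain_hom hf).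
  by rewrite -ur -vw !sdegE; ring.
apply: eq_spl => u r ur; rewrite bd_spl => [|v w vw]; last first.
  apply: bhomZ; apply: (cochain_hom hf).
  by rewrite -ur -vw !sdegE; ring.
apply: eq_spl => v w vw.
have -> : p + q - 1 + sdeg s = p + sdeg (u ++ ins q y v :: w).
  by rewrite -ur -vw !sdegE; ring.
by rewrite bdZ //; apply: (cochain_hom hf).
Qed.

(** A block that leaves the first letter alone passes through the outer action. A block starting at
    the first letter makes the output of [y] act, which is the cup product. The degree in [lop]
    counts only modulo 2, so [p + q + 1] stands for [p + q - 1]. *)
Lemma insop_lop p q y f s : cochain M p f ->
  insop q y (lop p f) s = lop (p + q + 1) (insop q y f) s
    - (-1) ^ (p * (q + 1)) *: lcup q p y f s.
Proof.
move=> hf; have E t : spl t (fun v w => lop p f (ins q y v :: w)) =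
    - ((-1) ^ (p * (q + 1)) *: lcup q p y f t).
  rewrite /lcup -spl_scale -spl_opp; apply: eq_spl => v w _ /=.
  congr (- _); sg_collect.
case: s => [|a s]; first by rewrite insop_nil add0r -E spl_nil.
rewrite insop_cons E addrC; congr (_ - _).
rewrite /= (lact_spl (q := p + q - 1 + sdeg s)) => [|u r ur]; last first.
  apply: bhom_spl => v w vw; apply: bhomZ; apply: (cochain_hom hf).
  by rewrite -ur -vw !sdegE; ring.
rewrite /insop -!spl_scale -spl_opp; apply: eq_spl => u r ur.
rewrite (lact_spl (q := p + q - 1 + sdeg s)) => [|v w vw]; last first.
  apply: bhomZ; apply: (cochain_hom hf).
  by rewrite -ur -vw !sdegE; ring.
rewrite -!spl_scale -spl_opp; apply: eq_spl => v w vw.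
rewrite (lactZ (q := p + sdeg (u ++ ins q y v :: w))); last exact: (cochain_hom hf).
by rewrite -!scalerN; lincomb k M.
Qed.

Lemma insop_rop p q y f s : cochain M p f ->
  insop q y (rop p f) s = rop (p + q - 1) (insop q y f) s
    + (-1) ^ p *: rcup q f y s.
Proof.
move=> hf; have E t : spl t (fun u v =>
    (-1) ^ ((q + 1) * sdeg u) *: rop p f (rcons u (ins q y v))) =
    (-1) ^ p *: rcup q f y t.
  rewrite /rcup -spl_scale; apply: eq_spl => v w _.
  rewrite rop_rcons; sg_collect.
case/lastP: s => [|s a].
  by rewrite insop_nil add0r -E spl_nil sdeg_nil mulr0 expr0z scale1r.
rewrite insop_rcons E; congr (_ + _).
rewrite rop_rcons (ract_spl (q := p + q - 1 + sdeg s)) => [|u r ur]; last first.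
  apply: bhom_spl => v w vw; apply: bhomZ; apply: (cochain_hom hf).
  by rewrite -ur -vw !sdegE; ring.
rewrite /insop -!spl_scale; apply: eq_spl => u r ur.
rewrite (ract_spl (q := p + q - 1 + sdeg s)) => [|v w vw]; last first.
  apply: bhomZ; apply: (cochain_hom hf).
  by rewrite -ur -vw !sdegE; ring.
rewrite -!spl_scale; apply: eq_spl => v w vw.
rewrite (ractZ (q := p + sdeg (u ++ ins q y v :: w))); last exact: (cochain_hom hf).
by rewrite rop_rcons -ur -vw; sg_collect.
Qed.

End Cups.

(** * The differential squares to zero *)

Section DeltaSquare.
Variables (k : fieldType) (A : augDGA k) (M : dgbimod A).
Implicit Types (s u v w : seq (helt A)) (a b : helt A).
Implicit Types (f g : seq (helt A) -> M).

(** On words of length one, two and three this is [d^2 = 0], the Leibniz rule and associativity;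
    longer words give nothing since [mu] vanishes beyond two letters. *)
Lemma insop_mu_mu s : insop 2 mu (@mu k A) s = 0.
Proof.
have m0 := @multilinear_mu k A.
case: s => [|a s]; first exact: insop_mu_nil.
have m1 := multilinear_behead m0 a.
case: s => [|b s].
  rewrite insop_mu_cons // insop_mu_nil //= (dga_d_deg (hval_pr a)) dga_dd.
  by rewrite scaler0 !addr0.
have m2 := multilinear_behead m1 b.
case: s => [|c s].
  rewrite 2?insop_mu_cons // insop_mu_nil //.
  rewrite /mu -/(hval (hd a)) -/(hval (hd b)) -/(hval (hmul a b)).
  rewrite !hvald hvalM (dga_dM _ (hval_pr a)) !sdegE.
  set x := _ * _; set y := _ * _; rewrite scaler0 !addr0.
  lincomb k A.
have m3 := multilinear_behead m2 c.
case: s => [|e s].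
  rewrite 3?insop_mu_cons // insop_mu_nil //.
  rewrite /mu -/(hval (hmul a b)) -/(hval (hmul b c)) !hvalM !sdegE mulrA.
  set x := _ * _; rewrite scaler0 !addr0 !add0r.
  lincomb k A.
rewrite 3?insop_mu_cons //= insop0 !scaler0 !addr0.
by case: s => [|? ?]; rewrite !(scaler0, add0r).
Qed.

(** [mu] has degree 2, so two disjoint insertions of it anticommute and cancel, and the nested ones
    are insertions of [circ 2 mu mu]. *)
Lemma insop_mu_square (V : lmodType k) (F : seq (helt A) -> V) s :
  multilinear F -> insop 2 mu (insop 2 mu F) s = 0.
Proof.
move=> mF; rewrite insop_insopE //.
have -> : circ 2 mu mu = (fun=> 0) :> (seq (helt A) -> A).
  by apply/funext => t; rewrite circE insop_mu_mu.
have -> : insop (2 + 2 - 1) (fun=> 0) F s = 0.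
  rewrite -[RHS](spl_0 V s); apply: eq_spl => u r _.
  rewrite -[RHS](spl_0 V r); apply: eq_spl => v w _.
  by rewrite /ins (multilinear0 mF) scaler0.
lincomb k V.
Qed.

Lemma multilinear_bdop p f : cochain M p f -> multilinear (bdop p f).
Proof.
move=> hf s1 s2 q c a b; rewrite /bdop (cochain_multilinear hf).
rewrite !sdegE; have E : p + (sdeg s1 + (q - 1 + sdeg s2)) =
  p + sdeg (s1 ++ hpr q (0 : A) :: s2) by rewrite !sdegE.
by rewrite bdL // E; apply: (cochain_hom hf); rewrite !sdegE.
Qed.

Lemma multilinear_lop p f : cochain M p f -> multilinear (lop p f).
Proof.
move=> hf [|a0 s1] s2 q c a b /=.
  have h2 : bhom (p + sdeg s2) (f s2) by apply: (cochain_hom hf).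
  rewrite (lactDl _ _ _ _ h2).
  lincomb k M.
rewrite (cochain_multilinear hf).
have ha := cochain_hom hf (erefl (p + sdeg (s1 ++ hpr q a :: s2))).
have hb : bhom (p + sdeg (s1 ++ hpr q a :: s2)) (f (s1 ++ hpr q b :: s2)).
  by apply: (cochain_hom hf); rewrite !sdegE.
rewrite (lactL _ _ ha hb).
lincomb k M.
Qed.

Lemma multilinear_rop p f : cochain M p f -> multilinear (rop p f).
Proof.
move=> hf s1 s2 q c a b; case/lastP: s2 => [|s2 a0].
  have h1 : bhom (p + sdeg s1) (f s1) by apply: (cochain_hom hf).
  rewrite !cats1 !rop_rcons (ractDr _ _ _ _ h1).
  lincomb k M.
rewrite -!rcons_cons -!rcons_cat !rop_rcons (cochain_multilinear hf).
have ha := cochain_hom hf (erefl (p + sdeg (s1 ++ hpr q a :: s2))).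
have hb : bhom (p + sdeg (s1 ++ hpr q a :: s2)) (f (s1 ++ hpr q b :: s2)).
  by apply: (cochain_hom hf); rewrite !sdegE.
rewrite (ractL _ _ ha hb).
by rewrite !sdegE; lincomb k M.
Qed.

Lemma multilinear_delta p f : cochain M p f -> multilinear (delta M p f).
Proof.
move=> hf s1 s2 q c a b; rewrite !deltaE; try exact: (cochain_multilinear hf).
rewrite multilinear_bdop // multilinear_lop // multilinear_rop //.
have mN := multilinear_insop 2 (cochain_multilinear hf) (@multilinear_mu k A).
rewrite mN.
lincomb k M.
Qed.

Section AgainstMu.
Variables (p : int) (f : seq (helt A) -> M).
Hypothesis hf : cochain M p f.

Let hom s : bhom (p + sdeg s) (f s).
Proof. exact: (cochain_hom hf). Qed.

Lemma bdop_hom s : bhom (p + sdeg s + 1) (bdop p f s).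
Proof. exact/bd_hom/hom. Qed.

Lemma lop_hom s : bhom (p + sdeg s + 1) (lop p f s).
Proof.
case: s => [|a s]; first exact: bhom0.
apply/bhomN/bhomZ; have -> : p + sdeg (a :: s) + 1 = hdeg a + (p + sdeg s).
  by rewrite !sdegE; ring.
exact: lact_hom.
Qed.

Lemma rop_hom s : bhom (p + sdeg s + 1) (rop p f s).
Proof.
case/lastP: s => [|s a]; first exact: bhom0.
rewrite rop_rcons; apply: bhomZ.
have -> : p + sdeg (rcons s a) + 1 = p + sdeg s + hdeg a.
  by rewrite !sdegE; ring.
exact: ract_hom.
Qed.

Lemma insop_mu_hom s : bhom (p + sdeg s + 1) (insop 2 mu f s).
Proof.
have -> : p + sdeg s + 1 = p + 2 - 1 + sdeg s by ring.
exact: insop_hom.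
Qed.

(** The axioms for the left action in one identity: the Leibniz rule leaves the action of [hd a],
    associativity that of [hmul a b], and these are the values of [mu] on the prefixes of the
    word. *)
Lemma lop_lcup_mu s : bdop (p + 1) (lop p f) s + lop (p + 1) (bdop p f) s
  + lop (p + 1) (lop p f) s = - lcup 2 p mu f s.
Proof.
case: s => [|a s].
  by rewrite /lcup spl_nil (lact_v0 _ (hom _)) scaler0 oppr0 /bdop bd0 !addr0.
rewrite /lcup !spl_cons (lact_v0 _ (hom _)) scaler0 add0r /bdop.
have -> : p + 1 + sdeg (a :: s) = hdeg a + (p + sdeg s) by rewrite !sdegE; ring.
have ha : bhom (hdeg a + (p + sdeg s)) (lact a (f s)) by apply: lact_hom.
rewrite /= -scaleNr bdZ // (bd_lact _ (hom s)).
case: s ha => [|b s] ha.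
  by rewrite spl_nil ins_mu1 lact0; lincomb k M.
rewrite spl_cons ins_mu1 spl_only_nil => [|[|c u] v _ ]//; last first.
  by rewrite (lact_v0 _ (hom _)) scaler0.
have -> : lact (ins 2 mu [:: a; b]) (f s) =
    (-1) ^ (hdeg a) *: lact a (lact b (f s)).
  rewrite -(lactA _ _ (hom s)) -(lact_vZ _ _ _ (hom s)).
  by congr (lact (hpr _ _) _); rewrite !sdegE; ring.
rewrite /= -[- (_ *: lact b _)]scaleNr (lactZ _ _ (lact_hom b (hom s))).
lincomb k M.
Qed.

Lemma rop_rcup_mu s : bdop (p + 1) (rop p f) s + rop (p + 1) (bdop p f) s
  + rop (p + 1) (rop p f) s = rcup 2 f mu s.
Proof.
case/lastP: s => [|s a].
  by rewrite /rcup spl_nil (ract_v0 _ (hom _)) scaler0 /bdop bd0 !addr0.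
rewrite /rcup spl_rcons (ract_v0 _ (hom _)) scaler0 addr0 /bdop !rop_rcons.
have -> : p + 1 + sdeg (rcons s a) = p + sdeg s + hdeg a by rewrite !sdegE; ring.
have ha : bhom (p + sdeg s + hdeg a) (ract (f s) a) by apply: ract_hom.
rewrite bdZ // (bd_ract _ (hom s)).
case/lastP: s ha => [|s b] ha.
  by rewrite spl_nil [rcons _ _]/= ins_mu1 /= ract0; lincomb k M.
rewrite spl_rcons [rcons [::] _]/= ins_mu1.
rewrite spl_only_nil_r => [|u [|c v] _ ]//; last first.
  rewrite [rcons _ _]/= [ins _ _ _](_ : _ = hpr (2 + sdeg (c :: rcons (rcons v b) a)) 0).
    by rewrite (ract_v0 _ (hom _)) scaler0.
  by rewrite /ins; case: v => [|? [|? ?]].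
have -> : ract (f s) (ins 2 mu (rcons (rcons [::] b) a)) =
    (-1) ^ (hdeg b) *: ract (ract (f s) b) a.
  rewrite -(ractA _ _ (hom s)) -(ract_vZ _ _ _ (hom s)).
  by congr (ract _ (hpr _ _)); rewrite !sdegE; ring.
rewrite rop_rcons (ractZ _ _ (ract_hom b (hom s))).
by rewrite !sdegE; lincomb k M.
Qed.

Lemma rop_lop s : rop (p + 1) (lop p f) s + lop (p + 1) (rop p f) s = 0.
Proof.
case/lastP: s => [|s b]; first by rewrite /= addr0.
rewrite rop_rcons; case: s => [|a s].
  by rewrite /= ract0 lact0 !scaler0 oppr0 addr0.
rewrite rcons_cons /= rop_rcons -scaleNr (ractZ _ _ (lact_hom a (hom s))).
rewrite (lactZ _ _ (ract_hom b (hom s))) (lractA _ _ (hom s)).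
by rewrite !sdegE; lincomb k M.
Qed.

End AgainstMu.

(** The bar piece squares to zero by itself. Moving it past the outer actions costs a left and a
    right cup product with [mu]; these are what [lop_lcup_mu] and [rop_rcup_mu] compensate, and the
    two outer actions anticommute. *)
Lemma delta_square p f s : cochain M p f -> delta M (p + 1) (delta M p f) s = 0.
Proof.
move=> hf; have mf := cochain_multilinear hf.
rewrite deltaE; last exact: multilinear_delta.
pose N := insop 2 mu f.
have DE : delta M p f =
    (fun t => bdop p f t + (-1) ^ p *: N t + rop p f t + lop p f t).
  by apply/funext => t; rewrite deltaE.
have hbd := bdop_hom hf; have hN : forall t, bhom _ (N t) := insop_mu_hom hf.
have hl := lop_hom hf; have hr := rop_hom hf.
have hZN t := bhomZ ((-1) ^ p) (hN t).
have h2 t := bhomD (hbd t) (hZN t).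
have h3 t := bhomD (h2 t) (hr t).
have E1 : insop 2 mu (delta M p f) s = bdop (p + 1) N s
    + rop (p + 1) N s + (-1) ^ p *: rcup 2 f mu s
    + lop (p + 1) N s - (-1) ^ p *: lcup 2 p mu f s.
  rewrite DE !insopD insopZ insop_mu_square // (insop_bdop _ _ _ hf).
  rewrite (insop_rop _ _ _ hf) (insop_lop _ _ _ hf) -/N.
  have -> : p + 2 - 1 = p + 1 by ring.
  have -> : lop (p + 2 + 1) N s = lop (p + 1) N s.
    by case: (s) => [|a t] //=; congr (- _); sg_collect.
  by rewrite -/N; lincomb k M.
have E2 : bdop (p + 1) (delta M p f) s = (-1) ^ p *: bdop (p + 1) N s
    + bdop (p + 1) (rop p f) s + bdop (p + 1) (lop p f) s.
  rewrite /bdop DE; have -> : p + 1 + sdeg s = p + sdeg s + 1 by ring.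
  rewrite (bdD (h3 s) (hl s)) (bdD (h2 s) (hr s)) (bdD (hbd s) (hZN s)).
  rewrite (bdZ _ (hN s)) bdd ?add0r //.
  exact: (cochain_hom hf).
have E3 : lop (p + 1) (delta M p f) s = lop (p + 1) (bdop p f) s
    + (-1) ^ p *: lop (p + 1) N s + lop (p + 1) (rop p f) s
    + lop (p + 1) (lop p f) s.
  rewrite DE; case: (s) => [|a t] /=; first by rewrite scaler0 !addr0.
  rewrite (lactD _ (h3 t) (hl t)) (lactD _ (h2 t) (hr t)).
  rewrite (lactD _ (hbd t) (hZN t)) (lactZ _ _ (hN t)).
  lincomb k M.
have E4 : rop (p + 1) (delta M p f) s = rop (p + 1) (bdop p f) s
    + (-1) ^ p *: rop (p + 1) N s + rop (p + 1) (rop p f) s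
    + rop (p + 1) (lop p f) s.
  rewrite DE; case/lastP: (s) => [|t a]; first by rewrite /= scaler0 !addr0.
  rewrite !rop_rcons (ractD _ (h3 t) (hl t)) (ractD _ (h2 t) (hr t)).
  rewrite (ractD _ (hbd t) (hZN t)) (ractZ _ _ (hN t)).
  lincomb k M.
rewrite E1 E2 E3 E4.
have R := rop_rcup_mu hf s; have L := lop_lcup_mu hf s.
have X := rop_lop hf s.
rewrite -R -[lcup _ _ _ _ _]opprK -L.
rewrite -[RHS]X.
lincomb k M.
Qed.

End DeltaSquare.

(** * The Leibniz rule for the cup product *)

Section LeftCup.
Variables (k : fieldType) (A : augDGA k) (M : dgbimod A).
Implicit Types (s u v w : seq (helt A)) (a b : helt A).
Implicit Types (x y z : seq (helt A) -> A) (f g : seq (helt A) -> M).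

Lemma lcup_addl p q x y f s c : (forall s, exists r, bhom r (f s)) ->
  lcup p q (fun t => c *: x t + y t) f s = c *: lcup p q x f s + lcup p q y f s.
Proof.
move=> hf; rewrite /lcup -spl_scale -spl_add; apply: eq_spl => u v _.
by have [r hr] := hf v; rewrite /ins (lactDl _ _ _ _ hr); lincomb k M.
Qed.

Lemma lcup_cochain p q x f : cochain (reg A) p x -> cochain M q f ->
  cochain M (p + q) (lcup p q x f).
Proof.
move=> hx hf; have [_ mx nx] := hx; have [_ mf nf] := hf.
have hom t : bhom (q + sdeg t) (f t) by apply: (cochain_hom hf).
split=> [s|s1 s2 e c a b|s1 s2].
- apply: bhom_spl => u v uv; apply: bhomZ.
  have -> : p + q + sdeg s = (p + sdeg u) + (q + sdeg v).
    by rewrite -uv sdegE; ring.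
  exact: (lact_hom (ins p x u)).
- rewrite /lcup !spl_cat_cons scalerDr addrACA -!spl_scale -!spl_add.
  congr (_ + _); apply: eq_spl => u v _.
    have ha := hom (v ++ hpr e a :: s2).
    have hb : bhom (q + sdeg (v ++ hpr e a :: s2)) (f (v ++ hpr e b :: s2)).
      by apply: (cochain_hom hf); rewrite !sdegE.
    by rewrite mf (lactL _ _ ha hb); lincomb k M.
  by rewrite /ins mx !sdegE (lactDl _ _ _ _ (hom _)); lincomb k M.
rewrite /lcup spl_cat_cons !spl_eq0 ?addr0 // => u v _.
  by rewrite /ins nx (lact_v0 _ (hom _)) scaler0.
by rewrite nf lact0 scaler0.
Qed.

(** Each piece of [delta] acts on [x] or on [f]. On the right-hand side there are in addition the
    right action on [x] and the left action on [f], both with the letter at the cut; they cancel. *)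
Lemma delta_lcup p q x f s : cochain (reg A) p x -> cochain M q f ->
  delta M (p + q) (lcup p q x f) s = lcup (p + 1) q (delta (reg A) p x) f s
    + (-1) ^ p *: lcup p (q + 1) x (delta M q f) s.
Proof.
move=> hx hf.
have hom t : bhom (q + sdeg t) (f t) by apply: (cochain_hom hf).
have hom' t : exists r, bhom r (f t) by exists (q + sdeg t).
have mx := cochain_multilinear hx; have mf := cochain_multilinear hf.
have hxf u v : bhom (p + sdeg u + (q + sdeg v)) (lact (ins p x u) (f v)).
  exact: (lact_hom (ins p x u)).
have hxf' s' u v : u ++ v = s' -> bhom (p + q + sdeg s') (lact (ins p x u) (f v)).
  move=> <-; have -> : p + q + sdeg (u ++ v) = p + sdeg u + (q + sdeg v).
    by rewrite sdegE; ring.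
  exact: hxf.
rewrite deltaE; last exact: cochain_multilinear (lcup_cochain hx hf).
have -> : delta (reg A) p x = (fun t => 1 *: bdop (M := reg A) p x t
    + (((-1) ^ p *: insop 2 mu x t) + (1 *: rop (M := reg A) p x t
      + lop (M := reg A) p x t))).
  by apply/funext => t; rewrite deltaE // !scale1r !addrA.
rewrite !lcup_addl // !scale1r.
have Ebd : bdop (p + q) (lcup p q x f) s =
    lcup (p + 1) q (bdop (M := reg A) p x) f s
    + (-1) ^ p *: lcup p (q + 1) x (bdop q f) s.
  rewrite {1}/bdop /lcup bd_spl => [|u v uv]; last by apply/bhomZ/hxf'.
  rewrite -spl_scale -spl_add; apply: eq_spl => u v uv.
  rewrite (bdZ _ (hxf' _ _ _ uv)).
  have -> : p + q + sdeg s = hdeg (ins p x u) + (q + sdeg v).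
    by rewrite -uv !sdegE; ring.
  rewrite (bd_lact _ (hom v)) hdeg_ins.
  have -> : hd (ins p x u) = ins (p + 1) (bdop (M := reg A) p x) u.
    by rewrite /hd (hval_ins _ hx) hdeg_ins /ins; congr hpr; ring.
  by rewrite -[bd (q + sdeg v) (f v)]/(bdop q f v); lincomb k M.
have Ebar : insop 2 mu (lcup p q x f) s = (-1) ^ q *:
      lcup (p + 1) q (insop 2 mu x) f s + lcup p (q + 1) x (insop 2 mu f) s.
  rewrite /lcup insop_spl -spl_scale; congr (_ + _); apply: eq_spl => u v _.
    rewrite /ins /insop (lact_vspl _ _ _ (hom v)) -!spl_scale.
    apply: eq_spl => u1 r ur; rewrite (lact_vspl _ _ _ (hom v)) -!spl_scale.
    apply: eq_spl => u2 u3 ur'; rewrite (lact_vZ _ _ _ (hom v)).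
    have -> : p + 1 + sdeg u = p + sdeg (u1 ++ ins 2 mu u2 :: u3).
      by rewrite -ur -ur' !sdegE; ring.
    by rewrite -ur -ur'; lincomb k M.
  rewrite insopZ scalerA; congr (_ *: _); first by rewrite -sgnM; sg_solve.
  rewrite /insop (lact_spl (q := q + 1 + sdeg v)) => [|v1 r ur]; last first.
    apply: bhom_spl => v2 v3 ur'; apply: bhomZ.
    by apply: (cochain_hom hf); rewrite -ur -ur' !sdegE; ring.
  apply: eq_spl => v1 r ur.
  rewrite (lact_spl (q := q + 1 + sdeg v)) => [|v2 v3 ur']; last first.
    apply: bhomZ.
    by apply: (cochain_hom hf); rewrite -ur -ur' !sdegE; ring.
  by apply: eq_spl => v2 v3 ur'; rewrite (lactZ _ _ (hom _)).
have Erop : rop (p + q) (lcup p q x f) s =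
    (-1) ^ p *: lcup p (q + 1) x (rop q f) s.
  case/lastP: (s) => [|t a].
    by rewrite /lcup spl_nil /= lact0 !scaler0.
  rewrite rop_rcons /lcup spl_rcons /= lact0 scaler0 addr0.
  rewrite (ract_spl (q := p + q + sdeg t)) => [|u v uv]; last first.
    exact/bhomZ/hxf'.
  rewrite -!spl_scale; apply: eq_spl => u v uv.
  rewrite rop_rcons (ractZ _ _ (hxf u v)) (lactZ _ _ (ract_hom a (hom v))).
  by rewrite (lractA _ _ (hom v)) -uv; lincomb k M.
have Elop : lop (p + q) (lcup p q x f) s =
    lcup (p + 1) q (lop (M := reg A) p x) f s.
  case: (s) => [|a t].
    by rewrite /lcup spl_nil /ins (lact_v0 _ (hom _)) scaler0.
  rewrite /lcup spl_cons /ins (lact_v0 _ (hom _)) scaler0 add0r /=.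
  rewrite (lact_spl (q := p + q + sdeg t)) => [|u v uv]; last first.
    exact/bhomZ/hxf'.
  rewrite -!spl_scale -spl_opp; apply: eq_spl => u v uv.
  rewrite (lactZ _ _ (hxf u v)) -(lactA _ _ (hom v)).
  rewrite -!scaleNr (lact_vZ _ _ _ (hom v)).
  rewrite /hmul (hval_ins _ hx) hdeg_ins.
  have -> : hdeg a + (p + sdeg u) = p + 1 + sdeg (a :: u) by rewrite !sdegE; ring.
  lincomb k M.
(* Both sides are sums of [x u], then a letter [c], then [f v]: associativity of the action
   identifies [x u] times [c] acting on [f v] with [x u] acting on [c] times [f v]. *)
have Ecross : lcup (p + 1) q (rop (M := reg A) p x) f s =
    - (-1) ^ p *: lcup p (q + 1) x (lop q f) s.
  rewrite /lcup spl_spl1_l spl_spl1_r /ins (lact_v0 _ (hom _)) /= lact0 !scaler0.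
  rewrite !add0r /spl1 -spl_scale; apply: eq_spl => u [|c v] uv.
    by rewrite scaler0.
  rewrite rop_rcons /= -scaleNr (lact_vZ _ _ _ (hom v)).
  rewrite (lactZ _ _ (lact_hom c (hom v))) -(lactA _ _ (hom v)) /hmul /=.
  rewrite (cochain_reg_hom _ hx).
  have -> : p + 1 + sdeg (rcons u c) = p + sdeg u + hdeg c.
    by rewrite !sdegE; ring.
  by rewrite !scalerA; congr (_ *: _); sg_ring.
have Edelta : lcup p (q + 1) x (delta M q f) s =
    lcup p (q + 1) x (bdop q f) s + (-1) ^ q *: lcup p (q + 1) x (insop 2 mu f) s
    + lcup p (q + 1) x (rop q f) s + lcup p (q + 1) x (lop q f) s.
  rewrite /lcup -spl_scale -!spl_add; apply: eq_spl => u v _.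
  rewrite deltaE //.
  have h1 := bdop_hom hf v; have h2 := bhomZ ((-1) ^ q) (insop_mu_hom hf v).
  have h3 := rop_hom hf v; have h4 := lop_hom hf v.
  rewrite (lactD _ (bhomD (bhomD h1 h2) h3) h4) (lactD _ (bhomD h1 h2) h3).
  by rewrite (lactD _ h1 h2) (lactZ _ _ (insop_mu_hom hf v)) !scalerDr;
    lincomb k M.
rewrite Ebd Ebar Erop Elop Ecross Edelta.
lincomb k M.
Qed.

End LeftCup.

Section RegularOperations.
Variables (k : fieldType) (A : augDGA k).
Implicit Types (s u v w : seq (helt A)) (a b : helt A).
Implicit Types (x y z : seq (helt A) -> A).

Lemma cupE p q x y s : cochain (reg A) p x ->
  cup q x y s = lcup (M := reg A) p q x y s.
Proof.
move=> hx; rewrite /cup /lcup /spl big_map /index_iota subn0.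
by apply: eq_bigr => i _ /=; rewrite (cochain_reg_hom _ hx).
Qed.

Lemma rcup_cup p q x y s : cochain (reg A) p x -> cochain (reg A) q y ->
  rcup (M := reg A) q x y s = cup q x y s.
Proof.
move=> hx hy; rewrite (cupE _ _ _ hx); apply: eq_spl => u v _ /=.
by rewrite (cochain_reg_hom _ hx) (cochain_reg_hom _ hy).
Qed.

Lemma cup_cochain p q x y : cochain (reg A) p x -> cochain (reg A) q y ->
  cochain (reg A) (p + q) (cup q x y).
Proof.
move=> hx hy.
have -> : cup q x y = lcup (M := reg A) p q x y by apply/funext => s; apply: cupE.
exact: lcup_cochain.
Qed.

Lemma lcup_assoc (M : dgbimod A) p q r x y (f : seq (helt A) -> M) s :
  cochain (reg A) p x -> cochain (reg A) q y -> cochain M r f ->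
  lcup p (q + r) x (lcup q r y f) s = lcup (p + q) r (cup q x y) f s.
Proof.
move=> hx hy hf; have hom t : bhom (r + sdeg t) (f t) by apply: (cochain_hom hf).
transitivity (spl s (fun u t => spl t (fun v w =>
    (-1) ^ ((q + r) * sdeg u + r * sdeg v) *:
      lact (ins p x u) (lact (ins q y v) (f w))))).
  apply: eq_spl => u t _.
  rewrite (lact_spl (q := q + r + sdeg t)) => [|v w vw]; last first.
    apply: bhomZ; have -> : q + r + sdeg t = (q + sdeg v) + (r + sdeg w).
      by rewrite -vw sdegE; ring.
    exact: (lact_hom (ins q y v)).
  rewrite -spl_scale; apply: eq_spl => v w _.
  by rewrite (lactZ _ _ (lact_hom (ins q y v) (hom w))); lincomb k M.
rewrite -spl_assoc; apply: eq_spl => t w _.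
rewrite /ins (cupE _ _ _ hx) /lcup (lact_vspl _ _ _ (hom w)) -spl_scale.
apply: eq_spl => u v uv; rewrite (lact_vZ _ _ _ (hom w)).
rewrite -(lactA _ _ (hom w)) /hmul /= !(cochain_reg_hom _ hx) (cochain_reg_hom _ hy).
have -> : p + q + sdeg t = p + sdeg u + (q + sdeg v) by rewrite -uv sdegE; ring.
by rewrite !scalerA -uv; congr (_ *: _); sg_ring.
Qed.

Lemma insop_vD (V : lmodType k) q c y z (F : seq (helt A) -> V) s :
  multilinear F ->
  insop q (fun t => c *: y t + z t) F s = c *: insop q y F s + insop q z F s.
Proof.
move=> mF; rewrite /insop -spl_scale -spl_add; apply: eq_spl => u r _.
rewrite -spl_scale -spl_add; apply: eq_spl => v w _.
by rewrite /ins mF; lincomb k V.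
Qed.

Lemma circ_reg q x y s : circ q x y s = insop (V := reg A) q y x s.
Proof. exact: circE. Qed.

(** [circ] fails to be compatible with the differentials by the commutator of the cup product. The
    two cup products arise when [insop q y] passes the outer actions in [delta p x], and [delta q y]
    arises when it passes the insertion of [mu]. *)
Lemma delta_circ p q x y s : cochain (reg A) p x -> cochain (reg A) q y ->
  delta (reg A) (p + q - 1) (circ q x y) s =
    circ q (delta (reg A) p x) y s
  - (-1) ^ p *: circ (q + 1) x (delta (reg A) q y) s
  - (-1) ^ p *: cup q x y s + (-1) ^ (p * (q + 1)) *: cup p y x s.
Proof.
move=> hx hy; have mx := cochain_multilinear hx.
have cE : circ q x y = insop (V := reg A) q y x by apply/funext => t; rewrite circ_reg.
have hxy := circ_cochain hx hy.
rewrite deltaE; last exact: cochain_multilinear hxy.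
rewrite !circ_reg cE.
have -> : delta (reg A) q y = (fun t => (-1) ^ q *: circ 2 y mu t + circ q mu y t).
  by apply/funext => t; rewrite delta_reg // addrC.
rewrite (insop_vD (V := reg A)) //.
have -> : delta (reg A) p x = (fun t => bdop (M := reg A) p x t
    + (-1) ^ p *: insop (V := reg A) 2 mu x t + rop (M := reg A) p x t + lop (M := reg A) p x t).
  by apply/funext => t; rewrite deltaE.
rewrite !insopD insopZ (insop_bdop _ _ _ hx) (insop_rop _ _ _ hx).
rewrite (insop_lop _ _ _ hx) (insop_insop 2 q mu y) //.
have -> : 2 + q - 1 = q + 1 by ring.
rewrite (rcup_cup _ hx hy) -(cupE _ _ _ hy).
have -> : lop (p + q + 1) (insop (V := reg A) q y x) s =
    lop (p + q - 1) (insop (V := reg A) q y x) s.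
  by case: (s) => [|a t] //; congr (- _); sg_collect.
lincomb k (reg A).
Qed.

Lemma gerst_cochain p q x y : cochain (reg A) p x -> cochain (reg A) q y ->
  cochain (reg A) (p + q - 1) (gerst p q x y).
Proof.
move=> hx hy; have -> : gerst p q x y =
    - (-1) ^ ((p + 1) * (q + 1)) *: circ p y x + circ q x y.
  by apply/funext => s; rewrite /gerst scaleNr addrC.
apply: (cochainL (M := reg A)); last exact: circ_cochain.
have -> : p + q - 1 = q + p - 1 by ring.
exact: circ_cochain.
Qed.

(** The cup products in [delta_circ] are interchanged by swapping [x] and [y], and cancel in the
    antisymmetrization. *)
Lemma delta_gerst p q x y s : cochain (reg A) p x -> cochain (reg A) q y ->
  delta (reg A) (p + q - 1) (gerst p q x y) s =
    gerst (p + 1) q (delta (reg A) p x) y s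
  - (-1) ^ p *: gerst p (q + 1) x (delta (reg A) q y) s.
Proof.
move=> hx hy; have -> : gerst p q x y =
    - (-1) ^ ((p + 1) * (q + 1)) *: circ p y x + circ q x y.
  by apply/funext => t; rewrite /gerst scaleNr addrC.
have E : p + q - 1 = q + p - 1 by ring.
have hyx : cochain (reg A) (p + q - 1) (circ p y x) by rewrite E; apply: circ_cochain.
have hxy := circ_cochain hx hy.
have -> : forall f g : seq (helt A) -> reg A, cochain (reg A) (p + q - 1) f ->
    cochain (reg A) (p + q - 1) g -> forall c, delta (reg A) (p + q - 1) (c *: f + g) s =
    c *: delta (reg A) (p + q - 1) f s + delta (reg A) (p + q - 1) g s.
- by move=> f g hf hg c; rewrite delta_lin.
- rewrite (delta_circ s hx hy) E (delta_circ s hy hx) /gerst.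
  lincomb k (reg A).
- by [].
- by [].
Qed.

End RegularOperations.

(** * Calculus on forms *)

Section Forms.
Variables (k : fieldType) (A : augDGA k).
Implicit Types (s u v w t : seq (helt A)) (a b c : helt A).
Implicit Types (f g : seq (helt A) -> A) (phi : helt A -> seq (helt A) -> k^o).
Implicit Types (psi : seq (helt A) -> k^o).

(** Insertion changes the degree of a word by [q - 1], so a sign depending affinely on that degree
    is the same for all summands; [q + 1] has the same parity. *)
Lemma insop_sgn (V : lmodType k) q f (F : seq (helt A) -> V) s (e m : int) :
  insop q f (fun t => (-1) ^ (e + m * sdeg t) *: F t) s =
  (-1) ^ (e + m * (sdeg s + q + 1)) *: insop q f F s.
Proof.
rewrite /insop -spl_scale; apply: eq_spl => u r ur; rewrite -spl_scale.
by apply: eq_spl => v w vw; rewrite -ur -vw; lincomb k V.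
Qed.

Lemma insop_exchange (V : lmodType k) q f r g
    (F : seq (helt A) -> seq (helt A) -> V) s t :
  insop q f (fun s' => insop r g (F s') t) s =
  insop r g (fun t' => insop q f (F^~ t') s) t.
Proof.
rewrite /insop.
under eq_spl => u x _ do under eq_spl => v w _ do rewrite -spl_scale.
under eq_spl => u x _ do rewrite spl_exchange.
rewrite spl_exchange; apply: eq_spl => u' x' _.
transitivity (spl s (fun u x => spl x (fun v w => spl x' (fun v' w' =>
   (-1) ^ ((q + 1) * sdeg u + (r + 1) * sdeg u') *:
     F (u ++ ins q f v :: w) (u' ++ ins r g v' :: w'))))).
  apply: eq_spl => u x _; apply: eq_spl => v w _; rewrite -spl_scale.
  by apply: eq_spl => v' w' _; lincomb k V.
under eq_spl => u x _ do rewrite spl_exchange.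
rewrite spl_exchange; apply: eq_spl => v' w' _.
rewrite -spl_scale; apply: eq_spl => u x _; rewrite -spl_scale.
by apply: eq_spl => v w _; lincomb k V.
Qed.

Definition formlike phi : Prop :=
  (forall q (e : k) (x y : A) s,
    phi (hpr q (e *: x + y)) s = e *: phi (hpr q x) s + phi (hpr q y) s) /\
  (forall a, multilinear (phi a)).

Section FormLike.
Variables (phi : helt A -> seq (helt A) -> k^o).
Hypothesis mphi : formlike phi.

Lemma form0 q s : phi (hpr q 0) s = 0.
Proof.
have := proj1 mphi q 1 0 0 s; rewrite !scale1r addr0.
by move=> E; apply: (addrI (phi (hpr q 0) s)); rewrite addr0 -E.
Qed.

Lemma formD q (x y : A) s :
  phi (hpr q (x + y)) s = phi (hpr q x) s + phi (hpr q y) s.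
Proof. by have := proj1 mphi q 1 x y s; rewrite !scale1r. Qed.

Lemma formZ q (e : k) (x : A) s : phi (hpr q (e *: x)) s = e *: phi (hpr q x) s.
Proof. by have := proj1 mphi q e x 0 s; rewrite form0 !addr0. Qed.

Lemma form_spl q T (r : seq T) (G : seq T -> seq T -> A) s :
  phi (hpr q (spl r G)) s = spl r (fun i j => phi (hpr q (G i j)) s).
Proof.
apply: (@spl_additive _ A (k^o) (fun x : A => phi (hpr q x) s)).
  exact: form0.
by move=> x y; rewrite formD.
Qed.

Lemma form_ins_multilinear p f w : multilinear f ->
  multilinear (fun t => phi (ins p f t) w).
Proof.
move=> mf s1 s2 q e x y; rewrite /ins mf (proj1 mphi).
by rewrite !sdegE.
Qed.

End FormLike.

(* The Lie derivative along [f] of a form [phi a s] on A (x) T(sA): [rotE] feeds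
   to [f] the cyclic subwords through [a], [insop] the other ones. *)
Definition rotE p f phi a s : k^o :=
  spl s (fun u r => spl r (fun w v =>
    (-1) ^ (sdeg v * (sdeg (a :: u) + sdeg w)) *: phi (ins p f (v ++ a :: u)) w)).

Definition lie p f phi a s : k^o :=
  rotE p f phi a s + (-1) ^ ((p + 1) * (hdeg a - 1)) *: insop p f (phi a) s.

Definition cyc psi a s : k^o :=
  spl s (fun u v => (-1) ^ (sdeg (a :: u) * sdeg v) *: psi (v ++ a :: u)).

(** Inserting [f] and rotating commute. In a rotation of the cyclic word, a block avoiding [a]
    contributes to the [insop] part of [lie], a block through [a] to [rotE]. *)
Lemma lie_cyc p f psi a s : lie p f (cyc psi) a s = cyc (insop p f psi) a s.
Proof.
rewrite /lie /cyc.
under [RHS]eq_spl => u v _ do rewrite insop_cat_cons !scalerDr.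
rewrite !spl_add addrC; congr (_ + _).
  rewrite insop_spl scalerDr addrC; congr (_ + _); rewrite -spl_scale.
    apply: eq_spl => u v _.
    transitivity ((-1) ^ ((p + 1) * (hdeg a - 1)) *: ((-1) ^ ((p + 1) * sdeg u) *:
      insop p f (fun v' => (-1) ^ (0 + sdeg (a :: u) * sdeg v') *:
        psi (v' ++ a :: u)) v)).
      by do 2!congr (_ *: _); apply: eq_insop => v'; rewrite add0r.
    rewrite insop_sgn; lincomb k (k^o).
  apply: eq_spl => u v _.
  transitivity ((-1) ^ ((p + 1) * (hdeg a - 1)) *:
    insop p f (fun u' => (-1) ^ ((hdeg a - 1) * sdeg v + sdeg v * sdeg u') *:
      psi (v ++ a :: u')) u).
    congr (_ *: _); apply: eq_insop => u'; lincomb k (k^o).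
  rewrite insop_sgn; lincomb k (k^o).
rewrite /rotE.
transitivity (spl s (fun u1 r => spl r (fun w v2 => spl w (fun u2 v1 =>
    (-1) ^ (sdeg (a :: u1 ++ u2) * (sdeg v1 + sdeg v2) + (p + 1) * sdeg v1) *:
      psi (v1 ++ ins p f (v2 ++ a :: u1) :: u2))))).
  apply: eq_spl => u1 r _; apply: eq_spl => w v2 _; rewrite -spl_scale.
  by apply: eq_spl => u2 v1 vw; rewrite -vw; lincomb k (k^o).
under eq_spl => u1 r _ do rewrite spl_assoc.
rewrite -spl_assoc; apply: eq_spl => u v _.
rewrite spl_exchange -spl_scale; apply: eq_spl => v1 v2 vv; rewrite -spl_scale.
by apply: eq_spl => u1 u2 uu; rewrite -uu -vv; lincomb k (k^o).
Qed.

Definition first_form phi t : k^o := if t is c :: t' then phi c t' else 0.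

Definition last_form phi t : k^o :=
  if t is c :: t' then
    (-1) ^ ((hdeg (last c t') - 1) * sdeg (belast c t')) *:
      phi (last c t') (belast c t')
  else 0.

Lemma last_form_rcons phi t c :
  last_form phi (rcons t c) = (-1) ^ ((hdeg c - 1) * sdeg t) *: phi c t.
Proof. by case: t => [|b t] //=; rewrite belast_rcons last_rcons. Qed.

(** The two forms differ by a rotation of one letter, which a sum over all rotations does not
    see. *)
Lemma cyc_first_last phi a s :
  cyc (first_form phi) a s = cyc (last_form phi) a s.
Proof.
rewrite /cyc spl_spl1_r [in RHS]spl_spl1_l; congr (_ + _).
  by rewrite /= cats1 last_form_rcons; lincomb k (k^o).
apply: eq_spl1 => u c v _ /=; rewrite -rcons_cons -rcons_cat last_form_rcons.
lincomb k (k^o).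
Qed.

Lemma form_mu phi a b s : formlike phi ->
  phi (ins 2 mu [:: a; b]) s = (-1) ^ (hdeg a) *: phi (hmul a b) s.
Proof.
move=> mphi; rewrite -(formZ mphi); congr (phi (hpr _ _) _).
by rewrite !sdegE; ring.
Qed.

(** The cyclic subwords through [a] on which [mu] can be nonzero are [a] alone, [a] with the letter
    after it, and the last letter of the word with [a]. *)
Lemma rotE_mu phi a s : formlike phi ->
  rotE 2 mu phi a s = phi (hd a) s
  + (if s is c :: w then (-1) ^ (hdeg a) *: phi (hmul a c) w else 0)
  + (if s is c :: w then
       (-1) ^ ((hdeg (last c w) - 1) * (hdeg a - 1 + sdeg (belast c w))
               + hdeg (last c w)) *: phi (hmul (last c w) a) (belast c w)
     else 0).
Proof.
move=> mphi.
have mu0 (n : int) t w : (2 < size t)%N -> (-1) ^ n *: phi (ins 2 mu t) w = 0.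
  by move=> t2; rewrite /ins mu_gt2 // (form0 mphi) scaler0.
rewrite /rotE spl_spl1_l addrAC; congr (_ + _).
  rewrite spl_spl1_r; congr (_ + _).
    by rewrite /= sdeg_nil mul0r expr0z scale1r ins_mu1.
  case/lastP: s => [|s c]; first by rewrite spl1_nil.
  rewrite spl1_last => [|w c' [|c'' v] _]//; last first.
    by rewrite mu0 // size_cat /=; lia.
  case: s => [|b s].
    by rewrite /= (form_mu _ _ _ mphi); lincomb k (k^o).
  rewrite rcons_cons last_rcons belast_rcons [_ ++ _]/= (form_mu _ _ _ mphi).
  lincomb k (k^o).
case: s => [|c s]; first by rewrite spl1_nil.
rewrite spl1_first => [|[|b u] c' t _]//; last first.
  apply: spl_eq0 => w v _; rewrite mu0 //.
  by rewrite size_cat /= size_rcons; lia.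
rewrite spl_only_nil_r => [|w [|b v] _]//; last first.
  by rewrite mu0 // size_cat /=; lia.
by rewrite [_ ++ _]/= (form_mu _ _ _ mphi); lincomb k (k^o).
Qed.

(* The form [phi] composed with Connes' operator. *)
Definition bform phi := cyc (phi hone).

(** With coefficient 1 the differential of the coefficient vanishes, and its products with the first
    and the last letter give back those letters as coefficients. *)
Lemma lie_mu_one phi t : formlike phi ->
  lie 2 mu phi hone t =
    - insop 2 mu (phi hone) t + first_form phi t - last_form phi t.
Proof.
move=> mphi; rewrite /lie rotE_mu //.
rewrite hd_one (form0 mphi) add0r hdeg_one.
case: t => [|c t]; first by rewrite /=; lincomb k (k^o).
by rewrite !(hmul_1l, hmul_1r) /=; lincomb k (k^o).
Qed.

(** Connes' operator anticommutes with the Hochschild differential: in [lie_mu_one] the two boundary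
    terms have the same cyclic sum, and the insertion of [mu] passes through the rotations by
    [lie_cyc]. *)
Lemma bform_lie_mu phi a s : formlike phi ->
  bform (lie 2 mu phi) a s = - lie 2 mu (bform phi) a s.
Proof.
move=> mphi; rewrite /bform lie_cyc.
have -> : lie 2 mu phi hone = (fun t => - insop 2 mu (phi hone) t
    + first_form phi t - last_form phi t).
  by apply/funext => t; rewrite lie_mu_one.
have := cyc_first_last phi a s; rewrite /cyc => E.
rewrite -[RHS]addr0 -(subrr (spl s (fun u v => (-1) ^ (sdeg (a :: u) * sdeg v)
  *: first_form phi (v ++ a :: u)))) {2}E -!spl_opp -!spl_add.
by apply: eq_spl => u v _; lincomb k (k^o).
Qed.

(** The first application puts a unit in the coefficient, the second moves it into the word, where a
    normalized form vanishes. *)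
Lemma bform_bform phi a s :
  (forall s1 s2, phi hone (s1 ++ hone :: s2) = 0) ->
  bform (bform phi) a s = 0.
Proof.
move=> nphi; apply: spl_eq0 => u v _; rewrite /bform /cyc spl_eq0 ?scaler0 //.
move=> u' v' _; rewrite nphi scaler0 //.
Qed.

End Forms.

(** * The commutator of Connes' operator with a contraction *)

Section Homotopies.
Variables (k : fieldType) (A : augDGA k).
Implicit Types (s u v w t : seq (helt A)) (a b c : helt A).
Implicit Types (f g : seq (helt A) -> A) (phi : helt A -> seq (helt A) -> k^o).
Implicit Types (psi : seq (helt A) -> k^o).

Lemma insop_sum (V : lmodType k) q f (r : seq (helt A))
    (H : seq (helt A) -> seq (helt A) -> seq (helt A) -> V) s :
  insop q f (fun t => spl r (fun i j => H i j t)) s =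
  spl r (fun i j => insop q f (H i j) s).
Proof.
rewrite /insop [RHS]spl_exchange; apply: eq_spl => u x _.
rewrite [RHS]spl_exchange; apply: eq_spl => v w _.
by rewrite spl_scale.
Qed.

(** For a cocycle the nested terms of [insop_insop] cancel, because [delta_reg] equates
    [circ q mu g] with a multiple of [circ 2 g mu]. *)
Lemma insop_insop_mu (V : lmodType k) q g (F : seq (helt A) -> V) s :
  cocycle (reg A) q g -> multilinear F ->
  insop q g (insop 2 mu F) s = (-1) ^ (q + 1) *: insop 2 mu (insop q g F) s.
Proof.
move=> [hg dg] mF; rewrite insop_insop //.
have -> : circ q mu g = (fun t => - (-1) ^ q *: circ 2 g mu t + 0).
  apply/funext => t; rewrite addr0 scaleNr; apply/eqP; rewrite -addr_eq0.
  by rewrite -(delta_reg _ hg) dg.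
rewrite insop_vD //.
have -> : insop (q + 2 - 1) (fun=> 0) F s = 0.
  apply: spl_eq0 => u r _; apply: spl_eq0 => v w _.
  by rewrite /ins (multilinear0 mF) scaler0.
lincomb k V.
Qed.

(** With [g] inserted after [a], the block of [mu] lies in [v], lies after [a], or contains [a]. In
    the last case it either takes in the output of [g], giving the product with [a], or consists of
    original letters. *)
Lemma insop_tail_mu q g psi v a u :
  cocycle (reg A) q g -> multilinear psi ->
  insop q g (fun t => insop 2 mu psi (v ++ a :: t)) u =
    insop 2 mu (fun t => insop q g (fun t' => psi (t ++ a :: t')) u) v
  + (-1) ^ (sdeg (rcons v a) + (q + 1)) *:
      insop 2 mu (insop q g (fun t => psi (v ++ a :: t))) u
  + spl u (fun u1 u2 =>
      (-1) ^ (sdeg v + hdeg a) *: psi (v ++ hmul a (ins q g u1) :: u2))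
  + spl v (fun v1 v2 => spl u (fun u1 u2 => (-1) ^ (sdeg v1 + (q + 1) * sdeg u1) *:
      insop q g (fun t => psi (v1 ++ ins 2 mu (v2 ++ a :: u1) :: t)) u2)).
Proof.
move=> hg mpsi.
transitivity (insop q g (fun t =>
    insop 2 mu (fun v' => psi (v' ++ a :: t)) v
  + (-1) ^ ((2 + 1) * sdeg (rcons v a)) *: insop 2 mu (fun t' => psi (v ++ a :: t')) t
  + spl t (fun u1 u2 => spl v (fun v1 v2 =>
      (-1) ^ ((2 + 1) * sdeg v1) *: psi (v1 ++ ins 2 mu (v2 ++ a :: u1) :: u2)))) u).
  by apply: eq_insop => t; rewrite insop_cat_cons [in RHS]spl_exchange.
rewrite !insopD insopZ -!addrA; congr (_ + (_ + _)).
- exact: insop_exchange.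
- rewrite (insop_insop_mu _ hg); first by lincomb k (k^o).
  by move=> s1 s2 e n x y; rewrite -!cat_cons !catA mpsi.
rewrite insop_spl; congr (_ + _).
  apply: eq_spl => u1 u2 _; rewrite /insop.
  (* The letter [a] and the output of [g] already make two letters, so a block with any further
     letter contributes zero: the cuts on either side of these two letters are forced. *)
  have mu0 (n : int) t w s : (2 < size t)%N -> (-1) ^ n *: psi (s ++ ins 2 mu t :: w) = 0.
    by move=> t2; rewrite /ins mu_gt2 // (multilinear0 mpsi) scaler0.
  rewrite spl_only_nil => [|[|x1 x] r _ //]; last first.
    apply: spl_eq0 => y z _; rewrite spl_eq0 ?scaler0 // => v1 v2 _.
    by rewrite mu0 // !size_cat /= size_cat /=; lia.
  rewrite spl_only_nil_r => [|y [|z1 z] _ //]; last first.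
    rewrite spl_eq0 ?scaler0 // => v1 v2 _.
    by rewrite mu0 // !size_cat /=; lia.
  rewrite spl_only_nil_r => [|v1 [|x1 v2] _ //]; last first.
    by rewrite mu0 // size_cat /=; lia.
  by rewrite [[::] ++ _]/= (multilinear_mu2 mpsi); lincomb k (k^o).
transitivity (spl u (fun u1 u2 => spl v (fun v1 v2 =>
    (-1) ^ (sdeg v1 + (q + 1) * sdeg u1) *:
      insop q g (fun t => psi (v1 ++ ins 2 mu (v2 ++ a :: u1) :: t)) u2))).
  apply: eq_spl => u1 u2 _; rewrite insop_sum -spl_scale; apply: eq_spl => v1 v2 _.
  by rewrite insopZ; lincomb k (k^o).
exact: spl_exchange.
Qed.

Definition contr_form q g phi a s : k^o :=
  spl s (fun u v => (-1) ^ (q * (hdeg a + 1)) *: phi (hmul a (ins q g u)) v).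

(** The rotations of the cyclic word, as in [cyc], with [f] inserted among the letters that follow
    [a]. *)
Definition htail p f psi a s : k^o :=
  spl s (fun u v =>
    (-1) ^ (sdeg v * sdeg (a :: u) + (p + 1) * (hdeg a - 1 + sdeg v)) *:
      insop p f (fun t => psi (v ++ a :: t)) u).

(** Of the four terms of [insop_tail_mu], the product with [a] gives the contraction ([E3]), the
    blocks through [a] the [rotE] part of the Lie derivative along [mu] ([E4]), and the two families
    of blocks avoiding [a] its [insop] part ([E12]). *)
Lemma htail_mu p f psi a s : cocycle (reg A) p f -> multilinear psi ->
  htail p f (insop 2 mu psi) a s =
    - contr_form p f (cyc psi) a s
    - (-1) ^ p *: lie 2 mu (htail p f psi) a s.
Proof.
move=> hf mpsi; rewrite {1}/htail.
under eq_spl => u v _ do rewrite insop_tail_mu // !scalerDr.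
rewrite !spl_add /lie.
have E3 : spl s (fun u v =>
    (-1) ^ (sdeg v * sdeg (a :: u) + (p + 1) * (hdeg a - 1 + sdeg v)) *:
    spl u (fun u1 u2 => (-1) ^ (sdeg v + hdeg a) *:
      psi (v ++ hmul a (ins p f u1) :: u2))) = - contr_form p f (cyc psi) a s.
  rewrite /contr_form /cyc -spl_opp.
  under [RHS]eq_spl => u v _ do rewrite -spl_scale -spl_opp.
  rewrite -spl_assoc; apply: eq_spl => u v _; rewrite -spl_scale.
  by apply: eq_spl => u1 u2 uu; rewrite -uu; lincomb k (k^o).
have E4 : spl s (fun u v =>
    (-1) ^ (sdeg v * sdeg (a :: u) + (p + 1) * (hdeg a - 1 + sdeg v)) *:
    spl v (fun v1 v2 => spl u (fun u1 u2 => (-1) ^ (sdeg v1 + (p + 1) * sdeg u1) *: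
      insop p f (fun t => psi (v1 ++ ins 2 mu (v2 ++ a :: u1) :: t)) u2))) =
    - (-1) ^ p *: rotE 2 mu (htail p f psi) a s.
  rewrite /rotE /htail -spl_scale.
  transitivity (spl s (fun u v => spl u (fun u1 u2 => spl v (fun v1 v2 =>
    (-1) ^ ((sdeg v1 + sdeg v2) * (sdeg (a :: u1) + sdeg u2)
            + (p + 1) * (hdeg a - 1 + sdeg v1 + sdeg v2 + sdeg u1) + sdeg v1) *:
      insop p f (fun t => psi (v1 ++ ins 2 mu (v2 ++ a :: u1) :: t)) u2)))).
    apply: eq_spl => u v _; rewrite [RHS]spl_exchange -spl_scale.
    apply: eq_spl => v1 v2 vv; rewrite -spl_scale; apply: eq_spl => u1 u2 uu.
    by rewrite -uu -vv; lincomb k (k^o).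
  rewrite spl_assoc; apply: eq_spl => u1 r _; rewrite -spl_scale.
  symmetry; transitivity (spl r (fun w v2 => spl w (fun u2 v1 =>
    (-1) ^ ((sdeg v1 + sdeg v2) * (sdeg (a :: u1) + sdeg u2)
            + (p + 1) * (hdeg a - 1 + sdeg v1 + sdeg v2 + sdeg u1) + sdeg v1) *:
      insop p f (fun t => psi (v1 ++ ins 2 mu (v2 ++ a :: u1) :: t)) u2))).
    apply: eq_spl => w v2 _; rewrite -!spl_scale; apply: eq_spl => u2 v1 ww.
    by rewrite -ww; lincomb k (k^o).
  exact: spl_assoc.
have E12 : spl s (fun u v =>
    (-1) ^ (sdeg v * sdeg (a :: u) + (p + 1) * (hdeg a - 1 + sdeg v)) *:
      insop 2 mu (fun t => insop p f (fun t' => psi (t ++ a :: t')) u) v)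
  + spl s (fun u v =>
    (-1) ^ (sdeg v * sdeg (a :: u) + (p + 1) * (hdeg a - 1 + sdeg v)) *:
      ((-1) ^ (sdeg (rcons v a) + (p + 1)) *:
        insop 2 mu (insop p f (fun t => psi (v ++ a :: t))) u)) =
  - (-1) ^ p *: ((-1) ^ ((2 + 1) * (hdeg a - 1)) *:
      insop 2 mu (htail p f psi a) s).
  rewrite /htail insop_spl !scalerDr addrC -!spl_scale.
  congr (_ + _); apply: eq_spl => u v _.
    transitivity (- (-1) ^ p *: ((-1) ^ ((2 + 1) * (hdeg a - 1)) *:
      insop 2 mu (fun u' => (-1) ^ (sdeg v * (hdeg a - 1)
        + (p + 1) * (hdeg a - 1 + sdeg v) + sdeg v * sdeg u') *:
        insop p f (fun t => psi (v ++ a :: t)) u') u)).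
      by rewrite insop_sgn; lincomb k (k^o).
    by do 2!congr (_ *: _); apply: eq_insop => u'; lincomb k (k^o).
  transitivity (- (-1) ^ p *: ((-1) ^ ((2 + 1) * (hdeg a - 1)) *:
    ((-1) ^ ((2 + 1) * sdeg u) *:
      insop 2 mu (fun v' => (-1) ^ ((p + 1) * (hdeg a - 1)
        + (sdeg (a :: u) + (p + 1)) * sdeg v') *:
        insop p f (fun t => psi (v' ++ a :: t)) u) v))).
    by rewrite insop_sgn; lincomb k (k^o).
  by do 3!congr (_ *: _); apply: eq_insop => u'; lincomb k (k^o).
rewrite E3 E4 E12.
lincomb k (k^o).
Qed.

(** Sort the terms by the letter that becomes the coefficient. On the left it is the output of [f],
    whose block contains [a] ([rotE]) or stops before it ([X]). On the right, [first_form] and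
    [last_form] share the terms [Y] with another letter as coefficient; the rest of the first is the
    [insop] part of [lie], the rest of the second is [X]. *)
Lemma bform_contr p f phi a s : formlike phi ->
  (-1) ^ p *: bform (contr_form p f phi) a s =
    lie p f phi a s - htail p f (first_form phi) a s
      + htail p f (last_form phi) a s.
Proof.
move=> mphi; pose X := spl s (fun u v => spl v (fun v1 v2 =>
  (-1) ^ (sdeg (a :: u) * (sdeg v1 + sdeg v2)) *:
    phi (ins p f v1) (v2 ++ a :: u))).
pose Y := spl1 s (fun u c v =>
  (-1) ^ (sdeg (c :: v) * sdeg (a :: u)
          + (p + 1) * (hdeg a - 1 + sdeg (c :: v))) *:
    insop p f (fun t => phi c (v ++ a :: t)) u).
have -> : (-1) ^ p *: bform (contr_form p f phi) a s = X + rotE p f phi a s.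
  rewrite /bform /cyc /contr_form.
  under eq_spl => u v _ do rewrite spl_cat_cons scalerDr.
  rewrite spl_add scalerDr -!spl_scale; congr (_ + _).
    apply: eq_spl => u v _; rewrite -!spl_scale; apply: eq_spl => v1 v2 vv.
    by rewrite hmul_1l -vv; lincomb k (k^o).
  rewrite /rotE -spl_assoc; apply: eq_spl => u v _.
  rewrite -!spl_scale; apply: eq_spl => u1 u2 uu.
  by rewrite hmul_1l -uu; lincomb k (k^o).
have -> : htail p f (first_form phi) a s =
    (-1) ^ ((p + 1) * (hdeg a - 1)) *: insop p f (phi a) s + Y.
  rewrite /htail spl_spl1_r; congr (_ + _).
  by rewrite (eq_insop p f _ (G := phi a)) //; lincomb k (k^o).
have -> : htail p f (last_form phi) a s = X + Y.
  pose Z := spl s (fun u v =>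
    (-1) ^ (sdeg v * sdeg (a :: u) + (p + 1) * (hdeg a - 1 + sdeg v)) *:
      spl u (fun u1 u2 => (-1) ^ ((p + 1) * sdeg u1) *:
        last_form phi (v ++ a :: rcons u1 (ins p f u2)))).
  (* In [Z] the block of [f] reaches the end of the word, so its output is the last letter, which
     [last_form] turns into the coefficient. *)
  have -> : X = Z.
    rewrite /X -[LHS]spl_assoc /Z; apply: eq_spl => r v _; rewrite -spl_scale.
    apply: eq_spl => u1 u2 uu; rewrite -uu -rcons_cons -rcons_cat.
    by rewrite last_form_rcons; lincomb k (k^o).
  rewrite /htail spl_spl1_l /Z [X in _ = X + _]spl_spl1_l spl_nil insop_nil -[RHS]addrA; congr (_ + _).
    by rewrite [rcons [::] _]/=; lincomb k (k^o).
  rewrite /Y /spl1 -spl_add; apply: eq_spl => u [|c v] _; first by rewrite addr0.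
  rewrite insop_rcons scalerDr addrC; congr (_ + _).
  transitivity ((-1) ^ (sdeg v * sdeg (a :: rcons u c)
      + (p + 1) * (hdeg a - 1 + sdeg v)) *:
    insop p f (fun t => (-1) ^ ((hdeg c - 1) * (sdeg v + (hdeg a - 1))
      + (hdeg c - 1) * sdeg t) *: phi c (v ++ a :: t)) u).
    congr (_ *: _); apply: eq_insop => t.
    by rewrite -rcons_cons -rcons_cat last_form_rcons; lincomb k (k^o).
  by rewrite insop_sgn; lincomb k (k^o).
rewrite /lie; lincomb k (k^o).
Qed.

(* The homotopy S_f of Getzler, Daletskii and Tsygan. *)
Definition contr_lift p f phi := htail p f (phi hone).

(** The boundary terms that [bform_contr] leaves over are exactly those of [lie_mu_one]. They are
    thus supplied by applying the homotopy to the differential of [phi], and [htail_mu] supplies the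
    contraction of [bform phi]. *)
Lemma bform_contr_comm p f phi a s : cocycle (reg A) p f -> formlike phi ->
  (-1) ^ p *: bform (contr_form p f phi) a s - contr_form p f (bform phi) a s =
    lie p f phi a s + (-1) ^ p *: lie 2 mu (contr_lift p f phi) a s
      - contr_lift p f (lie 2 mu phi) a s.
Proof.
move=> hf mphi; rewrite bform_contr // /contr_lift.
have -> : lie 2 mu phi hone = (fun t => - insop 2 mu (phi hone) t
    + first_form phi t - last_form phi t).
  by apply/funext => t; rewrite lie_mu_one.
have -> : htail p f (fun t => - insop 2 mu (phi hone) t
    + first_form phi t - last_form phi t) a s =
    - htail p f (insop 2 mu (phi hone)) a s
    + htail p f (first_form phi) a s - htail p f (last_form phi) a s.
  rewrite /htail -!spl_opp -!spl_add; apply: eq_spl => u v _.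
  rewrite -!scalerN -!scalerDr; congr (_ *: _).
  rewrite -!scaleN1r -!insopZ -!insopD; apply: eq_insop => t.
  by rewrite !scaleN1r.
rewrite (htail_mu _ _ hf (proj2 mphi hone)) -/(bform phi).
lincomb k (k^o).
Qed.

End Homotopies.

(** * The commutator of a Lie derivative with a contraction *)

Section LieContraction.
Variables (k : fieldType) (A : augDGA k).
Implicit Types (s u v w t : seq (helt A)) (a b c : helt A).
Implicit Types (f g : seq (helt A) -> A) (phi : helt A -> seq (helt A) -> k^o).
Implicit Types (X : seq (helt A) -> seq (helt A) -> k^o).

Lemma form_ins_insop p q f g phi t w : formlike phi ->
  phi (ins (p + q - 1) (insop q g f) t) w =
  insop q g (fun t' => phi (ins p f t') w) t.
Proof.
move=> mphi; rewrite /ins /insop (form_spl mphi); apply: eq_spl => u r ur.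
rewrite (form_spl mphi); apply: eq_spl => v x vx; rewrite (formZ mphi).
congr (_ *: phi (hpr _ _) _).
by rewrite -ur -vx !sdegE; ring.
Qed.

Lemma formlike_hmul phi a : formlike phi -> formlike (fun b => phi (hmul a b)).
Proof.
move=> mphi; split=> [q e x y s|b]; last exact: (proj2 mphi).
by rewrite /hmul !hval_hpr linearP mulrDr -scalerAr (proj1 mphi).
Qed.

Lemma hd_ins p f t : cochain (reg A) p f ->
  hd (ins p f t) = ins (p + 1) (bdop (M := reg A) p f) t.
Proof.
by move=> hf; rewrite /hd (hval_ins _ hf) hdeg_ins /ins; congr hpr; ring.
Qed.

(** A version of [htail] with two arcs: the arc [v ++ a :: u] through [a], with [g] inserted after
    [a], goes to the first argument of [X], the complementary arc [w] to the second. If [X] is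
    supported on the empty [w] it reduces to [htail]. *)
Definition tgen q g X a s : k^o :=
  spl s (fun u r => spl r (fun w v =>
    (-1) ^ (sdeg v * (sdeg (a :: u) + sdeg w) + (q + 1) * (hdeg a - 1 + sdeg v)) *:
      insop q g (fun t => X (v ++ a :: t) w) u)).

Lemma tgenD q g X Y a s :
  tgen q g (fun t w => X t w + Y t w) a s = tgen q g X a s + tgen q g Y a s.
Proof.
rewrite /tgen -spl_add; apply: eq_spl => u r _; rewrite -spl_add.
by apply: eq_spl => w v _; rewrite insopD scalerDr.
Qed.

Lemma tgenZ q g X e a s :
  tgen q g (fun t w => e *: X t w) a s = e *: tgen q g X a s.
Proof.
rewrite /tgen -spl_scale; apply: eq_spl => u r _; rewrite -spl_scale.
by apply: eq_spl => w v _; rewrite insopZ; lincomb k (k^o).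
Qed.

(* The homotopy between the contraction with [f, g] and the commutator of the
   Lie derivative along [f] with the contraction with [g]. *)
Definition lie_lift p f q g phi := tgen q g (fun t w => phi (ins p f t) w).

Lemma insop_spl3 (V : lmodType k) q f
    (H : seq (helt A) -> seq (helt A) -> seq (helt A) -> V) s :
  insop q f (fun t => spl t (fun u r => spl r (fun w v => H u w v))) s =
    spl s (fun u r => spl r (fun w v => insop q f (fun u' => H u' w v) u))
  + spl s (fun u r => spl r (fun w v => (-1) ^ ((q + 1) * sdeg u) *:
      insop q f (fun w' => H u w' v) w))
  + spl s (fun u r => spl r (fun w v => (-1) ^ ((q + 1) * (sdeg u + sdeg w)) *:
      insop q f (fun v' => H u w v') v)).
Proof.
rewrite insop_spl -addrA; congr (_ + _).
  by apply: eq_spl => u r _; rewrite insop_sum.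
rewrite -spl_add; apply: eq_spl => u r _; rewrite insop_spl scalerDr -!spl_scale.
congr (_ + _); apply: eq_spl => w v _; lincomb k V.
Qed.

(** The argument of [htail_mu] with the arc [w] as a spectator. The Lie derivative along [mu] also
    inserts into [w], and the last term corrects for this. *)
Lemma tgen_mu q g X a s : cocycle (reg A) q g ->
  (forall w, multilinear (X^~ w)) ->
  tgen q g (fun t w => insop 2 mu (X^~ w) t) a s =
    - (contr_form q g (fun b r => spl r (fun u r' => spl r' (fun w v =>
        (-1) ^ (sdeg v * (sdeg (b :: u) + sdeg w)) *: X (v ++ b :: u) w))) a s)
  - (-1) ^ q *: (lie 2 mu (tgen q g X) a s)
  + tgen q g (fun t w => (-1) ^ (sdeg t + 1) *: insop 2 mu (X t) w) a s.
Proof.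
move=> hg mX; rewrite {1}/tgen.
under eq_spl => u r _ do under eq_spl => w v _ do
  rewrite insop_tail_mu // !scalerDr.
under eq_spl => u r _ do rewrite !spl_add.
rewrite !spl_add /lie.
have E3 : spl s (fun u r => spl r (fun w v =>
    (-1) ^ (sdeg v * (sdeg (a :: u) + sdeg w) + (q + 1) * (hdeg a - 1 + sdeg v)) *:
    spl u (fun u1 u2 => (-1) ^ (sdeg v + hdeg a) *:
      X (v ++ hmul a (ins q g u1) :: u2) w))) =
   - (contr_form q g (fun b r => spl r (fun u r' => spl r' (fun w v =>
        (-1) ^ (sdeg v * (sdeg (b :: u) + sdeg w)) *: X (v ++ b :: u) w))) a s).
  rewrite /contr_form -spl_opp.
  under [RHS]eq_spl => u v _ do rewrite -spl_scale -spl_opp.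
  rewrite -[RHS]spl_assoc; apply: eq_spl => u r _.
  under [RHS]eq_spl => u1 u2 _ do rewrite -spl_scale -spl_opp.
  rewrite [RHS]spl_exchange; apply: eq_spl => w v _; rewrite -spl_scale.
  by apply: eq_spl => u1 u2 uu; rewrite -uu; lincomb k (k^o).
have E4 : spl s (fun u r => spl r (fun w v =>
    (-1) ^ (sdeg v * (sdeg (a :: u) + sdeg w) + (q + 1) * (hdeg a - 1 + sdeg v)) *:
    spl v (fun v1 v2 => spl u (fun u1 u2 => (-1) ^ (sdeg v1 + (q + 1) * sdeg u1) *:
      insop q g (fun t => X (v1 ++ ins 2 mu (v2 ++ a :: u1) :: t) w) u2)))) =
    - (-1) ^ q *: rotE 2 mu (tgen q g X) a s.
  pose G u1 u2 w v1 v2 : k^o :=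
    (-1) ^ ((sdeg v1 + sdeg v2) * (sdeg (a :: u1) + sdeg u2 + sdeg w)
            + (q + 1) * (hdeg a - 1 + sdeg v1 + sdeg v2 + sdeg u1) + sdeg v1) *:
      insop q g (fun t => X (v1 ++ ins 2 mu (v2 ++ a :: u1) :: t) w) u2.
  transitivity (spl s (fun u r => spl r (fun w v => spl v (fun v1 v2 =>
    spl u (fun u1 u2 => G u1 u2 w v1 v2))))).
    apply: eq_spl => u r _; apply: eq_spl => w v _; rewrite -spl_scale.
    apply: eq_spl => v1 v2 vv; rewrite -spl_scale; apply: eq_spl => u1 u2 uu.
    by rewrite /G -uu -vv; lincomb k (k^o).
  transitivity (spl s (fun u1 r => spl r (fun u2 r' => spl r' (fun w v =>
    spl v (fun v1 v2 => G u1 u2 w v1 v2))))).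
    rewrite -[RHS]spl_assoc; apply: eq_spl => u r _.
    under eq_spl => w v _ do rewrite spl_exchange.
    by rewrite spl_exchange.
  rewrite /rotE /tgen -spl_scale; apply: eq_spl => u1 r _; rewrite -spl_scale.
  symmetry; transitivity (spl r (fun W v2 => spl W (fun u2 r' =>
    spl r' (fun w v1 => G u1 u2 w v1 v2)))).
    apply: eq_spl => W v2 _; rewrite -!spl_scale; apply: eq_spl => u2 r' ww.
    rewrite -!spl_scale; apply: eq_spl => w v1 ww'.
    by rewrite /G -ww -ww'; lincomb k (k^o).
  rewrite spl_assoc; apply: eq_spl => u2 r' _.
  by rewrite spl_assoc.
rewrite E3 E4.
pose c u w v : int :=
  sdeg v * (sdeg (a :: u) + sdeg w) + (q + 1) * (hdeg a - 1 + sdeg v).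
pose Su := spl s (fun u r => spl r (fun w v => (-1) ^ (c u w v + sdeg v) *:
  (* The names record whether [mu] is inserted into [u], [w] or [v]. Only [Su] and [Sv] occur on the
     left-hand side; [Sw] is matched by the correction term. *)
  insop 2 mu (insop q g (fun t => X (v ++ a :: t) w)) u)).
pose Sw := spl s (fun u r => spl r (fun w v => (-1) ^ (c u w v + sdeg v + sdeg u) *:
  insop 2 mu (fun w' => insop q g (fun t => X (v ++ a :: t) w') u) w)).
pose Sv := spl s (fun u r => spl r (fun w v => (-1) ^ c u w v *:
  insop 2 mu (fun v' => insop q g (fun t => X (v' ++ a :: t) w) u) v)).
have -> : insop 2 mu (tgen q g X a) s =
    Su + Sw + (-1) ^ (hdeg a + q) *: Sv.
  rewrite /tgen insop_spl3 -[_ *: Sv]spl_scale.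
  congr (_ + _ + _); apply: eq_spl => u r _; rewrite -?spl_scale;
    apply: eq_spl => w v _.
  - transitivity (insop 2 mu (fun u' => (-1) ^ (sdeg v * (hdeg a - 1 + sdeg w)
        + (q + 1) * (hdeg a - 1 + sdeg v) + sdeg v * sdeg u') *:
        insop q g (fun t => X (v ++ a :: t) w) u') u).
      by apply: eq_insop => u'; sg_collect.
    by rewrite insop_sgn /c; sg_collect.
  - transitivity ((-1) ^ ((2 + 1) * sdeg u) *: insop 2 mu (fun w' =>
      (-1) ^ (sdeg v * sdeg (a :: u) + (q + 1) * (hdeg a - 1 + sdeg v)
        + sdeg v * sdeg w') *: insop q g (fun t => X (v ++ a :: t) w') u) w).
      by congr (_ *: _); apply: eq_insop => u'; sg_collect.
    by rewrite insop_sgn /c; sg_collect.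
  transitivity ((-1) ^ ((2 + 1) * (sdeg u + sdeg w)) *: insop 2 mu (fun v' =>
    (-1) ^ ((q + 1) * (hdeg a - 1) + (sdeg (a :: u) + sdeg w + (q + 1)) * sdeg v')
      *: insop q g (fun t => X (v' ++ a :: t) w) u) v).
    by congr (_ *: _); apply: eq_insop => u'; sg_collect.
  by rewrite insop_sgn /c; sg_collect.
have -> : tgen q g (fun t w => (-1) ^ (sdeg t + 1) *: insop 2 mu (X t) w) a s =
    (-1) ^ (hdeg a - 1 + q) *: Sw.
  rewrite /tgen -[RHS]spl_scale; apply: eq_spl => u r _; rewrite -[RHS]spl_scale.
  apply: eq_spl => w v _.
  transitivity ((-1) ^ c u w v *: insop q g (fun t =>
    (-1) ^ (sdeg v + (hdeg a - 1) + 1 + 1 * sdeg t) *: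
      insop 2 mu (X (v ++ a :: t)) w) u).
    by congr (_ *: _); apply: eq_insop => t; sg_collect.
  by rewrite insop_sgn insop_exchange /c; sg_collect.
rewrite [X in _ + X - _ + _](_ : _ = (-1) ^ (hdeg a + q) *: Su); last first.
  rewrite -[RHS]spl_scale; apply: eq_spl => u r _; rewrite -[RHS]spl_scale.
  by apply: eq_spl => w v _; rewrite /c; sg_collect.
rewrite [X in X + _ - _ + _](_ : _ = Sv) //.
set C := contr_form _ _ _ _ _; set R := rotE _ _ _ _ _; lincomb k (k^o).
Qed.

End LieContraction.

Section LieContractionFormula.
Variables (k : fieldType) (A : augDGA k) (p q : int) (f g : seq (helt A) -> A).
Variable phi : helt A -> seq (helt A) -> k^o.
Hypotheses (hf : cocycle (reg A) p f) (hg : cocycle (reg A) q g).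
Hypothesis mphi : formlike phi.
Implicit Types (s u v w t : seq (helt A)) (a b c : helt A).

(* The four ways in which the Hochschild differential multiplies [f t] by a
   neighbouring letter: its last or first argument, or the first or last letter
   of the remaining word. *)
Let mul_last t w : k^o :=
  if t is c :: t' then (-1) ^ (p + sdeg (belast c t')) *:
    phi (hmul (ins p f (belast c t')) (last c t')) w
  else 0.

Let mul_first t w : k^o :=
  if t is c :: t' then (-1) ^ (p * (hdeg c + 1)) *: phi (hmul c (ins p f t')) w
  else 0.

Let mul_next t w : k^o :=
  if w is c :: w' then (-1) ^ (p + sdeg t) *: phi (hmul (ins p f t) c) w'
  else 0.

Let mul_prev t w : k^o :=
  if w is c :: w' then
    (-1) ^ ((hdeg (last c w') - 1) * (p + sdeg t - 1 + sdeg (belast c w'))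
            + hdeg (last c w')) *:
      phi (hmul (last c w') (ins p f t)) (belast c w')
  else 0.

Let mul_last_rcons t c w : mul_last (rcons t c) w =
  (-1) ^ (p + sdeg t) *: phi (hmul (ins p f t) c) w.
Proof. by case: t => [|b t] //=; rewrite belast_rcons last_rcons. Qed.

Let mul_prev_rcons t c w : mul_prev t (rcons w c) =
  (-1) ^ ((hdeg c - 1) * (p + sdeg t - 1 + sdeg w) + hdeg c) *:
    phi (hmul c (ins p f t)) w.
Proof. by case: w => [|b w] //=; rewrite belast_rcons last_rcons. Qed.

(** The differential of the coefficient [f t] is eliminated by the cocycle equation of [f], which
    brings in the insertion of [mu] into [t] and the outer products [mul_last] and [mul_first]. The
    blocks of [mu] joining [f t] to a letter of [w] give [mul_next] and [mul_prev]. *)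
Lemma lie_mu_ins t w :
  lie 2 mu phi (ins p f t) w =
    - (-1) ^ p *: insop 2 mu (fun t' => phi (ins p f t') w) t
    + (-1) ^ p *: ((-1) ^ (sdeg t + 1) *: insop 2 mu (phi (ins p f t)) w)
    + (mul_next t w - mul_last t w) + (mul_first t w + mul_prev t w).
Proof.
have [cf df] := hf.
rewrite /lie rotE_mu // (hd_ins _ cf) hdeg_ins.
have -> : phi (ins (p + 1) (bdop (M := reg A) p f) t) w =
    - (-1) ^ p *: insop 2 mu (fun t' => phi (ins p f t') w) t
    - mul_last t w + mul_first t w.
  have E0 : phi (ins (p + 1) (delta (reg A) p f) t) w = 0.
    by rewrite df; apply: form0.
  have E1 : phi (ins (p + 1) (insop 2 mu f) t) w =
      insop 2 mu (fun t' => phi (ins p f t') w) t.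
    by rewrite -(form_ins_insop _ _ _ _ _ _ mphi); congr (phi (ins _ _ _) _); ring.
  have E2 : phi (ins (p + 1) (rop (M := reg A) p f) t) w = mul_last t w.
    case/lastP: t {E0 E1} => [|t c]; first exact: form0.
    rewrite mul_last_rcons /ins rop_rcons (formZ mphi); congr (_ *: phi _ _).
    apply: helt_inj; first by rewrite !sdegE; ring.
    rewrite hvalM !hval_hpr (cochain_reg_hom _ cf).
    have -> : p + 1 + sdeg (rcons t c) = p + sdeg t + hdeg c.
      by rewrite !sdegE; ring.
    by rewrite gprM ?hval_pr //; apply: cochain_reg_hom.
  have E3 : phi (ins (p + 1) (lop (M := reg A) p f) t) w = - mul_first t w.
    case: t {E0 E1 E2} => [|c t]; first by rewrite oppr0; apply: form0.
    rewrite /mul_first /lop /ins -scaleNr (formZ mphi) -scaleNr.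
    congr (_ *: phi _ _).
    apply: helt_inj; first by rewrite !sdegE; ring.
    rewrite hvalM !hval_hpr (cochain_reg_hom _ cf).
    have -> : p + 1 + sdeg (c :: t) = hdeg c + (p + sdeg t).
      by rewrite !sdegE; ring.
    by rewrite gprM ?hval_pr //; apply: cochain_reg_hom.
  have := E0; rewrite {1}/ins (deltaE _ _ (cochain_multilinear cf)).
  rewrite !(formD mphi) (formZ mphi) -/(ins _ _ _).
  rewrite -!/(ins (p + 1) _ t) E1 E2 E3 => E.
  rewrite -[LHS]subr0 -{}E; lincomb k (k^o).
rewrite -/(mul_next t w) -/(mul_prev t w); lincomb k (k^o).
Qed.

(** In [mul_last] the letter multiplied to [f] is an original letter or the output of [g]. The first
    kind equals [mul_next] with the cut moved by one letter and cancels; the second is [f] of the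
    arc times [g], a contraction inside [rotE]. *)
Lemma tgen_mul_next a s :
  tgen q g (fun t w => mul_next t w - mul_last t w) a s =
    - (-1) ^ (p + q * (p + 1)) *: rotE p f (contr_form q g phi) a s.
Proof.
pose c0 u w v : int :=
  sdeg v * (sdeg (a :: u) + sdeg w) + (q + 1) * (hdeg a - 1 + sdeg v).
pose Y := spl1 s (fun u c r => spl r (fun w v =>
  (-1) ^ c0 (rcons u c) w v *:
    insop q g (fun t => (-1) ^ (p + sdeg (v ++ a :: t)) *:
      phi (hmul (ins p f (v ++ a :: t)) c) w) u)).
have nextE : tgen q g mul_next a s = Y.
  rewrite /tgen spl_spl1_r spl_nil [X in X + _](_ : _ = 0) ?add0r; last first.
    by rewrite -[RHS](scaler0 _ ((-1) ^ c0 s [::] [::])); congr (_ *: _);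
      apply: insop0.
  apply: eq_spl1 => u c r _; rewrite spl_cons insop0 scaler0 add0r.
  by apply: eq_spl => w v _; rewrite /c0 /=; sg_collect.
have lastE : tgen q g mul_last a s = Y + (-1) ^ (p + q * (p + 1)) *:
    rotE p f (contr_form q g phi) a s.
  pose Z := spl s (fun u r => spl r (fun w v => (-1) ^ c0 u w v *:
    spl u (fun u1 u2 => (-1) ^ ((q + 1) * sdeg u1) *:
      mul_last (v ++ a :: rcons u1 (ins q g u2)) w))).
  have -> : (-1) ^ (p + q * (p + 1)) *: rotE p f (contr_form q g phi) a s = Z.
    rewrite /Z /rotE -spl_scale.
    transitivity (spl s (fun u r => spl r (fun u2 r' => spl r' (fun w v =>
       (-1) ^ (c0 (u ++ u2) w v + (q + 1) * sdeg u + p + sdeg v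
               + (hdeg a - 1) + sdeg u) *:
         phi (hmul (ins p f (v ++ a :: u)) (ins q g u2)) w)))).
      apply: eq_spl => u r _.
      transitivity (spl r (fun W v => spl W (fun u2 w =>
        (-1) ^ (c0 (u ++ u2) w v + (q + 1) * sdeg u + p + sdeg v
               + (hdeg a - 1) + sdeg u) *:
         phi (hmul (ins p f (v ++ a :: u)) (ins q g u2)) w))).
        rewrite -spl_scale; apply: eq_spl => W v _.
        rewrite /contr_form -!spl_scale; apply: eq_spl => u2 w ww.
        by rewrite /c0 -ww !scalerA -!sgnM; congr (_ *: _); sg_solve.
      exact: spl_assoc.
    rewrite -[LHS]spl_assoc; apply: eq_spl => u r _.
    rewrite spl_exchange; apply: eq_spl => w v _; rewrite -spl_scale.
    apply: eq_spl => u1 u2 uu; rewrite -rcons_cons -rcons_cat mul_last_rcons.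
    by rewrite -uu /c0; sg_collect.
  rewrite /tgen spl_spl1_l /Z [X in _ = _ + X]spl_spl1_l [RHS]addrCA.
  congr (_ + _).
    by apply: eq_spl => w v _; rewrite spl_nil insop_nil /c0; sg_collect.
  rewrite /Y /spl1 -spl_add; apply: eq_spl => u [|c r] _; first by rewrite addr0.
  rewrite -spl_add; apply: eq_spl => w v _; rewrite insop_rcons scalerDr.
  congr (_ *: _ + _); apply: eq_insop => t.
  by rewrite -rcons_cons -rcons_cat mul_last_rcons.
rewrite -[in LHS]/(fun t w => mul_next t w - mul_last t w).
transitivity (tgen q g mul_next a s + tgen q g (fun t w => (- 1) *: mul_last t w) a s).
  by rewrite -tgenD; congr tgen; do 2 apply/funext => ?; rewrite scaleN1r.
by rewrite tgenZ nextE lastE; lincomb k (k^o).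
Qed.

(** The first letter of the arc is [a] itself when [v] is empty, which gives [a] times [f] with [g]
    inserted, hence [circ q f g]. Otherwise it is a letter that [mul_prev] sees as the last letter
    of [w], and the terms cancel. *)
Lemma tgen_mul_first a s :
  tgen q g (fun t w => mul_first t w + mul_prev t w) a s =
    contr_form (p + q - 1) (circ q f g) phi a s.
Proof.
pose c0 u w v : int :=
  sdeg v * (sdeg (a :: u) + sdeg w) + (q + 1) * (hdeg a - 1 + sdeg v).
pose Y := spl s (fun u r => spl1 r (fun w c v =>
  (-1) ^ (c0 u w (c :: v) + p * (hdeg c + 1)) *:
    insop q g (fun t => phi (hmul c (ins p f (v ++ a :: t))) w) u)).
have prevE : tgen q g mul_prev a s = - Y.
  rewrite /tgen -spl_opp; apply: eq_spl => u r _.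
  rewrite spl_spl1_l insop0 scaler0 add0r -spl_opp; apply: eq_spl => w [|c v] _.
    by rewrite oppr0.
  transitivity ((-1) ^ c0 u (rcons w c) v *: insop q g (fun t =>
    (-1) ^ ((hdeg c - 1) * (p + sdeg v + (hdeg a - 1) - 1 + sdeg w) + hdeg c
      + (hdeg c - 1) * sdeg t) *: phi (hmul c (ins p f (v ++ a :: t))) w) u).
    by congr (_ *: _); apply: eq_insop => t; rewrite mul_prev_rcons; sg_collect.
  by rewrite insop_sgn -scaleNr sg_opp /c0; sg_collect.
have firstE : tgen q g mul_first a s =
    contr_form (p + q - 1) (circ q f g) phi a s + Y.
  rewrite /tgen /contr_form -spl_add; apply: eq_spl => u r _.
  rewrite spl_spl1_r; congr (_ + _).
    rewrite [circ q f g](_ : _ = insop q g f); last first.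
      by apply/funext => t; rewrite circE.
    rewrite (form_ins_insop _ _ _ _ _ _ (formlike_hmul a mphi)) /=.
    by rewrite insopZ; sg_collect.
  apply: eq_spl1 => w c v _ /=.
  by rewrite insopZ scalerA -sgnM.
by rewrite tgenD prevE firstE addrK.
Qed.

(** The block of [f] falls inside the arguments of [g], giving [circ p g f], or into the letters
    left over. The sign is taken relative to [hdeg a] because [hdeg b] is the degree of the new
    coefficient. *)
Lemma insop_contr_form a s :
  insop p f (contr_form q g phi a) s =
    (-1) ^ ((p + 1) * (hdeg a + 1)) *: contr_form (p + q - 1) (circ p g f) phi a s
  + (-1) ^ ((p + 1) * q) *: contr_form q g
      (fun b r => (-1) ^ ((p + 1) * (hdeg b - hdeg a)) *: insop p f (phi b) r) a s.
Proof.
rewrite {1}/contr_form insop_spl; congr (_ + _).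
  rewrite -spl_scale; apply: eq_spl => u v _.
  have -> : p + q - 1 = q + p - 1 by ring.
  rewrite [circ p g f](_ : _ = insop p f g); last first.
    by apply/funext => t; rewrite circE.
  rewrite (form_ins_insop _ _ _ _ _ _ (formlike_hmul a mphi)) insopZ.
  by sg_collect.
rewrite -[RHS]spl_scale; apply: eq_spl => u v _; rewrite insopZ.
by sg_collect.
Qed.

(** The two halves of the bracket have different origins: [circ q f g] comes from [tgen_mul_first],
    through the homotopy, and [circ p g f] from [insop_contr_form], through the Lie derivative. The
    [rotE] parts of the two composites come from [tgen_mul_next] and [tgen_mu]. *)
Lemma lie_contr a s :
  (-1) ^ p *: contr_form (p + q - 1) (gerst p q f g) phi a s =
    (-1) ^ (q * (p + 1)) *: lie p f (contr_form q g phi) a s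
  - contr_form q g (lie p f phi) a s
  - (-1) ^ q *: lie 2 mu (lie_lift p f q g phi) a s
  + (-1) ^ p *: lie_lift p f q g (lie 2 mu phi) a s.
Proof.
have [cf df] := hf.
have -> : lie_lift p f q g (lie 2 mu phi) a s =
    - (-1) ^ p *: tgen q g (fun t w => insop 2 mu (fun t' => phi (ins p f t') w) t) a s
    + (-1) ^ p *: tgen q g (fun t w => (-1) ^ (sdeg t + 1) *:
        insop 2 mu (phi (ins p f t)) w) a s
    + tgen q g (fun t w => mul_next t w - mul_last t w) a s
    + tgen q g (fun t w => mul_first t w + mul_prev t w) a s.
  rewrite -!tgenZ -!tgenD /lie_lift; congr tgen.
  by apply/funext => t; apply/funext => w; rewrite lie_mu_ins.
rewrite tgen_mul_next tgen_mul_first.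
rewrite (tgen_mu (X := fun t => phi (ins p f t)) _ _ hg); last first.
  by move=> w; apply/form_ins_multilinear/(cochain_multilinear cf).
rewrite -/(lie_lift p f q g phi).
have -> : contr_form (p + q - 1) (gerst p q f g) phi a s =
    contr_form (p + q - 1) (circ q f g) phi a s
    - (-1) ^ ((p + 1) * (q + 1)) *: contr_form (p + q - 1) (circ p g f) phi a s.
  rewrite /contr_form -spl_scale -spl_opp -spl_add; apply: eq_spl => u v _.
  rewrite [ins _ (gerst _ _ _ _) _](_ : _ = hpr (p + q - 1 + sdeg u)
    (- (-1) ^ ((p + 1) * (q + 1)) *: circ p g f u + circ q f g u)); last first.
    by rewrite /ins /gerst scaleNr [- _ + circ _ _ _ _]addrC.
  rewrite (proj1 (formlike_hmul a mphi)) /= -!/(ins (p + q - 1) _ u).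
  lincomb k (k^o).
have -> : contr_form q g (lie p f phi) a s = contr_form q g (rotE p f phi) a s
    + contr_form q g (fun b r => (-1) ^ ((p + 1) * (hdeg b - 1)) *:
        insop p f (phi b) r) a s.
  rewrite /contr_form -spl_add; apply: eq_spl => u v _.
  by rewrite -scalerDr.
have E : contr_form q g (fun b r => (-1) ^ ((p + 1) * (hdeg b - hdeg a)) *:
      insop p f (phi b) r) a s = (-1) ^ ((p + 1) * (hdeg a - 1)) *:
    contr_form q g (fun b r => (-1) ^ ((p + 1) * (hdeg b - 1)) *:
        insop p f (phi b) r) a s.
  by rewrite -[RHS]spl_scale; apply: eq_spl => u v _; sg_collect.
rewrite {1}/lie insop_contr_form E.
have -> : contr_form q g (fun b r => spl r (fun u r' => spl r' (fun w v =>
    (-1) ^ (sdeg v * (sdeg (b :: u) + sdeg w)) *: phi (ins p f (v ++ b :: u)) w)))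
    a s = contr_form q g (rotE p f phi) a s by [].
lincomb k (k^o).
Qed.

End LieContractionFormula.

(** * Linearity, normalization and degree of the forms *)

Section RotatedSums.
Variables (k : fieldType) (A : augDGA k).
Implicit Types (s u v w t : seq (helt A)) (a b c : helt A).
Implicit Types (f g : seq (helt A) -> A) (phi : helt A -> seq (helt A) -> k^o).
Implicit Types (psi : seq (helt A) -> k^o).

Definition normalized (V : lmodType k) (F : seq (helt A) -> V) : Prop :=
  forall s1 s2, F (s1 ++ hone :: s2) = 0.

Definition is_form (m : int) phi : Prop :=
  [/\ formlike phi, forall a, normalized (phi a)
    & forall a s, hdeg a != - (m + sdeg s) -> phi a s = 0].

Lemma insop_normalized (V : lmodType k) q f (F : seq (helt A) -> V) :
  multilinear F -> normalized F -> normalized f -> normalized (insop q f F).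
Proof.
move=> mF nF nf s1 s2; rewrite insop_cat_cons.
rewrite (eq_insop q f s1 (G := fun=> 0)); last by move=> t; rewrite nF.
rewrite (eq_insop q f s2 (G := fun=> 0)); last by move=> t; rewrite nF.
rewrite !insop0 scaler0 !add0r; apply: spl_eq0 => v1 v2 _; apply: spl_eq0 => u1 u2 _.
by rewrite /ins nf (multilinear0 mF) scaler0.
Qed.

(** The common shape of [cyc] and [tgen]: a cyclic word cut into three arcs around [a], with a sign
    that depends on degrees only. The conditions of [is_form] are proved once for this shape. *)
Definition rotsum (e : int -> int -> int -> int -> int)
    (G : seq (helt A) -> seq (helt A) -> helt A -> seq (helt A) -> k^o) a s : k^o :=
  spl s (fun u r => spl r (fun w v =>
    (-1) ^ e (hdeg a) (sdeg u) (sdeg w) (sdeg v) *: G u w a v)).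

Section RotatedSum.
Variables (e : int -> int -> int -> int -> int) (m : int).
Variable G : seq (helt A) -> seq (helt A) -> helt A -> seq (helt A) -> k^o.
Hypotheses (Gu : forall w a v, multilinear (fun u => G u w a v))
  (Gw : forall u a v, multilinear (fun w => G u w a v))
  (Gv : forall u w a, multilinear (G u w a)).
Hypothesis Ga : forall q (c : k) (x y : A) u w v,
  G u w (hpr q (c *: x + y)) v = c *: G u w (hpr q x) v + G u w (hpr q y) v.
Hypotheses (nu : forall w a v, normalized (fun u => G u w a v))
  (nw : forall u a v, normalized (fun w => G u w a v))
  (nv : forall u w a, normalized (G u w a)).
Hypothesis Gdeg : forall u w a v,
  hdeg a != - (m + (sdeg u + (sdeg w + sdeg v))) -> G u w a v = 0.

Lemma is_form_rotsum : is_form m (rotsum e G).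
Proof.
split=> [|a s1 s2|a s ne_a].
- split=> [q c x y s|a s1 s2 q c x y].
    rewrite /rotsum -spl_scale -spl_add; apply: eq_spl => u r _.
    rewrite -spl_scale -spl_add; apply: eq_spl => w v _.
    by rewrite Ga !hdeg_pr; lincomb k (k^o).
  rewrite /rotsum !spl_cat_cons.
  under eq_spl => u r _ do rewrite spl_cat_cons.
  under [X in _ = _ *: (X + _) + _]eq_spl => u r _ do rewrite spl_cat_cons.
  under [X in _ = _ + (X + _)]eq_spl => u r _ do rewrite spl_cat_cons.
  rewrite scalerDr addrACA -!spl_scale -!spl_add; congr (_ + _); last first.
    apply: eq_spl => u r _; rewrite -!spl_scale -!spl_add; apply: eq_spl => w v _.
    by rewrite (Gu w a v) !sdegE; lincomb k (k^o).
  apply: eq_spl => u r _; rewrite scalerDr addrACA -!spl_scale -!spl_add.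
  congr (_ + _); apply: eq_spl => w v _.
    by rewrite Gv !sdegE; lincomb k (k^o).
  by rewrite (Gw u a v) !sdegE; lincomb k (k^o).
- rewrite /rotsum spl_cat_cons [X in X + _]spl_eq0 ?[X in _ + X]spl_eq0 ?addr0 //.
    by move=> u r _; apply: spl_eq0 => w v _; rewrite (nu w a v) scaler0.
  move=> u r _; rewrite spl_cat_cons !spl_eq0 ?addr0 // => w v _.
    by rewrite (nw u a v) scaler0.
  by rewrite nv scaler0.
apply: spl_eq0 => u r ur; apply: spl_eq0 => w v wv.
by rewrite Gdeg ?scaler0 // -!sdeg_cat wv ur.
Qed.

End RotatedSum.

Lemma multilinear_null_cons (V : lmodType k) (x : V) :
  multilinear (fun w : seq (helt A) => if w is [::] then x else 0).
Proof. by case=> [|b s1] s2 q c y z /=; rewrite scaler0 addr0. Qed.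

Lemma is_form_cyc m psi : multilinear psi -> normalized psi ->
  (forall s, 0 != m + sdeg s -> psi s = 0) -> is_form (m - 1) (cyc psi).
Proof.
move=> mpsi npsi dpsi.
(* A rotation has only two arcs; it is a sum over three arcs whose middle one is forced to be
   empty. *)
pose G u w a v : k^o := if w is [::] then psi (v ++ a :: u) else 0.
have -> : cyc psi = rotsum (fun da du dw dv => (da - 1 + du) * dv) G.
  apply/funext => a; apply/funext => s; apply: eq_spl => u r _.
  rewrite spl_only_nil => [|[|b w] v //]; last by rewrite scaler0.
  by rewrite sdeg_cons.
apply: is_form_rotsum.
- move=> [|b w] a v s1 s2 q c x y; last by rewrite scaler0 addr0.
  by rewrite /G -!cat_cons !catA mpsi.
- by move=> u a v; apply: multilinear_null_cons.
- move=> u [|b w] a s1 s2 q c x y; last by rewrite /G scaler0 addr0.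
  by rewrite /G -!catA !cat_cons mpsi.
- move=> q c x y u [|b w] v; last by rewrite /G scaler0 addr0.
  by rewrite /G mpsi.
- by move=> [|b w] a v s1 s2; rewrite /G // -!cat_cons !catA npsi.
- by move=> u a v [|b s1] s2.
- by move=> u [|b w] a s1 s2; rewrite /G // -!catA !cat_cons npsi.
move=> u [|b w] a v ne_a //; apply: dpsi; apply: contra ne_a => /eqP E.
by apply/eqP; move: E; rewrite !sdegE; lia.
Qed.

Lemma is_form_bform m phi : is_form m phi -> is_form (m - 1) (bform phi).
Proof.
move=> [[_ mphi] nphi dphi]; apply: is_form_cyc => // s ne_s.
apply: dphi; apply: contra ne_s; rewrite hdeg_one => /eqP E.
by apply/eqP; lia.
Qed.

Section Tail.
Variables (q m : int) (g : seq (helt A) -> A).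
Variable X : seq (helt A) -> seq (helt A) -> k^o.
Hypotheses (mg : multilinear g) (ng : normalized g).
Hypotheses (mX1 : forall w, multilinear (X^~ w)) (mX2 : forall t, multilinear (X t)).
Hypotheses (nX1 : forall w, normalized (X^~ w)) (nX2 : forall t, normalized (X t)).
Hypothesis dX : forall t w, 0 != m + sdeg t + sdeg w -> X t w = 0.

Lemma is_form_tgen : is_form (m + q - 2) (tgen q g X).
Proof.
pose G u w a v : k^o := insop q g (fun t => X (v ++ a :: t) w) u.
have -> : tgen q g X =
    rotsum (fun da du dw dv => dv * (da - 1 + du + dw) + (q + 1) * (da - 1 + dv)) G.
  apply/funext => a; apply/funext => s; apply: eq_spl => u r _.
  by apply: eq_spl => w v _; rewrite sdeg_cons.
apply: is_form_rotsum.
- move=> w a v; apply: multilinear_insop => //.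
  by move=> s1 s2 e c x y; rewrite -!cat_cons !catA (mX1 w).
- move=> u a v s1 s2 e c x y; rewrite /G -insopZ -insopD; apply: eq_insop => t.
  by rewrite mX2.
- move=> u w a s1 s2 e c x y; rewrite /G -insopZ -insopD; apply: eq_insop => t.
  by rewrite -!catA !cat_cons (mX1 w).
- move=> e c x y u w v; rewrite /G -insopZ -insopD; apply: eq_insop => t.
  by rewrite (mX1 w).
- move=> w a v; apply: insop_normalized => //.
    by move=> s1 s2 e c x y; rewrite -!cat_cons !catA (mX1 w).
  by move=> s1 s2; rewrite -!cat_cons !catA (nX1 w).
- move=> u a v s1 s2; rewrite /G (eq_insop q g u (G := fun=> 0)) ?insop0 // => t.
  by rewrite nX2.
- move=> u w a s1 s2; rewrite /G (eq_insop q g u (G := fun=> 0)) ?insop0 // => t.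
  by rewrite -!catA !cat_cons (nX1 w).
move=> u w a v ne_a; apply: spl_eq0 => u1 r ur; apply: spl_eq0 => u2 u3 ur'.
rewrite dX ?scaler0 //; apply: contra ne_a; rewrite -ur -ur' !sdegE => /eqP E.
by apply/eqP; move: E; lia.
Qed.

End Tail.

Lemma is_form_lie_lift p q m f g phi : cochain (reg A) p f ->
  cochain (reg A) q g -> is_form m phi ->
  is_form (p + q + m - 2) (lie_lift p f q g phi).
Proof.
move=> [_ mf nf] [_ mg ng] [mphi nphi dphi].
have -> : p + q + m - 2 = p + m + q - 2 by ring.
apply: is_form_tgen => //.
- by move=> w; apply: form_ins_multilinear.
- by move=> t; apply: (proj2 mphi).
- by move=> w s1 s2; rewrite /ins nf form0.
move=> t w ne; apply: dphi; apply: contra ne => /eqP E; apply/eqP.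
by move: E; rewrite hdeg_ins; lia.
Qed.

Lemma is_form_contr_lift p m f phi : cochain (reg A) p f -> is_form m phi ->
  is_form (p + m - 2) (contr_lift p f phi).
Proof.
move=> [_ mf nf] [mphi nphi dphi].
have -> : contr_lift p f phi =
    tgen p f (fun t w => if w is [::] then phi hone t else 0).
  apply/funext => a; apply/funext => s; apply: eq_spl => u r _.
  rewrite spl_only_nil => [|[|b w] v _ //]; last by rewrite insop0 scaler0.
  by rewrite sdeg_nil addr0.
have -> : p + m - 2 = m + p - 2 by ring.
apply: is_form_tgen => //.
- move=> [|b w]; first exact: (proj2 mphi).
  by move=> s1 s2 e c x y; rewrite scaler0 addr0.
- by move=> t; apply: multilinear_null_cons.
- by move=> [|b w] s1 s2 //; rewrite nphi.
- by move=> t [|b s1] s2.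
move=> t [|b w] ne //; apply: dphi; apply: contra ne; rewrite hdeg_one => /eqP E.
by apply/eqP; move: E; rewrite sdeg_nil; lia.
Qed.

End RotatedSums.

Lemma match_rcons (T R : Type) (G : T -> seq T -> R) (r : R) t c :
  (if rcons t c is b :: w then G (last b w) (belast b w) else r) = G c t.
Proof. by case: t => [|b t] //=; rewrite last_rcons belast_rcons. Qed.

(** * Cochains with values in the dual bimodule as forms *)

Section DualCochains.
Variables (k : fieldType) (A : augDGA k).
Implicit Types (s u v w t : seq (helt A)) (a b c : helt A).
Implicit Types (f g : seq (helt A) -> dual A) (x y : seq (helt A) -> A).
Implicit Types (phi : helt A -> seq (helt A) -> k^o).

Lemma delta_hom (M : dgbimod A) p (f : seq (helt A) -> M) s : cochain M p f ->
  bhom (p + 1 + sdeg s) (delta M p f s).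
Proof.
move=> hf; rewrite deltaE; last exact: cochain_multilinear hf.
have -> : p + 1 + sdeg s = p + sdeg s + 1 by ring.
apply: bhomD; last exact: lop_hom.
apply: bhomD; last exact: rop_hom.
apply: bhomD; first exact: bdop_hom.
exact/bhomZ/insop_mu_hom.
Qed.

Lemma dual_spl s (G : seq (helt A) -> seq (helt A) -> dual A) (z : A) :
  (spl s G : A -> k^o) z = spl s (fun u v => (G u v : A -> k^o) z).
Proof.
exact: (@spl_additive _ (dual A) (k^o) (fun l : dual A => (l : A -> k^o) z)).
Qed.

Section Homogeneous.
Variables (m : int) (f : seq (helt A) -> dual A).
Hypothesis hom_f : forall s, bhom (m + sdeg s) (f s).

Lemma dual_lin s (e : k) (z z' : A) : f s (e *: z + z') = e * f s z + f s z'.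
Proof. by case: (hom_f s) => L _; rewrite L. Qed.

Lemma dual_deg s (z : A) : f s z = f s (gpr A (- (m + sdeg s)) z).
Proof. by case: (hom_f s). Qed.

Lemma dual_0 s : f s 0 = 0.
Proof. by rewrite -(scale0r 0) (dual_homZ _ _ (hom_f s)) mul0r. Qed.

Lemma dual_off s a : hdeg a != - (m + sdeg s) -> f s (hval a) = 0.
Proof.
move=> ne; rewrite dual_deg -hval_pr gprK eq_sym (negbTE ne).
exact: dual_0.
Qed.

Lemma to_form_off a s : hdeg a != - (m + sdeg s) -> to_form f a s = 0.
Proof. by move=> ne; rewrite /to_form dual_off // mulr0. Qed.

Lemma of_form_to_form : of_form m (to_form f) = f.
Proof.
apply/funext => s; apply/funext => b.
by rewrite /of_form /to_form hdeg_pr mulrA sgn2 mul1r hval_hpr -dual_deg.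
Qed.

End Homogeneous.

Lemma to_form_is_form m f : cochain (dual A) m f -> is_form m (to_form f).
Proof.
move=> hf; have [hom_f mf nf] := hf; split; first split.
- move=> q c x y s; rewrite /to_form !hval_hpr !hdeg_pr linearP (dual_lin hom_f).
  by rewrite mulrDr mulrCA.
- move=> a s1 s2 q c x y; rewrite /to_form mf !sdegE /=.
  by rewrite mulrDr mulrCA.
- by move=> a s1 s2; rewrite /to_form nf mulr0.
- by move=> a s; apply: to_form_off.
Qed.

Lemma of_form_cochain m phi : formlike phi -> (forall a, normalized (phi a)) ->
  cochain (dual A) m (of_form m phi).
Proof.
move=> [aphi mphi] nphi; split=> [s|s1 s2 q c x y|s1 s2].
- split=> [c z z'|z]; rewrite /of_form /=.
    by rewrite aphi mulrDr mulrCA.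
  congr (_ * phi _ _); apply: helt_inj => //=.
  by rewrite gprK eqxx.
- apply/funext => z; rewrite /of_form !sdegE mphi.
  by rewrite mulrDr mulrCA.
by apply/funext => z; rewrite /of_form nphi mulr0.
Qed.

Lemma to_form_of_form m phi : (forall q s, phi (hpr q 0) s = 0) ->
  (forall a s, hdeg a != - (m + sdeg s) -> phi a s = 0) ->
  to_form (of_form m phi) = phi.
Proof.
move=> phi0 dphi; apply/funext => a; apply/funext => s.
rewrite /to_form /of_form /=.
have [E|ne] := eqVneq (hdeg a) (- (m + sdeg s)).
  by rewrite -E hprK mulrA sgn2 mul1r.
rewrite [RHS]dphi // [hpr _ _](_ : _ = hpr (- (m + sdeg s)) 0) ?phi0 ?mulr0 //.
by apply: helt_inj => //; rewrite !hval_hpr linear0 -hval_pr gprK eq_sym (negbTE ne).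
Qed.

Lemma to_form_inj m f g : (forall s, bhom (m + sdeg s) (f s)) ->
  (forall s, bhom (m + sdeg s) (g s)) -> to_form f = to_form g -> f = g.
Proof.
by move=> hf hg E; rewrite -(of_form_to_form hf) -(of_form_to_form hg) E.
Qed.

Lemma to_formD f g a s : to_form (f + g) a s = to_form f a s + to_form g a s.
Proof. exact: mulrDr. Qed.

Lemma to_formZ (e : k) f a s : to_form (e *: f) a s = e * to_form f a s.
Proof. exact: mulrCA. Qed.

Lemma lie_off m p x phi a s : is_form m phi ->
  hdeg a != - (m + p - 1 + sdeg s) -> lie p x phi a s = 0.
Proof.
move=> [_ _ dphi] ne; rewrite /lie /rotE /insop.
rewrite !spl_eq0 ?scaler0 ?addr0 // => u r ur; apply: spl_eq0 => v w vw;
  rewrite dphi ?scaler0 //; apply: contra ne; rewrite -ur -vw !sdegE => /eqP E;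
  apply/eqP; move: E; lia.
Qed.

(** The right and left actions on [dual A] multiply the argument on the left and on the right. So
    the outer terms of [delta] become products of the coefficient with the last and the first
    letter, which are the cyclic blocks in [rotE_mu]. *)
Lemma to_form_delta m f a s : cochain (dual A) m f ->
  to_form (delta (dual A) m f) a s = - (-1) ^ m * lie 2 mu (to_form f) a s.
Proof.
move=> hf; have hom_f := delta_hom _ hf.
(* Off this degree both sides vanish; in it, the value of [hdeg a] is what makes the signs on the
   two sides comparable. *)
have [E|ne] := eqVneq (hdeg a) (- (m + 1 + sdeg s)); last first.
  rewrite (to_form_off hom_f) // (lie_off _ (to_form_is_form hf)) ?mulr0 //.
  by apply: contra ne => /eqP ->; apply/eqP; ring.
rewrite {1}/to_form deltaE; last exact: cochain_multilinear hf.
have tf := to_form_is_form hf; have [mtf _ _] := tf.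
rewrite /lie rotE_mu //.
have -> : insop (V := k^o) 2 mu (to_form f a) s =
    (-1) ^ (hdeg a * (sdeg s + 1)) * (insop 2 mu f s (hval a)).
  transitivity (insop (V := k^o) 2 mu (fun t => (-1) ^ (0 + hdeg a * sdeg t) *:
      (f t (hval a) : k^o)) s).
    by apply: eq_insop => t; rewrite add0r.
  rewrite insop_sgn; rewrite [X in _ = _ * X]dual_spl.
  rewrite [in RHS](eq_spl (H := fun u r => spl r (fun v w =>
    (-1) ^ ((2 + 1) * sdeg u) *: (f (u ++ ins 2 mu v :: w) (hval a) : k^o)))); last first.
    by move=> u r _; rewrite dual_spl.
  rewrite -/(insop (V := k^o) 2 mu (fun t => f t (hval a)) s).
  by congr (_ * _); sg_solve.
have Erop : (-1) ^ (hdeg a * sdeg s) * (rop m f s : A -> k^o) (hval a) =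
    - (-1) ^ m * (if s is c :: w then
       (-1) ^ ((hdeg (last c w) - 1) * (hdeg a - 1 + sdeg (belast c w))
               + hdeg (last c w)) *:
         (to_form f (hmul (last c w) a) (belast c w) : k^o)
     else 0).
  case/lastP: (s) E => [|t c] E; first by rewrite mulr0 mulr0.
  rewrite rop_rcons (match_rcons (fun l w => (-1) ^ ((hdeg l - 1) *
    (hdeg a - 1 + sdeg w) + hdeg l) *: (to_form f (hmul l a) w : k^o))).
  transitivity ((-1) ^ (hdeg a * sdeg (rcons t c)) *
    ((-1) ^ (m + sdeg t) * f t (hval c * hval a))); first by [].
  rewrite /to_form hvalM hdeg_mul E !sdegE.
  rewrite -[_ *: _]/(_ * _) !mulrA; congr (_ * _); sg_ring.
have Elop : (-1) ^ (hdeg a * sdeg s) * (lop m f s : A -> k^o) (hval a) =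
    - (-1) ^ m * (if s is c :: w then
      (-1) ^ (hdeg a) *: (to_form f (hmul a c) w : k^o) else 0).
  case: (s) E => [|c t] E; first by rewrite mulr0 mulr0.
  transitivity ((-1) ^ (hdeg a * sdeg (c :: t)) *
    - ((-1) ^ (m * (hdeg c + 1)) * ((-1) ^ (hdeg c) * f t (hval a * hval c)))).
    by [].
  rewrite /to_form hvalM hdeg_mul E !sdegE -[_ *: _]/(_ * _) -mulNr !mulrA.
  by congr (_ * _); sg_ring.
have Ebd : (-1) ^ (hdeg a * sdeg s) * (bdop m f s : A -> k^o) (hval a) =
    - (-1) ^ m * to_form f (hd a) s.
  transitivity ((-1) ^ (hdeg a * sdeg s) *
    - ((-1) ^ (m + sdeg s) * f s (dga_d A (hval a)))); first by [].
  rewrite /to_form hvald hdeg_d E -mulNr !mulrA.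
  by congr (_ * _); sg_ring.
transitivity ((-1) ^ (hdeg a * sdeg s) * (bdop m f s : A -> k^o) (hval a)
  + (-1) ^ (hdeg a * sdeg s) * ((-1) ^ m * (insop 2 mu f s : A -> k^o) (hval a))
  + (-1) ^ (hdeg a * sdeg s) * (rop m f s : A -> k^o) (hval a)
  + (-1) ^ (hdeg a * sdeg s) * (lop m f s : A -> k^o) (hval a)).
  by rewrite -!mulrDr.
rewrite Ebd Erop Elop E.
set I := (insop 2 mu f s : A -> k^o) (hval a); set x := to_form f (hd a) s.
set y : k := (if s is c :: w then _ else 0).
set z : k := (if s is c :: w then _ else 0).
rewrite -![_ *: _]/(_ * _).
sg_ring.
Qed.

End DualCochains.

Section CartanFormula.
Variables (k : fieldType) (A : augDGA k).
Implicit Types (s u v w t : seq (helt A)) (a b c : helt A).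
Implicit Types (f g : seq (helt A) -> dual A) (x y : seq (helt A) -> A).
Implicit Types (phi : helt A -> seq (helt A) -> k^o).

Lemma contr_formP p x phi phi' (e : k) a s :
  contr_form p x (fun b t => e *: phi b t + phi' b t) a s =
  e *: contr_form p x phi a s + contr_form p x phi' a s.
Proof.
rewrite /contr_form -spl_scale -spl_add; apply: eq_spl => u v _.
lincomb k (k^o).
Qed.

Lemma contr_formZ p x phi (e : k) a s :
  contr_form p x (fun b t => e *: phi b t) a s = e *: contr_form p x phi a s.
Proof.
rewrite /contr_form -spl_scale; apply: eq_spl => u v _; lincomb k (k^o).
Qed.

Lemma bformZ phi (e : k) a s :
  bform (fun b t => e *: phi b t) a s = e *: bform phi a s.
Proof.
rewrite /bform /cyc -spl_scale; apply: eq_spl => u v _; lincomb k (k^o).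
Qed.

Lemma lieZ p x phi (e : k) a s :
  lie p x (fun b t => e *: phi b t) a s = e *: lie p x phi a s.
Proof.
rewrite /lie insopZ; have -> : rotE p x (fun b t => e *: phi b t) a s =
    e *: rotE p x phi a s.
  rewrite /rotE -spl_scale; apply: eq_spl => u r _; rewrite -spl_scale.
  by apply: eq_spl => w v _; lincomb k (k^o).
lincomb k (k^o).
Qed.

Lemma is_form0 m phi q s : is_form m phi -> phi (hpr q 0) s = 0.
Proof. by case=> mphi _ _; apply: form0. Qed.

Lemma is_formZ m phi (e : k) : is_form m phi -> is_form m (fun a s => e *: phi a s).
Proof.
move=> [[aphi mphi] nphi dphi]; split; first split.
- by move=> q c x y s; rewrite aphi; lincomb k (k^o).
- by move=> a s1 s2 q c x y; rewrite mphi; lincomb k (k^o).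
- by move=> a s1 s2; rewrite nphi scaler0.
by move=> a s ne; rewrite dphi ?scaler0.
Qed.

Lemma to_form_of_is_form m phi : is_form m phi -> to_form (of_form m phi) = phi.
Proof.
move=> hphi; apply: to_form_of_form; first by move=> q s; apply: is_form0 hphi.
by case: hphi.
Qed.

Lemma of_is_form_cochain m phi : is_form m phi -> cochain (dual A) m (of_form m phi).
Proof. by case=> mphi nphi _; apply: of_form_cochain. Qed.

Lemma connes_dualE m f : connes_dual m f =
  of_form (m - 1) (fun a s => (-1) ^ m *: bform (to_form f) a s).
Proof.
rewrite /connes_dual; congr of_form; apply/funext => a; apply/funext => s.
congr (_ * _); rewrite /eval_chain /connes big_map (iotaDl 1 0) big_map.
by rewrite /bform /cyc /spl big_map.
Qed.

Section Connes.
Variables (m : int) (f : seq (helt A) -> dual A).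
Hypothesis hf : cochain (dual A) m f.

Lemma is_form_connes : is_form (m - 1) (fun a s => (-1) ^ m *: bform (to_form f) a s).
Proof. exact/is_formZ/is_form_bform/to_form_is_form. Qed.

Lemma connes_cochain : cochain (dual A) (m - 1) (connes_dual m f).
Proof. rewrite connes_dualE; exact/of_is_form_cochain/is_form_connes. Qed.

Lemma to_form_connes :
  to_form (connes_dual m f) = (fun a s => (-1) ^ m *: bform (to_form f) a s).
Proof. rewrite connes_dualE; exact/to_form_of_is_form/is_form_connes. Qed.

Lemma connes_connes : connes_dual (m - 1) (connes_dual m f) = 0.
Proof.
rewrite connes_dualE to_form_connes; apply/funext => s; apply/funext => b.
rewrite /of_form bformZ bform_bform ?scaler0 ?mulr0 // => s1 s2.
by have [_ nphi _] := to_form_is_form hf; apply: nphi.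
Qed.

Lemma delta_connes : cochain (dual A) (m + 1) (delta (dual A) m f) ->
  delta (dual A) (m - 1) (connes_dual m f) = - connes_dual (m + 1) (delta (dual A) m f).
Proof.
move=> hdf; have hB := connes_cochain.
have [mphi _ _] := to_form_is_form hf.
have hBd : cochain (dual A) m (connes_dual (m + 1) (delta (dual A) m f)).
  rewrite connes_dualE addrK.
  apply/of_is_form_cochain/is_formZ.
  by rewrite -[m in is_form m](addrK 1); apply/is_form_bform/to_form_is_form.
apply: (@to_form_inj _ _ m).
- by move=> s; have := delta_hom s hB; rewrite addrNK.
- by move=> s; apply: bhomN; apply: (cochain_hom hBd).
apply/funext => a; apply/funext => s; rewrite to_form_delta // to_form_connes.
rewrite -[- connes_dual _ _]scaleN1r to_formZ connes_dualE addrK to_form_of_is_form; last first.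
  by apply: is_formZ; rewrite -[m in is_form m](addrK 1);
    apply/is_form_bform/to_form_is_form.
rewrite lieZ; have -> : to_form (delta (dual A) m f) =
    (fun a s => - (-1) ^ m *: lie 2 mu (to_form f) a s).
  by apply/funext => b; apply/funext => t; rewrite to_form_delta.
rewrite bformZ bform_lie_mu // -[_ * _]/(_ *: (_ : k^o)) -[-1 * _]/(_ *: (_ : k^o)).
lincomb k (k^o).
Qed.

End Connes.

Section Cap.
Variables (p m : int) (x : seq (helt A) -> A) (f : seq (helt A) -> dual A).
Hypotheses (hx : cochain (reg A) p x) (hf : forall s, bhom (m + sdeg s) (f s)).

Lemma capE : cap p m x f =
  of_form (p + m) (fun a s => (-1) ^ (p * m) *: contr_form p x (to_form f) a s).
Proof.
rewrite /cap; congr of_form; apply/funext => a; apply/funext => s.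
congr (_ * _); rewrite /eval_chain /contr big_map.
rewrite /contr_form /spl big_map; apply: eq_bigr => n _ /=.
congr (_ * to_form f _ _); apply: helt_inj => //.
by rewrite hvalM (hval_ins _ hx) hval_hpr gprM ?hval_pr ?(cochain_reg_hom _ hx).
Qed.

Lemma lcup_dual_hom s : bhom (p + m + sdeg s) (lcup p m x f s).
Proof.
apply: bhom_spl => u v uv; apply: bhomZ.
have -> : p + m + sdeg s = (p + sdeg u) + (m + sdeg v) by rewrite -uv sdegE; ring.
exact: (lact_hom (ins p x u)).
Qed.

Lemma to_form_lcup a s : to_form (lcup p m x f) a s =
  (-1) ^ (p * m + p) *: contr_form p x (to_form f) a s.
Proof.
have [E|ne] := eqVneq (hdeg a) (- (p + m + sdeg s)); last first.
  rewrite (to_form_off lcup_dual_hom) // /contr_form spl_eq0 ?scaler0 // => u v uv.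
  rewrite (to_form_off hf) ?scaler0 //; apply: contra ne.
  by rewrite -uv hdeg_mul hdeg_ins sdegE => /eqP E; apply/eqP; lia.
rewrite /to_form [X in _ * X]dual_spl -spl_scale.
rewrite -[_ * _]/(_ *: (_ : k^o)) -[LHS]spl_scale; apply: eq_spl => u v uv.
transitivity ((-1) ^ (hdeg a * sdeg s) *: ((-1) ^ (m * sdeg u) *:
  ((-1) ^ (p + sdeg u) *: (f v (hval a * hval (ins p x u)) : k^o)))); first by [].
transitivity ((-1) ^ (p * m + p) *: ((-1) ^ (p * (hdeg a + 1)) *:
  ((-1) ^ ((hdeg a + (p + sdeg u)) * sdeg v) *:
    (f v (hval (hmul a (ins p x u))) : k^o)))); last by [].
by rewrite hvalM E -uv; lincomb k (k^o).
Qed.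

(** Acting on the left by [x u] replaces the argument [a_0] of a form on [A] by [a_0] times [x u],
    which is the contraction. All bimodule results on [lcup] now apply to [cap]. *)
Lemma cap_lcup : cap p m x f = (-1) ^ p *: lcup p m x f.
Proof.
rewrite capE -[RHS](@of_form_to_form _ _ (p + m)); last first.
  by move=> s; apply/bhomZ/lcup_dual_hom.
congr of_form; apply/funext => a; apply/funext => s.
rewrite to_formZ to_form_lcup.
transitivity ((-1) ^ p *: ((-1) ^ (p * m + p) *:
  contr_form p x (to_form f) a s)); last by [].
lincomb k (k^o).
Qed.

Lemma to_form_cap :
  to_form (cap p m x f) = (fun a s => (-1) ^ (p * m) *: contr_form p x (to_form f) a s).
Proof.
apply/funext => a; apply/funext => s; rewrite cap_lcup to_formZ to_form_lcup.
transitivity ((-1) ^ p *: ((-1) ^ (p * m + p) *: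
  contr_form p x (to_form f) a s)); first by [].
lincomb k (k^o).
Qed.

End Cap.

End CartanFormula.

(** * Cartan's formula on cochains *)

Section Cartan.
Variables (k : fieldType) (A : augDGA k).
Implicit Types (s u v w t : seq (helt A)) (a b c : helt A).

Lemma sg_mul0 (n : int) (z : k) : (-1) ^ n * z = 0 -> z = 0.
Proof. by move=> E; rewrite -[z]mul1r -(sgn2 k n) -mulrA E mulr0. Qed.

Lemma to_form0 a s : to_form (0 : seq (helt A) -> dual A) a s = 0.
Proof. exact: mulr0. Qed.

Lemma to_formN (F : seq (helt A) -> dual A) a s : to_form (- F) a s = - to_form F a s.
Proof. exact: mulrN. Qed.

Section CapCochains.
Variables (p m : int) (x : seq (helt A) -> A) (f : seq (helt A) -> dual A).
Hypotheses (hx : cochain (reg A) p x) (hf : cochain (dual A) m f).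

Lemma cap_cochain : cochain (dual A) (p + m) (cap p m x f).
Proof.
rewrite (cap_lcup hx) => [|s]; last exact: (cochain_hom hf).
exact/cochainZ/lcup_cochain.
Qed.

Lemma deltaZ (M : dgbimod A) n (e : k) (F : seq (helt A) -> M) :
  cochain M n F -> delta M n (e *: F) = e *: delta M n F.
Proof.
move=> hF; have := delta_lin e hF (cochain0 M n).
by rewrite !addr0 delta0 addr0.
Qed.

Lemma deltaD (M : dgbimod A) n (F G : seq (helt A) -> M) :
  cochain M n F -> cochain M n G -> delta M n (F + G) = delta M n F + delta M n G.
Proof. by move=> hF hG; have := delta_lin 1 hF hG; rewrite !scale1r. Qed.

Lemma delta_cap : delta (dual A) (p + m) (cap p m x f) =
  (-1) ^ p *: lcup (p + 1) m (delta (reg A) p x) f + lcup p (m + 1) x (delta (dual A) m f).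
Proof.
rewrite (cap_lcup hx) => [|s]; last exact: (cochain_hom hf).
rewrite deltaZ; last exact: lcup_cochain.
apply/funext => s; rewrite -[LHS]/(_ *: delta (dual A) (p + m) (lcup p m x f) s).
rewrite delta_lcup // -[RHS]/(_ *: lcup (p + 1) m (delta (reg A) p x) f s + _).
lincomb k (dual A).
Qed.

End CapCochains.

Variables (p q m : int) (x y : seq (helt A) -> A) (f : seq (helt A) -> dual A).
Hypotheses (cx : cocycle (reg A) p x) (cy : cocycle (reg A) q y).
Hypothesis cf : cocycle (dual A) m f.

Let hx : cochain (reg A) p x := proj1 cx.
Let hy : cochain (reg A) q y := proj1 cy.
Let hf : cochain (dual A) m f := proj1 cf.

Theorem cartan : exists2 H, cochain (dual A) (p + q - 1 + m - 1) H &
  cap (p + q - 1) m (gerst p q x y) f =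
    (-1) ^ p *: connes_dual (p + (q + m)) (cap p (q + m) x (cap q m y f))
  - cap p (q + m - 1) x (connes_dual (q + m) (cap q m y f))
  - (-1) ^ ((p - 1) * q + p) *:
      cap q (p + m - 1) y (connes_dual (p + m) (cap p m x f))
  + (-1) ^ ((p - 1) * q) *: cap q (p + (m - 1)) y (cap p (m - 1) x (connes_dual m f))
  + delta (dual A) (p + q - 1 + m - 1) H.
Proof.
pose n := p + q - 1 + m - 1.
pose phi : helt A -> seq (helt A) -> k^o := to_form f.
have fphi : is_form m phi by apply: to_form_is_form.
have [mphi _ _] := fphi.
have hYf := cap_cochain hy hf; have hXf := cap_cochain hx hf.
have hBf := connes_cochain hf; have hBYf := connes_cochain hYf.
have hBXf := connes_cochain hXf; have hXBf := cap_cochain hx hBf.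
have hXYf := cap_cochain hx hYf; have hgf := cap_cochain (gerst_cochain hx hy) hf.
have hYXBf := cap_cochain hy hXBf; have hYBXf := cap_cochain hy hBXf.
have hXBYf := cap_cochain hx hBYf; have hBXYf := connes_cochain hXYf.
have hom M r (F : seq (helt A) -> dgb_gr M) : cochain M r F ->
  forall s, bhom (r + sdeg s) (F s) by move=> hF s; apply: (cochain_hom hF).
pose psi := contr_form q y phi.
have fpsi : is_form (q + m) (to_form (cap q m y f)) by apply: to_form_is_form.
have psiE : to_form (cap q m y f) = (fun a s => (-1) ^ (q * m) *: psi a s).
  by rewrite (to_form_cap hy (hom _ _ _ hf)).
have mpsi : is_form (q + m) psi.
  have -> : psi = (fun a s => (-1) ^ (q * m) *: (to_form (cap q m y f) a s : k^o)).
    by apply/funext => a; apply/funext => s; rewrite psiE; lincomb k (k^o).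
  exact: is_formZ.
pose S1 := contr_lift p x psi; pose S2 := contr_lift p x phi.
pose T := lie_lift p x q y phi.
have fS1 : is_form n S1.
  have -> : n = p + (q + m) - 2 by rewrite /n; ring.
  exact: is_form_contr_lift.
have fS2 : is_form (p + m - 2) S2 by apply: is_form_contr_lift.
have fT : is_form n T.
  have -> : n = p + q + m - 2 by rewrite /n; ring.
  exact: is_form_lie_lift.
(* [f] and its cap with [y] are cocycles, so in each homotopy formula the half in which the
   differential acts first vanishes. *)
have bphi a s : lie 2 mu phi a s = 0.
  have := to_form_delta a s hf; rewrite (proj2 cf) to_form0.
  by rewrite mulNr => /esym/eqP; rewrite oppr_eq0 => /eqP/sg_mul0.
have bpsi a s : lie 2 mu psi a s = 0.
  have dYf : delta (dual A) (q + m) (cap q m y f) = 0.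
    rewrite (delta_cap hy hf) (proj2 cy) (proj2 cf); apply/funext => t.
    rewrite -[LHS]/(_ *: lcup _ _ _ _ t + lcup _ _ _ _ t) /lcup !spl_eq0.
    - by rewrite scaler0 addr0.
    - by move=> u v _; rewrite lact0 scaler0.
    by move=> u v _; rewrite /ins (lact_v0 _ (hom _ _ _ hf v)) scaler0.
  have := to_form_delta a s hYf; rewrite dYf to_form0 psiE lieZ.
  by rewrite mulNr => /esym/eqP; rewrite oppr_eq0 => /eqP/sg_mul0/sg_mul0.
have cZ r z (ph : helt A -> seq (helt A) -> k^o) (e : k) :
    contr_form r z (fun b t => e *: ph b t) = (fun b t => e *: contr_form r z ph b t).
  by apply/funext => a; apply/funext => s; rewrite contr_formZ.
have bZ (ph : helt A -> seq (helt A) -> k^o) (e : k) :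
    bform (fun b t => e *: ph b t) = (fun b t => e *: bform ph b t).
  by apply/funext => a; apply/funext => s; rewrite bformZ.
pose Sf := of_form (p + m - 2) S2.
have hSf : cochain (dual A) (p + m - 2) Sf by apply: of_is_form_cochain.
have hS1 : cochain (dual A) n (of_form n S1) by apply: of_is_form_cochain.
have hT : cochain (dual A) n (of_form n T) by apply: of_is_form_cochain.
have hYSf : cochain (dual A) n (cap q (p + m - 2) y Sf).
  have -> : n = q + (p + m - 2) by rewrite /n; ring.
  exact: cap_cochain.
(* One summand per homotopy: [[B, i_x]] on the cap of [y] with [f], the cap of [y] with the homotopy
   for [[B, i_x]] on [f], and [[L_x, i_y]] on [f]. The exponents undo the signs acquired in passing
   from forms to [cap] and [connes_dual]. *)
pose H := (-1) ^ (p * m + p * q + p + q * m) *: of_form n S1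
  + (- (-1) ^ (p * m + p * q + p) *: cap q (p + m - 2) y Sf
     + (-1) ^ ((p + q) * m) *: of_form n T).
have hZ (F : seq (helt A) -> dual A) (e : k) :
  cochain (dual A) n F -> cochain (dual A) n (e *: F) by apply: cochainZ.
have hH : cochain (dual A) n H.
  by apply: cochainD; [exact: hZ | apply: cochainD; exact: hZ].
exists H => //; rewrite -/n.
have e1 : to_form (connes_dual (p + (q + m)) (cap p (q + m) x (cap q m y f))) =
    (fun a s => (-1) ^ (p + q + m + p * (q + m) + q * m) *:
      bform (contr_form p x psi) a s).
  rewrite to_form_connes // (to_form_cap hx (hom _ _ _ hYf)) psiE cZ !bZ.
  do 2!apply/funext => ?; rewrite /GRing.scale /=; sg_ring.
have e2 : to_form (cap p (q + m - 1) x (connes_dual (q + m) (cap q m y f))) =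
    (fun a s => (-1) ^ (p * (q + m - 1) + q + m + q * m) *:
      contr_form p x (bform psi) a s).
  rewrite (to_form_cap hx (hom _ _ _ hBYf)) to_form_connes // psiE bZ !cZ.
  by do 2!apply/funext => ?; rewrite /GRing.scale /=; sg_ring.
have e3 : to_form (cap q (p + m - 1) y (connes_dual (p + m) (cap p m x f))) =
    (fun a s => (-1) ^ (q * (p + m - 1) + p + m + p * m) *:
      contr_form q y (bform (contr_form p x phi)) a s).
  rewrite (to_form_cap hy (hom _ _ _ hBXf)) to_form_connes //.
  rewrite (to_form_cap hx (hom _ _ _ hf)) bZ !cZ.
  by do 2!apply/funext => ?; rewrite /GRing.scale /=; sg_ring.
have e4 : to_form (cap q (p + (m - 1)) y (cap p (m - 1) x (connes_dual m f))) =
    (fun a s => (-1) ^ (q * (p + m - 1) + p * (m - 1) + m) *: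
      contr_form q y (contr_form p x (bform phi)) a s).
  rewrite (to_form_cap hy (hom _ _ _ hXBf)) (to_form_cap hx (hom _ _ _ hBf)).
  rewrite to_form_connes // !cZ.
  by do 2!apply/funext => ?; rewrite /GRing.scale /=; sg_ring.
have e5 a s : to_form (delta (dual A) n (of_form n S1)) a s =
    - (-1) ^ n *: lie 2 mu S1 a s.
  by rewrite to_form_delta // to_form_of_is_form.
have e6 a s : to_form (delta (dual A) n (of_form n T)) a s =
    - (-1) ^ n *: lie 2 mu T a s.
  by rewrite to_form_delta // to_form_of_is_form.
have e7 a s : to_form (delta (dual A) n (cap q (p + m - 2) y Sf)) a s =
    - (-1) ^ (q * (p + m) + p + m) *: contr_form q y (lie 2 mu S2) a s.
  have E : n = q + (p + m - 2) by rewrite /n; ring.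
  rewrite [in LHS]E (delta_cap hy hSf) (proj2 cy) to_formD to_formZ.
  rewrite [X in _ * X](_ : _ = 0); last first.
    rewrite /to_form /lcup spl_eq0; first by rewrite -[0 _]/(0 : k) mulr0.
    by move=> u v _; rewrite /ins (lact_v0 _ (hom _ _ _ hSf v)) scaler0.
  rewrite mulr0 add0r (to_form_lcup _ _ (fun t => delta_hom t hSf)).
  rewrite [to_form _](_ : _ = (fun b t => - (-1) ^ (p + m - 2) *: lie 2 mu S2 b t)).
    by rewrite cZ; lincomb k (k^o).
  do 2!apply/funext => ?; rewrite to_form_delta // to_form_of_is_form //.
have eL a s : to_form (cap (p + q - 1) m (gerst p q x y) f) a s =
    (-1) ^ ((p + q - 1) * m) *: contr_form (p + q - 1) (gerst p q x y) phi a s.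
  by rewrite (to_form_cap (gerst_cochain hx hy) (hom _ _ _ hf)).
apply: (@to_form_inj _ _ (p + q - 1 + m)); first exact: (hom _ _ _ hgf).
  have hn r F : cochain (dual A) r F -> r = p + q - 1 + m ->
      forall s, bhom (p + q - 1 + m + sdeg s) (F s).
    by move=> hF <-; apply: hom hF.
  move=> s; apply: bhomD; last first.
    have -> : p + q - 1 + m + sdeg s = n + 1 + sdeg s by rewrite /n; ring.
    exact: delta_hom.
  apply: bhomD; last by apply/bhomZ/(hn _ _ hYXBf); ring.
  apply: bhomD; last by apply/bhomN/bhomZ/(hn _ _ hYBXf); ring.
  apply: bhomD; last by apply/bhomN/(hn _ _ hXBYf); ring.
  by apply/bhomZ/(hn _ _ hBXYf); ring.
apply/funext => a; apply/funext => s; rewrite eL.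
rewrite /H deltaD ?deltaZ ?deltaD ?deltaZ //; last first.
- by apply: cochainD; apply: (hZ).
- exact: hZ.
- exact: hZ.
- exact: hZ.
have [mpsi' _ _] := mpsi.
have lift0 (ph : helt A -> seq (helt A) -> k^o) b t :
    (forall b t, lie 2 mu ph b t = 0) -> contr_lift p x (lie 2 mu ph) b t = 0.
  move=> ph0; apply: spl_eq0 => u v _; rewrite (eq_insop p x u (G := fun=> 0)).
    by rewrite insop0 scaler0.
  by move=> t'; rewrite ph0.
have P1 := bform_contr_comm a s cx mpsi'.
rewrite (lift0 _ _ _ bpsi) subr0 -/S1 in P1.
have P2 : contr_form q y (lie p x phi) a s =
    (-1) ^ p *: contr_form q y (bform (contr_form p x phi)) a s
    - contr_form q y (contr_form p x (bform phi)) a s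
    - (-1) ^ p *: contr_form q y (lie 2 mu S2) a s.
  have -> : lie p x phi = (fun b t => (-1) ^ p *: bform (contr_form p x phi) b t
      + ((-1) *: contr_form p x (bform phi) b t
         + - (-1) ^ p *: lie 2 mu S2 b t)).
    apply/funext => b; apply/funext => t; have := bform_contr_comm b t cx mphi.
    rewrite (lift0 _ _ _ bphi) subr0 -/S2 => E.
    by rewrite scaleN1r addrA E scaleNr addrK.
  rewrite !contr_formP contr_formZ; lincomb k (k^o).
have T0 : lie_lift p x q y (lie 2 mu phi) a s = 0.
  apply: spl_eq0 => u r _; apply: spl_eq0 => w v _.
  rewrite (eq_insop q y u (G := fun=> 0)); first by rewrite insop0 scaler0.
  by move=> t; rewrite bphi.
have P3 := lie_contr cx cy mphi a s.
rewrite T0 -/T -/psi P2 scaler0 addr0 in P3.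
rewrite !to_formD !to_formN !to_formZ e1 e2 e3 e4 e5 e6 e7.
move: P1 P3.
set G := contr_form _ (gerst _ _ _ _) _ _ _; set L := lie p x _ _ _.
set A1 := bform (contr_form p x psi) a s; set A2 := contr_form p x (bform psi) a s.
set A3 := contr_form q y (bform _) a s; set A4 := contr_form q y (contr_form _ _ _) a s.
set b1 := lie 2 mu S1 a s; set b2 := contr_form q y (lie _ _ _) a s.
set b3 := lie 2 mu T a s => P1 P3.
have {}P1 : L = (-1) ^ p *: A1 - A2 - (-1) ^ p *: b1 by rewrite P1; lincomb k (k^o).
have -> : G = (-1) ^ p *: ((-1) ^ p *: G) by lincomb k (k^o).
rewrite {}P3 {}P1 /n /GRing.scale /=.
sg_ring.
Qed.

End Cartan.

(** * Quasi-isomorphisms *)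

Section LinearSection.
Variables (k : fieldType) (V W : lmodType k) (P : V -> Prop) (d : V -> W).
Hypotheses (P0 : P 0) (PL : forall c x y, P x -> P y -> P (c *: x + y)).
Hypothesis dL : forall c x y, P x -> P y -> d (c *: x + y) = c *: d x + d y.

Let d0 : d 0 = 0.
Proof. by have := dL (-1) P0 P0; rewrite scaler0 addr0 scaleN1r addNr. Qed.

(* Adding the origin makes the empty graph admissible, as Zorn's lemma needs. *)
Let graph (S : set (W * V)) t := S t \/ t = 0.

Let partial_section (S : set (W * V)) : Prop :=
  [/\ forall c t t', graph S t -> graph S t' -> graph S (c *: t + t'),
      forall t, graph S t -> P t.2 /\ d t.2 = t.1
    & forall x, graph S (0, x) -> x = 0].

(** Zorn's lemma for graphs of partial linear sections, in place of a choice of basis: a maximal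
    graph is defined on the whole image of [P], since otherwise it extends by one vector. *)
Lemma linear_section : exists sigma : W -> V,
  [/\ forall x, P x -> P (sigma (d x)), forall x, P x -> d (sigma (d x)) = d x
    & forall c x y, P x -> P y ->
        sigma (c *: d x + d y) = c *: sigma (d x) + sigma (d y)].
Proof.
have [F FP totF|S [[SL SP Sf] maxS]] := @Zorn_bigcup _ partial_section.
  have graphU t : graph (\bigcup_(X in F) X)%classic t ->
      t = 0 \/ exists2 X, F X & graph X t.
    by case=> [[X FX Xt]|->]; [right; exists X => //; left | left].
  have sub X t : F X -> graph X t -> graph (\bigcup_(X in F) X)%classic t.
    by move=> FX [Xt|->]; [left; exists X | right].
  split=> [c t t' /graphU Ht /graphU Ht'|t /graphU[->|[X /FP[_ XP _] /XP]]|x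
      /graphU[[//]|[X /FP[_ _ Xf] /Xf]]] //.
  case: Ht Ht' => [->|[X FX Xt]] [->|[Y FY Yt']].
  - by right; rewrite scaler0 addr0.
  - by rewrite scaler0 add0r; apply: sub Yt'.
  - by have [XL _ _] := FP _ FX; apply: (sub X) => //; apply: XL => //; right.
  have [XY|YX] := totF _ _ FX FY.
    have [YL _ _] := FP _ FY; apply: (sub Y) => //; apply: YL => //.
    by case: Xt => [/XY|->]; [left | right].
  have [XL _ _] := FP _ FX; apply: (sub X) => //; apply: XL => //.
  by case: Yt' => [/YX|->]; [left | right].
have totS x : P x -> exists y, graph S (d x, y).
  move=> Px; apply: contrapT => notin.
  (* The span of the graph and the single new pair [(d x, x)]. *)
  pose B : set (W * V) := fun t => exists c t', graph S t' /\ t = c *: (d x, x) + t'.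
  have BS t : graph S t -> B t.
    by move=> St; exists 0, t; split=> //; rewrite scale0r add0r.
  have B0 : B 0 by apply: BS; right.
  have gB t : graph B t -> B t by case=> // ->.
  apply: (maxS B); first split.
  - by move=> t St; apply: BS; left.
  - move=> BsubS; apply: notin; exists x; left; apply: BsubS.
    by exists 1, 0; split; [right | rewrite scale1r addr0].
  split=> [c t t' /gB[e [u [Su ->]]] /gB[e' [u' [Su' ->]]]|t /gB[e [u [Su ->]]]|y
      /gB[e [u [Su]]]].
  - left; exists (c * e + e'), (c *: u + u'); split; first exact: SL.
    by rewrite scalerDr scalerDl scalerA addrACA.
  - have [Pu du] := SP _ Su; split => /=; first exact: PL.
    by rewrite dL // du.
  case: u Su => [w z] Su [Ew Ez].
  have [e0|ne0] := eqVneq e 0.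
    by apply: Sf; move: Ew Ez Su; rewrite e0 !scale0r !add0r => <- <-.
  (* If a pair over 0 really involves the new vector, then [e *: d x + w = 0] with [(w, z)] in the
     old graph, and rescaling that pair already gives a value at [d x]. *)
  case: notin; exists (- e^-1 *: z).
  have -> : (d x, - e^-1 *: z) = (- e^-1) *: (w, z) + 0.
    rewrite addr0; congr (_, _).
    apply: (scalerI ne0); rewrite scalerA mulrN divff // scaleN1r.
    by apply/eqP; rewrite -addr_eq0 -Ew.
  by apply: SL => //; right.
have /choice[sigma sigmaP] : forall w, exists y,
    (exists2 x, P x & w = d x) -> graph S (w, y).
  move=> w; have [[x Px ->]|nw] := pselect (exists2 x, P x & w = d x).
    by have [y Sy] := totS x Px; exists y.
  by exists 0.
have sP x : P x -> graph S (d x, sigma (d x)).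
  by move=> Px; apply: sigmaP; exists x.
exists sigma; split=> [x /sP/SP[]|x /sP/SP[]|c x y Px Py] //.
have S1 := SL c _ _ (sP _ Px) (sP _ Py).
have S2 : graph S (c *: d x + d y, sigma (c *: d x + d y)).
  by apply: sigmaP; exists (c *: x + y); [exact: PL | rewrite dL].
apply/eqP; rewrite -subr_eq0; apply/eqP/Sf.
have := SL (-1) _ _ S1 S2.
rewrite (_ : -1 *: (c *: (d x, sigma (d x)) + (d y, sigma (d y)))
  + (c *: d x + d y, sigma (c *: d x + d y)) =
  (0, sigma (c *: d x + d y) - (c *: sigma (d x) + sigma (d y)))) //.
rewrite scaleN1r; congr (_, _) => /=; first by rewrite addNr.
by rewrite addrC.
Qed.

End LinearSection.

Section DeltaCochain.
Variables (k : fieldType) (A : augDGA k) (M : dgbimod A) (p : int).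
Variable f : seq (helt A) -> M.
Hypothesis hf : cochain M p f.
Implicit Types (s : seq (helt A)) (a b c : helt A).

(** The unit can be multiplied into its right or its left neighbour, with opposite signs; a missing
    neighbour removes the corresponding term. *)
Lemma insop_mu_one s1 s2 : insop 2 mu f (s1 ++ hone :: s2) =
  (if s2 is [::] then 0 else (-1) ^ (sdeg s1) *: f (s1 ++ s2))
  - (if s1 is [::] then 0 else (-1) ^ (sdeg s1) *: f (s1 ++ s2)).
Proof.
have [hom mf nf] := hf; rewrite insop_cat_cons.
rewrite (eq_insop 2 mu s1 (G := fun=> 0)); last by move=> t; rewrite nf.
rewrite (eq_insop 2 mu s2 (G := fun=> 0)); last by move=> t; rewrite nf.
rewrite !insop0 scaler0 !add0r.
have mu0 (n : int) t v w : (2 < size t)%N -> (-1) ^ n *: f (v ++ ins 2 mu t :: w) = 0.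
  by move=> t2; rewrite /ins mu_gt2 // (multilinear0 mf) scaler0.
rewrite spl_spl1_r; congr (_ + _).
  rewrite spl_spl1_l ins_mu1 hd_one (multilinear0 mf) scaler0 add0r.
  case: s2 => [|c s2]; first by rewrite spl1_nil.
  rewrite spl1_first => [|[|b u] c' v _ //]; last first.
    by rewrite mu0 // /= size_rcons; lia.
  by rewrite [_ ++ _ :: rcons _ _]/= (multilinear_mu2 mf) hmul_1l; lincomb k M.
case/lastP: s1 => [|s1 c]; first by rewrite spl1_nil oppr0.
rewrite spl1_last => [|u c' [|b v] _ //]; last first.
  by apply: spl_eq0 => u1 u2 _; rewrite mu0 // size_cat /=; lia.
rewrite spl_only_nil => [|[|b u] v _ //]; last first.
  by rewrite mu0 // size_cat /=; lia.
rewrite [[:: c] ++ _]/= (multilinear_mu2 mf) hmul_1r -cats1 -catA /=.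
by case: s1 => [|b s1] /=; lincomb k M.
Qed.

(** Normalization is the point: inside the word the two products with the unit cancel, and at an end
    of the word the missing one is replaced by the outer action of the unit. *)
Lemma delta_cochain : cochain M (p + 1) (delta M p f).
Proof.
have [hom mf nf] := hf.
split=> [s||s1 s2]; [exact: delta_hom | exact: multilinear_delta |].
rewrite deltaE // insop_mu_one /bdop nf bd0 add0r.
have -> : rop p f (s1 ++ hone :: s2) =
    if s2 is [::] then (-1) ^ (p + sdeg s1) *: f (s1 ++ s2) else 0.
  case/lastP: s2 => [|s2 c].
    rewrite cats1 rop_rcons cats0 (ract1 (hom s1)) //.
  rewrite -rcons_cons -rcons_cat rop_rcons nf ract0 scaler0.
  by case: (s2).
have -> : lop p f (s1 ++ hone :: s2) =
    - (if s1 is [::] then (-1) ^ p *: f (s1 ++ s2) else 0).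
  case: s1 => [|c s1] /=; last by rewrite nf lact0 scaler0.
  by rewrite (lact1 (hom s2)) add0r mulr1.
by case: s1 s2 => [|c s1] [|c' s2]; lincomb k M.
Qed.

End DeltaCochain.

(** * Cochains with values in an acyclic bimodule *)

Section Contraction.
Variables (k : fieldType) (A : augDGA k) (K : dgbimod A).

Definition acyclic : Prop := forall q (x : K), bhom q x -> bd q x = 0 ->
  exists2 z : K, bhom (q - 1) z & x = bd (q - 1) z.

Definition contraction (sigma : int -> K -> K) : Prop :=
  [/\ forall q x, bhom q x -> bhom (q - 1) (sigma q x),
      forall q c x y, bhom q x -> bhom q y ->
        sigma q (c *: x + y) = c *: sigma q x + sigma q y
    & forall q x, bhom q x -> bd (q - 1) (sigma q x) + sigma (q + 1) (bd q x) = x].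

(** With [tau] a linear section of the differential, [x - tau (d x)] is a cycle, hence a boundary,
    and [tau] lifts it linearly. The result is linear over the field only, not compatible with the
    actions. *)
Lemma acyclic_contraction : acyclic -> exists sigma, contraction sigma.
Proof.
move=> acyc.
have /choice[tau tauP] : forall q, exists t : K -> K,
    [/\ forall x : K, bhom q x -> bhom q (t (bd q x)),
        forall x : K, bhom q x -> bd q (t (bd q x)) = bd q x
      & forall c (x y : K), bhom q x -> bhom q y ->
          t (c *: bd q x + bd q y) = c *: t (bd q x) + t (bd q y)].
  move=> q; apply: (@linear_section k K K (bhom q) (bd q)).
  - exact: bhom0.
  - by move=> c x y; apply: bhomL.
  by move=> c x y; apply: bdL.
have tau0 q : tau q 0 = 0.
  have [_ _ L] := tauP q; have := L (-1) 0 0 (bhom0 K q) (bhom0 K q).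
  by rewrite bd0 scaler0 addr0 scaleN1r addNr.
pose r q (x : K) := x - tau q (bd q x).
have rhom q x : bhom q x -> bhom q (r q x).
  by have [h _ _] := tauP q => hx; apply/bhomD/bhomN/h.
have rex q x : bhom q x -> exists2 z : K, bhom (q - 1) z & r q x = bd (q - 1) z.
  move=> hx; apply: acyc; first exact: rhom.
  have [h1 h2 _] := tauP q; rewrite bdD //; last exact/bhomN/h1.
  by rewrite -[- tau _ _]scaleN1r bdZ ?h2 // ?scaleN1r ?subrr //; apply: h1.
exists (fun q x => tau (q - 1) (r q x)); split=> [q x hx|q c x y hx hy|q x hx].
- by have [z hz ->] := rex q x hx; have [h _ _] := tauP (q - 1); apply: h.
- have -> : r q (c *: x + y) = c *: r q x + r q y.
    have [_ _ L] := tauP q; rewrite /r bdL // L //; lincomb k K.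
  have [z hz ->] := rex q x hx; have [z' hz' ->] := rex q y hy.
  by have [_ _ L] := tauP (q - 1); apply: L.
have [z hz E] := rex q x hx; have [_ h2 _] := tauP (q - 1).
rewrite E h2 // -E addrK /r bdd // tau0 subr0.
by rewrite addrNK.
Qed.

Variable sigma : int -> K -> K.
Hypothesis csigma : contraction sigma.
Implicit Types (s : seq (helt A)) (f h : seq (helt A) -> K).

Let sigma_hom q x : bhom q x -> bhom (q - 1) (sigma q x).
Proof. by case: csigma => h _ _; apply: h. Qed.

Let sigmaL q c x y : bhom q x -> bhom q y ->
  sigma q (c *: x + y) = c *: sigma q x + sigma q y.
Proof. by case: csigma => _ h _; apply: h. Qed.

Let sigma0 q : sigma q 0 = 0.
Proof.
have := sigmaL (-1) (bhom0 K q) (bhom0 K q).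
by rewrite scaler0 addr0 scaleN1r addNr.
Qed.

Let bhom_sum q N (c : nat -> k) (x : nat -> K) :
  (forall i, (i < N)%N -> bhom q (x i)) -> bhom q (\sum_(0 <= i < N) c i *: x i).
Proof.
elim: N => [|N IH] hx; first by rewrite big_geq //; apply: bhom0.
rewrite big_nat_recr //= addrC; apply: bhomL; first exact: hx.
by apply: IH => i lti; apply/hx/ltnW.
Qed.

Let sigma_sum q N (c : nat -> k) (x : nat -> K) :
  (forall i, (i < N)%N -> bhom q (x i)) ->
  sigma q (\sum_(0 <= i < N) c i *: x i) = \sum_(0 <= i < N) c i *: sigma q (x i).
Proof.
elim: N => [|N IH] hx; first by rewrite !big_geq.
have hx' i : (i < N)%N -> bhom q (x i) by move=> lti; apply/hx/ltnW.
rewrite !big_nat_recr //= -(IH hx') addrC (addrC (sigma q _)).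
by apply: sigmaL; [exact: hx | exact: bhom_sum].
Qed.

Definition contract p f s : K := sigma (p + sdeg s) (f s).

Lemma contract_cochain p f : cochain K p f -> cochain K (p - 1) (contract p f).
Proof.
move=> [hom mf nf]; split=> [s|s1 s2 q c a b|s1 s2].
- by rewrite addrAC; apply/sigma_hom/hom.
- rewrite /contract mf !sdegE; apply: sigmaL; first by have := hom (s1 ++ hpr q a :: s2); rewrite !sdegE.
  by have := hom (s1 ++ hpr q b :: s2); rewrite !sdegE.
by rewrite /contract nf sigma0.
Qed.

Definition vanishes_below (n : nat) f : Prop :=
  forall s, (size s < n)%N -> f s = 0.

Lemma delta_vanishes n p f : vanishes_below n f -> vanishes_below n (delta K p f).
Proof.
move=> vf s ltn; rewrite /delta vf // bd0 !big1_seq ?subr0 ?add0r //.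
- by case: s ltn => [|a s] ltn //; rewrite !vf ?ract0 ?lact0 ?scaler0 ?subr0 //
    ?size_belast //; exact: ltnW.
- move=> i; rewrite mem_index_iota => /andP[_ lti]; rewrite vf ?scaler0 //.
  by rewrite size_cat /= size_takel ?size_drop; lia.
move=> i; rewrite mem_index_iota => /andP[_ lti]; rewrite vf ?scaler0 //.
by rewrite size_cat /= size_takel ?size_drop; lia.
Qed.

(** If [f] vanishes in arities below [n], then in arity [n] the products and the outer actions in
    [delta] see only shorter words. The differentials of [K] and of the letters remain, and there
    the identity of the contraction cancels [f]. *)
Lemma contract_step n p f : cocycle K p f -> vanishes_below n f ->
  vanishes_below n.+1 (f - delta K (p - 1) (contract p f)).
Proof.
move=> [hf df] vf s; rewrite ltnS leq_eqVlt => /predU1P[sn|lt_sn]; last first.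
  rewrite -[LHS]/(f s - delta K (p - 1) (contract p f) s) vf // add0r.
  by rewrite (@delta_vanishes n) ?oppr0 // => t lt_t; rewrite /contract vf ?sigma0.
have [hom mf nf] := hf.
have dE r g : vanishes_below n g -> delta K r g s = bd (r + sdeg s) (g s)
    + \sum_(0 <= i < size s) (-1) ^ (r + sdeg (take i s)) *:
        g (take i s ++ hd (nth hone s i) :: drop i.+1 s).
  move=> vg; rewrite /delta [X in _ - X]big1_seq ?subr0; last first.
    move=> i /andP[_]; rewrite mem_index_iota => /andP[_ lti].
    by rewrite vg ?scaler0 // size_cat /= size_takel ?size_drop; lia.
  case: (s) sn => [|a t] /= sn; first by rewrite addr0.
  have -> : g (belast a t) = 0 by rewrite vg // size_belast -sn.
  have -> : g t = 0 by rewrite vg // -sn.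
  by rewrite ract0 lact0 !scaler0 subr0 addr0.
have hd_deg i : (i < size s)%N ->
    p + sdeg (take i s ++ hd (nth hone s i) :: drop i.+1 s) = p + sdeg s + 1.
  move=> lti; rewrite -[in RHS](cat_take_drop i s) (drop_nth hone lti) !sdegE.
  ring.
rewrite -[LHS]/(f s - delta K (p - 1) (contract p f) s) dE; last first.
  by move=> t lt_t; rewrite /contract vf ?sigma0.
have := dE p f vf; rewrite df -[0 s]/(0 : K) => /esym E0.
have [_ _ /(_ _ _ (hom s))] := csigma.
set S := \sum_(0 <= i < size s) _ in E0.
have -> : bd (p + sdeg s) (f s) = - S by apply/eqP; rewrite -addr_eq0 E0.
have -> : sigma (p + sdeg s + 1) (- S) = \sum_(0 <= i < size s)
    (-1) ^ (p - 1 + sdeg (take i s)) *: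
      contract p f (take i s ++ hd (nth hone s i) :: drop i.+1 s).
  have -> : - S = \sum_(0 <= i < size s) (-1) ^ (p - 1 + sdeg (take i s)) *:
      f (take i s ++ hd (nth hone s i) :: drop i.+1 s).
    by rewrite /S -sumrN; apply: eq_bigr => i _; lincomb k K.
  rewrite sigma_sum => [|i lti]; last by rewrite -(hd_deg i lti); apply: hom.
  by apply: eq_big_nat => i /andP[_ lti]; rewrite /contract hd_deg.
set S1 := \sum_(0 <= i < size s) _ => E1.
apply/eqP; rewrite subr_eq0; apply/eqP; rewrite -[LHS]E1.
by rewrite (_ : p - 1 + sdeg s = p + sdeg s - 1) // addrAC.
Qed.

Let step p f : seq (helt A) -> K := f - delta K (p - 1) (contract p f).

Let step_cocycle p f : cocycle K p f -> cocycle K p (step p f).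
Proof.
move=> [hf df]; have hc := contract_cochain hf.
have hdc := delta_cochain hc; rewrite subrK in hdc.
split; first by rewrite /step addrC -scaleN1r; apply: cochainL.
apply/funext => s; rewrite /step addrC -scaleN1r delta_lin // df addr0.
by rewrite -[LHS]/(-1 *: delta K p _ s) -{1}(subrK 1 p) delta_square ?scaler0.
Qed.

(** Iterating [contract_step] pushes the cocycle into ever higher arities. The sum of all
    corrections is finite on every word, so it is a cochain, and [delta] may be compared with that
    of a partial sum because it never looks at longer words. *)
Lemma acyclic_cocycle p f : cocycle K p f -> coboundary K p f.
Proof.
move=> cf; pose F n := iter n (step p) f.
have cF n : cocycle K p (F n) by elim: n => //= n; apply: step_cocycle.
have vF n : vanishes_below n (F n).
  by elim: n => [|n IH] //; apply: contract_step.
pose H N : seq (helt A) -> K := \sum_(0 <= n < N) contract p (F n).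
have HE N s : H N s = \sum_(0 <= n < N) contract p (F n) s.
  by rewrite /H fct_sumE.
have HS N : H N.+1 = 1 *: contract p (F N) + H N.
  by rewrite /H big_nat_recr //= addrC scale1r.
have cH N : cochain K (p - 1) (H N).
  elim: N => [|N IH]; first by rewrite /H big_geq //; apply: cochain0.
  by rewrite HS; apply: cochainL => //; apply: contract_cochain; case: (cF N).
have dH N : delta K (p - 1) (H N) = f - F N.
  elim: N => [|N IH]; first by rewrite /H big_geq // delta0 /F /= subrr.
  have cN : cochain K (p - 1) (contract p (F N)).
    by apply: contract_cochain; case: (cF N).
  by rewrite HS delta_lin // IH scale1r [F N.+1]/= /step opprB addrCA.
have Hstab N M s : (size s < N)%N -> (N <= M)%N -> H M s = H N s.
  move=> lt_sN leNM; rewrite !HE (big_cat_nat (n := N)) //=.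
  rewrite [X in _ + X]big1_seq ?addr0 // => n /andP[_].
  rewrite mem_index_iota => /andP[leNn _]; rewrite /contract vF //.
  exact: leq_trans leNn.
(* The correction with index [n] vanishes on words of size less than [n], so only the indices up to
   [size s] contribute at [s]. *)
pose h s := H (size s).+1 s.
have hE N : vanishes_below N (H N - h).
  move=> s lt_sN; rewrite -[LHS]/(H N s - h s).
  by rewrite (@Hstab (size s).+1 N) // subrr.
have ch : cochain K (p - 1) h.
  split=> [s|s1 s2 q c a b|s1 s2].
  - by have [hom _ _] := cH (size s).+1; apply: hom.
  - have [_ ml _] := cH (size (s1 ++ hone :: s2)).+1.
    by move: (ml s1 s2 q c a b); rewrite /h !size_cat.
  by have [_ _ nf] := cH (size (s1 ++ hone :: s2)).+1; apply: nf.
exists h => //; apply/funext => s; pose N := (size s).+1.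
have E : delta K (p - 1) (H N) s = delta K (p - 1) h s.
  have := delta_vanishes (p - 1) (hE N) (ltnSn _ : (size s < N)%N).
  rewrite [H N - h]addrC -scaleN1r delta_lin // => E; apply/eqP.
  rewrite eq_sym -subr_eq0 -oppr_eq0 opprB addrC -scaleN1r; exact/eqP.
rewrite -E dH -[RHS]/(f s - F N s) vF ?subr0 //; exact: ltnSn.
Qed.

End Contraction.

(** * Cones and the invariance of cohomology under quasi-isomorphisms *)

Section Cone.
Variables (k : fieldType) (A : augDGA k) (M N : dgbimod A) (m : int).
Variable g : M -> N.
Hypothesis gdg : dgmap m g.
Implicit Types (z : (M * N)%type) (a b : helt A).

Let g_hom q x : bhom q x -> bhom (q + m) (g x).
Proof. by case: gdg => [[h _ _ _] _]; apply: h. Qed.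
Let gL q c x y : bhom q x -> bhom q y -> g (c *: x + y) = c *: g x + g y.
Proof. by case: gdg => [[_ h _ _] _]; apply: h. Qed.
Let g_lact a q x : bhom q x -> g (lact a x) = (-1) ^ (m * hdeg a) *: lact a (g x).
Proof. by case: gdg => [[_ _ h _] _]; apply: h. Qed.
Let g_ract a q x : bhom q x -> g (ract x a) = ract (g x) a.
Proof. by case: gdg => [[_ _ _ h] _]; apply: h. Qed.
Let g_bd q x : bhom q x -> g (bd q x) = (-1) ^ m *: bd (q + m) (g x).
Proof. by case: gdg => [_ h]; apply: h. Qed.
Let g0 : g 0 = 0.
Proof.
have := gL (-1) (bhom0 M 0) (bhom0 M 0).
by rewrite scaler0 addr0 scaleN1r addNr.
Qed.

Lemma bhom_eq (L : dgbimod A) p q (x : L) : p = q -> bhom p x -> bhom q x.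
Proof. by move->. Qed.

Lemma pair_sum I (r : seq I) (x : I -> M) (y : I -> N) :
  \sum_(i <- r) (x i, y i) = (\sum_(i <- r) x i, \sum_(i <- r) y i).
Proof. by elim/big_rec3: _ => // i u v w _ ->. Qed.

Let sndL (c : k) z z' : (c *: z + z').2 = c *: z.2 + z'.2. Proof. by []. Qed.
(** The target is shifted by [m - 1], so that a closed map of any degree [m] has a cone. In
    [cone_lact] the sign is that of moving [a] past the shift, [m + 1] having the parity of
    [m - 1]. *)
Definition cone_hom q z := bhom q z.1 /\ bhom (q + m - 1) z.2.
Definition cone_lact a z := (lact a z.1, (-1) ^ ((m + 1) * hdeg a) *: lact a z.2).
Definition cone_ract z a := (ract z.1 a, ract z.2 a).
Definition cone_d q z := (bd q z.1, g z.1 - (-1) ^ m *: bd (q + m - 1) z.2).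

Lemma cone_indep (s : seq int) (x : int -> (M * N)%type) : uniq s ->
  (forall q, cone_hom q (x q)) -> \sum_(q <- s) x q = 0 ->
  forall q, q \in s -> x q = 0.
Proof.
move=> us hx; rewrite (eq_bigr (fun q => ((x q).1, (x q).2))) => [|q _]; last first.
  by case: (x q).
rewrite pair_sum => -[s1 s2] q qs; rewrite [x q]surjective_pairing; congr (_, _).
  by apply: (@bhom_indep _ _ M s (fun q => (x q).1)) => // r; case: (hx r).
(* The second components are indexed by their own degrees [r + m - 1], and [r + 1 - m] inverts this
   reindexing. *)
have := @bhom_indep _ _ N [seq r + m - 1 | r <- s] (fun r => (x (r + 1 - m)).2).
have E r : r + m - 1 + 1 - m = r by ring.
move=> /(_ _ _ _ (q + m - 1)); rewrite E; apply.
- by rewrite map_inj_uniq // => i j H; rewrite -(E i) H E.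
- move=> r; case: (hx (r + 1 - m)) => _; apply: bhom_eq; ring.
- by rewrite big_map -[RHS]s2; apply: eq_bigr => r _; rewrite E.
exact: map_f.
Qed.

Lemma cone_hom0 q : cone_hom q 0. Proof. by split; apply: bhom0. Qed.

Lemma cone_homL q c x y : cone_hom q x -> cone_hom q y -> cone_hom q (c *: x + y).
Proof. by case=> ? ? [? ?]; split; apply: bhomL. Qed.

Lemma cone_lact_hom a q x : cone_hom q x -> cone_hom (hdeg a + q) (cone_lact a x).
Proof.
case=> h1 h2; split; first exact: lact_hom.
by apply: bhomZ; apply: bhom_eq (lact_hom a h2); ring.
Qed.

Lemma cone_ract_hom a q x : cone_hom q x -> cone_hom (q + hdeg a) (cone_ract x a).
Proof.
case=> h1 h2; split; first exact: ract_hom.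
by apply: bhom_eq (ract_hom a h2); ring.
Qed.

Lemma cone_lactL a q c x y : cone_hom q x -> cone_hom q y ->
  cone_lact a (c *: x + y) = c *: cone_lact a x + cone_lact a y.
Proof.
case=> h1 h2 [h3 h4]; congr (_, _); first exact: lactL h1 h3.
by rewrite sndL (lactL _ _ h2 h4) /=; lincomb k N.
Qed.

Lemma cone_ractL a q c x y : cone_hom q x -> cone_hom q y ->
  cone_ract (c *: x + y) a = c *: cone_ract x a + cone_ract y a.
Proof.
by case=> h1 h2 [h3 h4]; congr (_, _); [exact: ractL h1 h3 | exact: ractL h2 h4].
Qed.

Lemma cone_lactDl p (c : k) (a b : A) q x : cone_hom q x ->
  cone_lact (hpr p (c *: a + b)) x =
  c *: cone_lact (hpr p a) x + cone_lact (hpr p b) x.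
Proof.
case=> h1 h2; congr (_, _); first exact: lactDl h1.
by rewrite (lactDl _ _ _ _ h2) /=; lincomb k N.
Qed.

Lemma cone_ractDr p (c : k) (a b : A) q x : cone_hom q x ->
  cone_ract x (hpr p (c *: a + b)) =
  c *: cone_ract x (hpr p a) + cone_ract x (hpr p b).
Proof.
by case=> h1 h2; congr (_, _); [exact: ractDr h1 | exact: ractDr h2].
Qed.

Lemma cone_lactA a b q x : cone_hom q x ->
  cone_lact (hmul a b) x = cone_lact a (cone_lact b x).
Proof.
case=> h1 h2; congr (_, _); first exact: lactA h1.
rewrite (lactA _ _ h2) /= (lactZ _ _ (lact_hom b h2)).
by lincomb k N.
Qed.

Lemma cone_ractA a b q x : cone_hom q x ->
  cone_ract x (hmul a b) = cone_ract (cone_ract x a) b.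
Proof. by case=> h1 h2; congr (_, _); [exact: ractA h1 | exact: ractA h2]. Qed.

Lemma cone_lractA a b q x : cone_hom q x ->
  cone_ract (cone_lact a x) b = cone_lact a (cone_ract x b).
Proof.
case=> h1 h2; congr (_, _); first exact: lractA h1.
by rewrite /= (ractZ _ _ (lact_hom a h2)) (lractA _ _ h2).
Qed.

Lemma cone_lact1 q x : cone_hom q x -> cone_lact hone x = x.
Proof.
case: x => x y [h1 h2]; congr (_, _); first exact: lact1 h1.
by rewrite (lact1 h2) /= mulr0 scale1r.
Qed.

Lemma cone_ract1 q x : cone_hom q x -> cone_ract x hone = x.
Proof.
by case: x => x y [h1 h2]; congr (_, _); [exact: ract1 h1 | exact: ract1 h2].
Qed.

Definition cone_gr : grbimod A := @GrBimod k A (M * N)%type cone_hom cone_hom0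
  cone_homL cone_indep cone_lact cone_ract cone_lact_hom cone_ract_hom cone_lactL
  cone_ractL cone_lactDl cone_ractDr cone_lactA cone_ractA cone_lractA cone_lact1
  cone_ract1.

Lemma cone_d_hom q x : cone_hom q x -> cone_hom (q + 1) (cone_d q x).
Proof.
case=> h1 h2; split; first exact: bd_hom.
apply: bhomD; first by apply: bhom_eq (g_hom h1); ring.
by apply/bhomN/bhomZ; apply: bhom_eq (bd_hom h2); ring.
Qed.

Lemma cone_dL q c x y : cone_hom q x -> cone_hom q y ->
  cone_d q (c *: x + y) = c *: cone_d q x + cone_d q y.
Proof.
case=> h1 h2 [h3 h4]; congr (_, _); first exact: bdL h1 h3.
by rewrite /= (gL _ h1 h3) (bdL _ h2 h4) /=; lincomb k N.
Qed.

Lemma cone_dd q x : cone_hom q x -> cone_d (q + 1) (cone_d q x) = 0.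
Proof.
case=> h1 h2; congr (_, _); first exact: bdd h1.
have h3 := g_hom h1; have h4 := bd_hom h2.
have e : q + m - 1 + 1 = q + m by ring.
rewrite /= (g_bd h1) (_ : q + 1 + m - 1 = q + m); last by ring.
rewrite e in h4; rewrite bdD //; last exact/bhomN/bhomZ.
have bd0' : bd (q + m) (bd (q + m - 1) x.2) = 0 by rewrite -{1}e bdd.
rewrite -!scaleNr bdZ // bd0' scaler0 addr0.
by rewrite scaleNr subrr.
Qed.

Lemma cone_d_lact a q x : cone_hom q x ->
  cone_d (hdeg a + q) (cone_lact a x) =
  cone_lact (hd a) x + (-1) ^ (hdeg a) *: cone_lact a (cone_d q x).
Proof.
case=> h1 h2; congr (_, _); first exact: bd_lact h1.
rewrite /= (g_lact a h1).
rewrite (_ : hdeg a + q + m - 1 = hdeg a + (q + m - 1)); last by ring.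
rewrite bdZ; last exact: lact_hom; rewrite (bd_lact a h2).
have h3 := g_hom h1.
have h4 : bhom (q + m) (bd (q + m - 1) x.2) by apply: bhom_eq (bd_hom h2); ring.
rewrite (lactD a h3); last exact/bhomN/bhomZ; rewrite -!scaleNr (lactZ _ _ h4).
by lincomb k N.
Qed.

Lemma cone_d_ract a q x : cone_hom q x ->
  cone_d (q + hdeg a) (cone_ract x a) =
  cone_ract (cone_d q x) a + (-1) ^ q *: cone_ract x (hd a).
Proof.
case=> h1 h2; congr (_, _); first exact: bd_ract h1.
rewrite /= (g_ract a h1).
rewrite (_ : q + hdeg a + m - 1 = (q + m - 1) + hdeg a); last by ring.
rewrite (bd_ract a h2).
have h3 := g_hom h1.
have h4 : bhom (q + m) (bd (q + m - 1) x.2) by apply: bhom_eq (bd_hom h2); ring.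
rewrite (ractD a h3); last exact/bhomN/bhomZ; rewrite -!scaleNr (ractZ _ _ h4).
by lincomb k N.
Qed.

Definition cone : dgbimod A :=
  @DGBimod k A cone_gr cone_d cone_d_hom cone_dL cone_dd cone_d_lact cone_d_ract.

(** For a cycle [(x, y)] of the cone, injectivity on cohomology gives [z] with [x = d z];
    surjectivity then provides a cycle [x'] which corrects [z] so that [y] is reached up to a
    boundary. *)
Lemma cone_acyclic : quasi_iso m g -> acyclic cone.
Proof.
move=> [_ g_inj g_surj] q [x y] /= [h1 h2] /= [dx /eqP].
rewrite subr_eq0 => /eqP E.
have [z hz xE] : exists2 z, bhom (q - 1) z & x = bd (q - 1) z.
  apply: (g_inj q x ((-1) ^ m *: y)) => //; first exact: bhomZ.
  by rewrite bdZ.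
have e1 : q + m - 1 = q - 1 + m by ring.
have h3 := g_hom hz; rewrite e1 in h2.
have [|| x' [w [hx' dx' hw yE]]] := g_surj (q - 1) (y - g z).
- exact/bhomD/bhomN.
- rewrite bdD //; last exact: bhomN.
  rewrite -scaleN1r bdZ // -e1 scaleN1r.
  apply/eqP; rewrite subr_eq0; apply/eqP/(scalerI (a := (-1) ^ m)).
    by rewrite expfz_neq0 // oppr_eq0 oner_eq0.
  by rewrite -E xE (g_bd hz) e1.
exists (z + x', - (-1) ^ m *: w); first split => /=.
- exact: bhomD.
- exact: bhomZ.
congr (_, _) => /=; first by rewrite bdD // dx' addr0.
rewrite -[z]scale1r (gL 1 hz hx') !scale1r bdZ // -yE.
by lincomb k N.
Qed.

Lemma delta_cone p (f : seq (helt A) -> M) (h : seq (helt A) -> N) s :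
  delta cone p (fun s => (f s, h s)) s =
  (delta M p f s, g (f s) - (-1) ^ m *: delta N (p + m - 1) h s).
Proof.
pose G (u : nat -> k) n (t : nat -> seq (helt A)) :=
  pair_sum (index_iota 0 n) (fun i => u i *: f (t i)) (fun i => u i *: h (t i)).
rewrite {1}/delta.
rewrite [X in _ + X - _]G [X in _ - X]G; congr (_, _); first by case: (s).
rewrite /= /delta (_ : p + sdeg s + m - 1 = p + m - 1 + sdeg s); last by ring.
set b := bd _ _; set S1 := \sum_(0 <= i < size s) _.
set S2 := \sum_(0 <= i < (size s).-1) _.
rewrite [X in _ = _ - _ *: (_ + X - _ + _)](_ : _ = - (-1) ^ m *: S1); last first.
  by rewrite scaler_sumr; apply: eq_bigr => i _; lincomb k N.
rewrite [X in _ = _ - _ *: (_ + _ - X + _)](_ : _ = - (-1) ^ m *: S2); last first.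
  by rewrite scaler_sumr; apply: eq_bigr => i _; lincomb k N.
case: (s) => [|a t] /=; first by lincomb k N.
by lincomb k N.
Qed.

Lemma cone_cochain p (f : seq (helt A) -> M) (h : seq (helt A) -> N) :
  cochain M p f -> cochain N (p + m - 1) h -> cochain cone p (fun s => (f s, h s)).
Proof.
case=> f1 f2 f3 [h1 h2 h3]; split=> [s|s1 s2 q c a b|s1 s2].
- by split=> //=; apply: bhom_eq (h1 s); ring.
- by rewrite f2 h2.
by rewrite f3 h3.
Qed.

Lemma cone_cochain_proj p (f : seq (helt A) -> cone) : cochain cone p f ->
  cochain M p (fun s => (f s).1) /\ cochain N (p + m - 1) (fun s => (f s).2).
Proof.
case=> f1 f2 f3; split; split=> [s|s1 s2 q c a b|s1 s2].
- by case: (f1 s).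
- by rewrite f2.
- by rewrite f3.
- by case: (f1 s) => _; apply: bhom_eq; ring.
- by rewrite f2.
by rewrite f3.
Qed.

Lemma dgmap_cochain p f : cochain M p f -> cochain N (p + m) (g \o f).
Proof.
case=> f1 f2 f3; split=> [s|s1 s2 q c a b|s1 s2] /=.
- by apply: bhom_eq (g_hom (f1 s)); ring.
- rewrite f2; have := f1 (s1 ++ hpr q a :: s2).
  have := f1 (s1 ++ hpr q b :: s2); rewrite !sdegE => hb ha; exact: gL ha hb.
by rewrite f3.
Qed.

Lemma coneP p f : acyclic cone -> cocycle cone p f -> exists u w,
  [/\ cochain M (p - 1) u, cochain N (p - 1 + m - 1) w,
      forall s, (f s).1 = delta M (p - 1) u s
    & forall s, (f s).2 = g (u s) - (-1) ^ m *: delta N (p - 1 + m - 1) w s].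
Proof.
move=> acyc cf; have [sigma csigma] := acyclic_contraction acyc.
have [h /cone_cochain_proj[hu hw] fE] := acyclic_cocycle csigma cf.
exists (fun s => (h s).1), (fun s => (h s).2).
have E s : f s = delta cone (p - 1) (fun t => ((h t).1, (h t).2)) s.
  by rewrite fE; congr delta; apply/funext => t; case: (h t).
by split=> // s; rewrite E delta_cone.
Qed.

(** A primitive [h] of [g f] makes [(f, h)], up to a sign on [h], a cocycle with values in the cone;
    it is a coboundary there, and the first component is a primitive of [f]. *)
Lemma quasi_iso_inj p f : quasi_iso m g -> cocycle M p f ->
  coboundary N (p + m) (g \o f) -> coboundary M p f.
Proof.
move=> qi [hf df] [h hh E].
have [|u [w [hu _ fE _]]] :=
    @coneP p (fun s => (f s, (-1) ^ m *: h s)) (cone_acyclic qi).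
  split.
    apply: cone_cochain => //.
    exact: cochainZ hh.
  have dh := deltaZ ((-1) ^ m) hh; rewrite -E in dh.
  apply/funext => s; rewrite delta_cone df [delta N _ _]dh.
  rewrite -[((-1) ^ m *: (g \o f)) s]/((-1) ^ m *: g (f s)).
  by congr (_, _); lincomb k N.
by exists u => //; apply/funext => s; rewrite -fE.
Qed.

(** Here [(0, h)] is a cocycle of degree [p + 1] with values in the cone. In a primitive [(u, w)] of
    it, [u] is a cocycle and [w] relates [h] to [g u]. *)
Lemma quasi_iso_surj p h : quasi_iso m g -> cocycle N (p + m) h ->
  exists2 u, cocycle M p u & coboundary N (p + m) (h - (g \o u)).
Proof.
move=> qi [hh dh].
have e : p + 1 + m - 1 = p + m by ring.
have [|u [w [hu hw uE hE]]] :=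
    @coneP (p + 1) (fun s => (0, h s)) (cone_acyclic qi).
  split; first by apply: cone_cochain; [exact: cochain0 | rewrite e].
  apply/funext => s; rewrite delta_cone e dh g0 sub0r scaler0 oppr0.
  by rewrite [delta M _ _](delta0 M (p + 1)).
rewrite addrK in hu uE hw hE; exists u.
  by split=> //; apply/funext => s; rewrite -uE.
exists (- (-1) ^ m *: w).
  exact: cochainZ.
apply/funext => s; rewrite deltaZ // -[LHS]/(h s - g (u s)) -[RHS]/(- (-1) ^ m *: delta N (p + m - 1) w s).
by have /= -> := hE s; lincomb k N.
Qed.

End Cone.

Section Coboundaries.
Variables (k : fieldType) (A : augDGA k) (M : dgbimod A).
Implicit Types (s : seq (helt A)) (x y : seq (helt A) -> A).
Implicit Types (f g : seq (helt A) -> M).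

Lemma coboundaryL p c f g : coboundary M p f -> coboundary M p g ->
  coboundary M p (c *: f + g).
Proof.
by move=> [h hh ->] [h' hh' ->]; exists (c *: h + h');
  [apply: cochainL | rewrite delta_lin].
Qed.

Lemma coboundary0 p : coboundary M p 0.
Proof. by exists 0; [apply: cochain0 | rewrite delta0]. Qed.

Lemma coboundaryZ p c f : coboundary M p f -> coboundary M p (c *: f).
Proof. by move=> hf; rewrite -[_ *: f]addr0; apply/coboundaryL/coboundary0. Qed.

Lemma coboundaryD p f g : coboundary M p f -> coboundary M p g ->
  coboundary M p (f + g).
Proof. by move=> hf hg; rewrite -[f]scale1r; apply: coboundaryL. Qed.

Lemma coboundaryN p f : coboundary M p f -> coboundary M p (- f).
Proof. by move=> hf; rewrite -scaleN1r; apply: coboundaryZ. Qed.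

Lemma coboundaryB p f g : coboundary M p f -> coboundary M p g ->
  coboundary M p (f - g).
Proof. by move=> hf hg; apply/coboundaryD/coboundaryN. Qed.

Lemma coboundary_cocycle p f : coboundary M p f -> cocycle M p f.
Proof.
move=> [h hh ->]; have := delta_cochain hh; have := fun s => delta_square s hh.
by rewrite subrK => d2 hd; split=> //; apply/funext.
Qed.

Lemma cocycleL p c f g : cocycle M p f -> cocycle M p g ->
  cocycle M p (c *: f + g).
Proof.
move=> [hf df] [hg dg]; split; first exact: cochainL.
by rewrite delta_lin // df dg scaler0 addr0.
Qed.

Lemma cocycle0 p : cocycle M p 0.
Proof. by split; [apply: cochain0 | apply: delta0]. Qed.

Lemma cocycleZ p c f : cocycle M p f -> cocycle M p (c *: f).
Proof. by move=> hf; rewrite -[_ *: f]addr0; apply/cocycleL/cocycle0. Qed.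

Lemma cocycleB p f g : cocycle M p f -> cocycle M p g -> cocycle M p (f - g).
Proof. by move=> hf hg; rewrite addrC -scaleN1r; apply: cocycleL. Qed.

Lemma lcup0l p q f : cochain M q f -> lcup p q 0 f = 0.
Proof.
move=> hf; apply/funext => s; rewrite -[RHS](spl_0 M s); apply: eq_spl => u v _.
by rewrite /ins (lact_v0 _ (cochain_hom hf (erefl _))) scaler0.
Qed.

Lemma lcup0r p q x : lcup p q x (0 : seq (helt A) -> M) = 0.
Proof.
apply/funext => s; rewrite -[RHS](spl_0 M s); apply: eq_spl => u v _.
by rewrite lact0 scaler0.
Qed.

Lemma lcupDr p q x f g c : cochain M q f -> cochain M q g ->
  lcup p q x (c *: f + g) = c *: lcup p q x f + lcup p q x g.
Proof.
move=> hf hg; apply/funext => s; rewrite -[RHS]/(c *: lcup p q x f s + lcup p q x g s).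
rewrite /lcup -spl_scale -spl_add; apply: eq_spl => u v _.
rewrite (@lactL _ _ _ _ (q + sdeg v)); first by lincomb k M.
  exact: (cochain_hom hf).
exact: (cochain_hom hg).
Qed.

Lemma lcupDl p q x y f c : cochain M q f ->
  lcup p q (c *: x + y) f = c *: lcup p q x f + lcup p q y f.
Proof.
move=> hf; apply/funext => s; apply: lcup_addl => t.
by exists (q + sdeg t); apply: (cochain_hom hf).
Qed.

Lemma lcup_cocycle p q x f : cocycle (reg A) p x -> cocycle M q f ->
  cocycle M (p + q) (lcup p q x f).
Proof.
move=> [hx dx] [hf df]; split; first exact: lcup_cochain.
apply/funext => s; rewrite delta_lcup // dx df lcup0l // lcup0r.
by rewrite scaler0 addr0.
Qed.

Lemma lcup_coboundary_r p q x f : cocycle (reg A) p x -> coboundary M q f ->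
  coboundary M (p + q) (lcup p q x f).
Proof.
move=> [hx dx] [h hh ->]; exists ((-1) ^ p *: lcup p (q - 1) x h).
  by rewrite -addrA; apply/cochainZ/lcup_cochain.
rewrite -addrA deltaZ; last exact: lcup_cochain.
apply/funext => s; rewrite -[RHS]/(_ *: delta M _ _ s) delta_lcup // dx lcup0l //.
by rewrite subrK add0r scalerA sgn2 scale1r.
Qed.

Lemma lcup_coboundary_l p q x f : coboundary (reg A) p x -> cocycle M q f ->
  coboundary M (p + q) (lcup p q x f).
Proof.
move=> [h hh ->] [hf df]; have e : p + q - 1 = p - 1 + q by rewrite addrAC.
exists (lcup (p - 1) q h f); first by rewrite e; apply: lcup_cochain.
apply/funext => s; rewrite e delta_lcup // df lcup0r subrK.
by rewrite scaler0 addr0.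
Qed.

End Coboundaries.

Section DgMaps.
Variables (k : fieldType) (A : augDGA k) (M N : dgbimod A) (m : int).
Variable g : M -> N.
Hypothesis gdg : dgmap m g.
Implicit Types (s : seq (helt A)) (x : seq (helt A) -> A) (f : seq (helt A) -> M).

Lemma dgmap0 : g 0 = 0.
Proof.
have [[_ gL _ _] _] := gdg; have := gL _ (-1) _ _ (bhom0 M 0) (bhom0 M 0).
by rewrite scaler0 addr0 scaleN1r addNr.
Qed.

Lemma dgmapB p f h : cochain M p f -> cochain M p h -> g \o (f - h) = (g \o f) - (g \o h).
Proof.
move=> [hf _ _] [hh _ _]; have [[_ gL _ _] _] := gdg; apply/funext => s.
rewrite /= -[(f - h) s]/(f s - h s) addrC -scaleN1r (gL _ _ _ _ (hh s) (hf s)).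
by rewrite scaleN1r addrC.
Qed.

(** Read off from [delta_square] in the cone, applied to [(f, 0)]: the second component of the
    vanishing square is the compatibility of [g] with the differentials. *)
Lemma dgmap_delta p f : cochain M p f ->
  delta N (p + m) (g \o f) = (-1) ^ m *: (g \o delta M p f).
Proof.
move=> hf; pose F s : cone gdg := (f s, 0).
have hF : cochain (cone gdg) p F.
  by apply: (@cone_cochain _ _ _ _ _ _ gdg); [exact: hf | exact: cochain0].
have dF : delta (cone gdg) p F = (fun s => (delta M p f s, g (f s))).
  apply/funext => s; rewrite (delta_cone gdg p f 0) delta0.
  by rewrite scaler0 subr0.
apply/funext => s; have := delta_square s hF; rewrite dF.
rewrite (delta_cone gdg (p + 1) (delta M p f) (fun s => g (f s))) => -[_ /eqP].
rewrite subr_eq0 (_ : p + 1 + m - 1 = p + m); last by ring.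
move=> /eqP E; rewrite -[RHS]/(_ *: g (delta M p f s)) E scalerA sgn2 scale1r.
by [].
Qed.

Lemma dgmap_cocycle p f : cocycle M p f -> cocycle N (p + m) (g \o f).
Proof.
move=> [hf df]; split; first exact: dgmap_cochain.
rewrite dgmap_delta // df; apply/funext => s.
by rewrite -[LHS]/(_ *: g 0) dgmap0 scaler0.
Qed.

Lemma dgmap_coboundary p f : coboundary M p f -> coboundary N (p + m) (g \o f).
Proof.
move=> [h hh ->]; have hg := dgmap_cochain gdg hh.
have e : p + m - 1 = p - 1 + m by rewrite addrAC.
exists ((-1) ^ m *: (g \o h)).
  by rewrite e; apply: cochainZ.
rewrite e deltaZ // dgmap_delta // scalerA sgn2.
by rewrite scale1r.
Qed.

Lemma dgmap_lcup p q x f : cochain (reg A) p x -> cochain M q f ->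
  g \o lcup p q x f = (-1) ^ (m * p) *: lcup p (q + m) x (g \o f).
Proof.
move=> hx hf; have [[_ gL gl _] _] := gdg; apply/funext => s /=.
have gD r (z z' : M) : bhom r z -> bhom r z' -> g (z + z') = g z + g z'.
  by move=> hz hz'; have := gL r 1 z z' hz hz'; rewrite !scale1r.
have hom u v : bhom (p + sdeg u + (q + sdeg v)) (lact (ins p x u) (f v)).
  by apply: (lact_hom (ins p x u)); apply: (cochain_hom hf).
rewrite /lcup (spl_homogeneous (gD (p + q + sdeg s))) => [|u v uv]; last first.
  by apply/bhomZ/bhom_eq/hom; rewrite -uv sdegE; ring.
rewrite -[RHS]/(_ *: spl s _) -spl_scale; apply: eq_spl => u v uv.
rewrite -[_ *: lact _ _]addr0 (gL _ _ _ _ (hom u v) (bhom0 _ _)).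
rewrite dgmap0 (gl _ (q + sdeg v)); last exact: (cochain_hom hf).
by rewrite /=; lincomb k N.
Qed.

End DgMaps.

Lemma class_eq (k : fieldType) (A : augDGA k) (M : dgbimod A) p
    (f g : seq (helt A) -> M) (Zf : cocycle M p f) (Zg : cocycle M p g) :
  class Zf = class Zg <-> coboundary M p (f - g).
Proof. by rewrite /class HH_piE; split=> [/asboolP|h]; [|apply/asboolP]. Qed.

(** * Bijectivity of capping with the class *)

Section PoincareDuality.
Variables (k : fieldType) (A : augDGA k) (P : dgbimod A) (d : int).
Variables (eps : P -> reg A) (psi : P -> dual A) (t : seq (helt A) -> P).
Hypotheses (qeps : quasi_iso 0 eps) (qpsi : quasi_iso (- d) psi).
Hypothesis ct : cocycle P 0 t.
Hypothesis eps_t : coboundary (reg A) 0 (fun s => eps (t s) - unit_cochain s).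
Variable F : seq (helt A) -> dual A.
Hypothesis cF : cocycle (dual A) (- d) F.
Hypothesis psi_t : coboundary (dual A) (- d) (F - (psi \o t)).

Lemma lcup_unit p x : cochain (reg A) p x ->
  lcup (M := reg A) p 0 x (@unit_cochain k A) = x.
Proof.
move=> hx; apply/funext => s; rewrite /lcup spl_only_nil_r => [|u [|b v] // _].
  by rewrite mul0r expr0z scale1r /= mulr1; apply: cochain_reg_hom.
by rewrite /= mulr0 scaler0.
Qed.

Let eps_dg : dgmap 0 eps. Proof. by case: qeps. Qed.
Let psi_dg : dgmap (- d) psi. Proof. by case: qpsi. Qed.

(* Both sides of [eps (x . t) = x . eps t] are cohomologous to [x] since [t]
   lifts the unit. *)
Let eps_lcup p x : cocycle (reg A) p x ->
  coboundary (reg A) (p + 0) ((eps \o lcup p 0 x t) - x).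
Proof.
move=> cx; have := lcup_coboundary_r cx eps_t.
have ce := dgmap_cocycle eps_dg ct; rewrite addr0 in ce.
have cu : cochain (reg A) 0 (@unit_cochain k A).
  have [[he _] [hb _]] := (ce, coboundary_cocycle eps_t).
  have -> : @unit_cochain k A =
      (-1) *: (fun s => eps (t s) - unit_cochain s) + (eps \o t).
    apply/funext => s; rewrite -[RHS]/(-1 *: (eps (t s) - unit_cochain s) + eps (t s)).
    by lincomb k (reg A).
  exact: (cochainL (M := reg A)).
have -> : (fun s => eps (t s) - unit_cochain s) =
    (-1) *: (@unit_cochain k A : seq (helt A) -> reg A) + (eps \o t).
  by apply/funext => s; rewrite scaleN1r addrC.
rewrite lcupDr //; last by case: ce.
rewrite (lcup_unit (proj1 cx)) (dgmap_lcup eps_dg (proj1 cx) (proj1 ct)).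
by rewrite mul0r expr0z scale1r addr0 scaleN1r addrC.
Qed.

(** The sign [e] collects that of [cap_lcup] and the one of moving [psi] past [x]. Only its square
    is needed afterwards. *)
Let psi_lcup p x : cocycle (reg A) p x -> exists e : k, [/\ e * e = 1 &
  coboundary (dual A) (p - d) (cap p (- d) x F - e *: (psi \o lcup p 0 x t))].
Proof.
move=> cx; exists ((-1) ^ p * (-1) ^ (- d * p)).
split; first by rewrite mulrACA !sgn2 mulr1.
have [hx _] := cx; have [hF _] := cF; have [ht _] := ct.
rewrite (cap_lcup hx) => [|s]; last exact: (cochain_hom hF).
have hp := dgmap_cochain psi_dg ht; rewrite add0r in hp.
rewrite (dgmap_lcup psi_dg) // add0r.
have -> : (-1) ^ p *: lcup p (- d) x F - ((-1) ^ p * (-1) ^ (- d * p)) *: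
    ((-1) ^ (- d * p) *: lcup p (- d) x (psi \o t)) =
    (-1) ^ p *: lcup p (- d) x (F - (psi \o t)).
  rewrite (_ : F - (psi \o t) = -1 *: (psi \o t) + F).
    rewrite lcupDr //.
    by rewrite !scalerA -mulrA sgn2 mulr1 scalerDr addrC scalerA mulrN1 scaleNr.
  by rewrite scaleN1r addrC.
exact/coboundaryZ/lcup_coboundary_r.
Qed.

(** If the cap is a coboundary, so is the image of [lcup p 0 x t] under [psi], hence that cochain
    itself, hence its image under [eps], which is cohomologous to [x]. *)
Lemma cap_inj p x : cocycle (reg A) p x ->
  coboundary (dual A) (p - d) (cap p (- d) x F) -> coboundary (reg A) p x.
Proof.
move=> cx bx; have [e [e2 hb]] := psi_lcup cx.
have ctx := lcup_cocycle cx ct.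
have : coboundary P (p + 0) (lcup p 0 x t).
  apply: (quasi_iso_inj psi_dg qpsi ctx); rewrite addr0.
  have := coboundaryZ e (coboundaryB bx hb).
  by rewrite subKr scalerA e2 scale1r.
move=> /(dgmap_coboundary eps_dg) bt; have := eps_lcup cx.
rewrite !addr0 in bt *; move=> /(coboundaryB bt).
by rewrite subKr.
Qed.

(** Lift [G] through [psi] to a cocycle [u] in [P] and take for [x] the image of [u] under [eps].
    Then [u] and [lcup p 0 x t] have cohomologous images under [eps], so they are cohomologous in
    [P], and [psi] carries this back to [G]. *)
Lemma cap_surj p G : cocycle (dual A) (p - d) G ->
  exists2 x, cocycle (reg A) p x & coboundary (dual A) (p - d) (G - cap p (- d) x F).
Proof.
move=> cG; have [u cu bu] := quasi_iso_surj psi_dg qpsi cG.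
have cx := dgmap_cocycle eps_dg cu; rewrite addr0 in cx.
have [e [e2 hb]] := psi_lcup cx; set x := eps \o u in cx hb.
have ctx := lcup_cocycle cx ct; have hbx := eps_lcup cx.
rewrite addr0 in ctx hbx.
have bux : coboundary P p (u - lcup p 0 x t).
  apply: (quasi_iso_inj eps_dg qeps); first exact: cocycleB.
  rewrite (dgmapB eps_dg (proj1 cu) (proj1 ctx)) addr0.
  by have := coboundaryN hbx; rewrite opprB.
exists (e *: x : seq (helt A) -> reg A); first exact: cocycleZ.
have [hx _] := cx; have [hF _] := cF.
have -> : cap p (- d) (e *: (x : seq (helt A) -> reg A)) F = e *: cap p (- d) x F.
  rewrite !cap_lcup //; try by move=> s; apply: (cochain_hom hF).
    rewrite -[e *: _]addr0 lcupDl // lcup0l // addr0.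
    by rewrite !scalerA mulrC.
  by case: (cocycleZ e cx).
have := coboundaryD bu (dgmap_coboundary psi_dg bux).
rewrite (dgmapB psi_dg (proj1 cu) (proj1 ctx)) addrA subrK.
move=> /coboundaryB /(_ (coboundaryZ e hb)).
by rewrite scalerBr scalerA e2 scale1r opprB addrA subrK.
Qed.

End PoincareDuality.

(** * The BV structure *)

Section GradedOperators.
Variables (k : fieldType) (V : lmodType k) (Zc Bd : V -> Prop).
Hypotheses (ZcL : forall c w w', Zc w -> Zc w' -> Zc (c *: w + w')).
Hypotheses (Bd0 : Bd 0) (BdL : forall c w w', Bd w -> Bd w' -> Bd (c *: w + w')).
Hypothesis BdZ : forall w, Bd w -> Zc w.
Implicit Types (w : V) (S T X Y Z I : V -> V).

(** Linearity is asked on cocycles only, because the actions of a bimodule are linear only on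
    elements of one degree. *)
Definition stable_op T : Prop :=
  [/\ forall w, Zc w -> Zc (T w), forall w, Bd w -> Bd (T w)
    & forall c w w', Zc w -> Zc w' -> T (c *: w + w') = c *: T w + T w'].

Lemma stable_comp S T : stable_op S -> stable_op T -> stable_op (fun w => S (T w)).
Proof.
move=> [S1 S2 S3] [T1 T2 T3]; split=> [w /T1/S1|w /T2/S2|c w w' h h'] //.
by rewrite T3 // S3 //; apply: T1.
Qed.

Lemma stable0 T : stable_op T -> T 0 = 0.
Proof.
move=> [_ _ T3]; have := T3 (-1) _ _ (BdZ Bd0) (BdZ Bd0).
by rewrite scaler0 addr0 scaleN1r addNr.
Qed.

Lemma stable_comb c S T : stable_op S -> stable_op T ->
  stable_op (fun w => c *: S w - T w).
Proof.
have E u v : c *: u - v = -1 *: v + c *: u :> V by lincomb k V.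
have BdZ' e u : Bd u -> Bd (e *: u) by move=> h; rewrite -[_ *: u]addr0; apply: BdL.
have ZcZ e u : Zc u -> Zc (e *: u).
  by move=> h; rewrite -[_ *: u]addr0; apply: ZcL => //; apply: BdZ.
move=> [S1 S2 S3] [T1 T2 T3]; split=> [w h|w h|e w w' h h'].
- by rewrite E; apply: ZcL; [exact: T1 | apply/ZcZ/S1].
- by rewrite E; apply: BdL; [exact: T2 | apply/BdZ'/S2].
by rewrite S3 // T3 //; lincomb k V.
Qed.

Lemma stable_opZ T c w : stable_op T -> Zc w -> T (c *: w) = c *: T w.
Proof.
move=> sT hw; have [_ _ TL] := sT.
by have := TL c _ _ hw (BdZ Bd0); rewrite (stable0 sT) !addr0.
Qed.

Lemma stable_opB T w w' c : stable_op T -> Zc w -> Zc w' ->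
  T (w - c *: w') = T w - c *: T w'.
Proof.
move=> [_ _ TL] hw hw'; rewrite addrC -scaleNr TL // scaleNr.
by rewrite addrC.
Qed.

Variable B : V -> V.
Hypotheses (sB : stable_op B) (BB : forall w, Zc w -> B (B w) = 0).

Definition lie_op (p : int) X w : V := (-1) ^ p *: B (X w) - X (B w).

Lemma stable_lie_op p X : stable_op X -> stable_op (lie_op p X).
Proof. by move=> sX; apply: stable_comb; apply: stable_comp. Qed.

(* Cartan's formula: [I] is the graded commutator of [Y] with
   [lie_op p X = (-1)^p [B, X]], modulo [Bd]. *)
Definition derived_bracket (p q : int) X Y I : Prop := forall w, Zc w ->
  Bd (I w - (lie_op p X (Y w) - (-1) ^ ((p - 1) * q) *: Y (lie_op p X w))).

Lemma stable_bracket p q X Y I T w : stable_op X -> stable_op Y -> stable_op I ->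
  derived_bracket p q X Y I -> stable_op T -> Zc w ->
  Bd (T (I w) - (T (lie_op p X (Y w)) - (-1) ^ ((p - 1) * q) *: T (Y (lie_op p X w)))).
Proof.
move=> sX sY [I1 _ _] br sT hw; have [_ T2 _] := sT; have := T2 _ (br w hw).
have [[L1 _ _] [Y1 _ _]] := (stable_lie_op p sX, sY).
have h1 := L1 _ (Y1 _ hw); have h2 := Y1 _ (L1 _ hw).
have hZ : Zc (lie_op p X (Y w) - (-1) ^ ((p - 1) * q) *: Y (lie_op p X w)).
  by rewrite addrC -scaleNr; apply: ZcL.
rewrite -[X in I w - X]scale1r (stable_opB _ sT (I1 _ hw) hZ).
by rewrite (stable_opB _ sT h1 h2) scale1r.
Qed.

(** The commutator with [lie_op p X] is a derivation of the composition of operators, and the cup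
    product acts as the composite of [Y] and [Z]. *)
Lemma derived_bracket_poisson p q r X Y Z Ixy Ixz J w :
  stable_op X -> stable_op Y -> stable_op Z -> stable_op Ixz ->
  derived_bracket p q X Y Ixy -> derived_bracket p r X Z Ixz ->
  derived_bracket p (q + r) X (fun w => Y (Z w)) J -> Zc w ->
  Bd (J w - (Ixy (Z w) + (-1) ^ ((p - 1) * q) *: Y (Ixz w))).
Proof.
move=> sX sY sZ sI bxy bxz bJ hw; have [Z1 _ _] := sZ.
have E1 := bJ w hw; have E2 := bxy _ (Z1 _ hw).
have E3 := stable_bracket sX sZ sI bxz sY hw.
have := BdL (-1) E2 (BdL (- (-1) ^ ((p - 1) * q)) E3 E1).
by congr Bd; lincomb k V.
Qed.

(** The identity [L_[x, y] = [L_x, L_y]] modulo coboundaries: expand both sides into words in [B],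
    [X], [Y] and drop those containing [B] twice in a row. *)
Lemma lie_op_bracket p q X Y I w :
  stable_op X -> stable_op Y -> stable_op I -> derived_bracket p q X Y I -> Zc w ->
  Bd (lie_op (p + q - 1) I w - (lie_op p X (lie_op q Y w)
    - (-1) ^ ((p - 1) * (q - 1)) *: lie_op q Y (lie_op p X w))).
Proof.
move=> sX sY sI b hw; have [B1 _ _] := sB.
have E1 := stable_bracket sX sY sI b sB hw; have E2 := b _ (B1 _ hw).
have := BdL ((-1) ^ (p + q - 1)) E1 (BdL (-1) E2 Bd0); congr Bd.
have lieE T e u u' : stable_op T -> Zc u -> Zc u' ->
    T (e *: u - u') = e *: T u - T u'.
  move=> sT hu hu'; have [_ _ TL] := sT; rewrite addrC -scaleN1r TL //.
    by rewrite (stable_opZ e sT hu) scaleN1r addrC.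
  by rewrite -[_ *: u]addr0; apply/ZcL/BdZ.
have [[X1 _ _] [Y1 _ _]] := (sX, sY); have hX := X1 _ hw; have hY := Y1 _ hw.
have hB := B1 _ hw; have hXB := X1 _ hB; have hYB := Y1 _ hB.
have hBX := B1 _ hX; have hBY := B1 _ hY.
have hXBY := X1 _ hBY; have hBXY := B1 _ (X1 _ hY).
have hYBX := Y1 _ hBX; have hBYX := B1 _ (Y1 _ hX).
have hYXB := Y1 _ hXB; have hXYB := X1 _ hYB.
have hBXB := B1 _ hXB; have hBYB := B1 _ hYB; have hXY := X1 _ hY.
have h0 := BdZ Bd0; have hX0 := X1 _ h0.
rewrite /lie_op !(lieE X _ _ _ sX, lieE Y _ _ _ sY, lieE B _ _ _ sB, BB) //.
by rewrite (stable0 sX) (stable0 sY); lincomb k V.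
Qed.

(** This is the Jacobi identity for commutators of [lie_op p X], [lie_op q Y] and [Z];
    [lie_op_bracket] replaces the Lie operator of [Ixy] by the commutator of the two others. *)
Lemma derived_bracket_jacobi p q r X Y Z Ixy Ixz Iyz J1 J2 J3 w :
  stable_op X -> stable_op Y -> stable_op Z ->
  stable_op Ixy -> stable_op Ixz -> stable_op Iyz ->
  derived_bracket p q X Y Ixy -> derived_bracket p r X Z Ixz ->
  derived_bracket q r Y Z Iyz ->
  derived_bracket p (q + r - 1) X Iyz J1 ->
  derived_bracket (p + q - 1) r Ixy Z J2 ->
  derived_bracket q (p + r - 1) Y Ixz J3 -> Zc w ->
  Bd (J1 w - (J2 w + (-1) ^ ((p - 1) * (q - 1)) *: J3 w)).
Proof.
move=> sX sY sZ sIxy sIxz sIyz bxy bxz byz b1 b2 b3 hw.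
have [sLX sLY] := (stable_lie_op p sX, stable_lie_op q sY).
have [[LX1 _ _] [LY1 _ _] [Z1 Z2 _]] := And3 sLX sLY sZ.
have E1 := b1 w hw; have E2 := b2 w hw; have E3 := b3 w hw.
have F1 := stable_bracket sY sZ sIyz byz sLX hw; have F2 := byz _ (LX1 _ hw).
have G1 := stable_bracket sX sZ sIxz bxz sLY hw; have G2 := bxz _ (LY1 _ hw).
have H1 := lie_op_bracket sX sY sIxy bxy (Z1 _ hw).
have := Z2 _ (lie_op_bracket sX sY sIxy bxy hw).
have h1 := LX1 _ (LY1 _ hw); have h2 := LY1 _ (LX1 _ hw).
have hL : Zc (lie_op (p + q - 1) Ixy w).
  by have [L1 _ _] := stable_lie_op (p + q - 1) sIxy; apply: L1.
have hZ : Zc (lie_op p X (lie_op q Y w)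
    - (-1) ^ ((p - 1) * (q - 1)) *: lie_op q Y (lie_op p X w)).
  by rewrite addrC -scaleNr; apply: ZcL.
rewrite -[X in _ - X]scale1r (stable_opB _ sZ hL hZ) (stable_opB _ sZ h1 h2).
rewrite scale1r => H2.
(* The relations [E] expand the outer brackets, [F] and [G] the inner brackets [Iyz] and [Ixz], and
   [H] the Lie operator of [Ixy]. Each one enters with the coefficient of the term it eliminates. *)
pose e1 := (p - 1) * (q + r - 1); pose e2 := (p + q - 1 - 1) * r.
pose e := (p - 1) * (q - 1).
have := BdL (-1) E2 (BdL (- (-1) ^ e) E3 (BdL 1 F1 (BdL (- (-1) ^ e1) F2
  (BdL (- (-1) ^ e) G1 (BdL ((-1) ^ (e + (q - 1) * (p + r - 1))) G2
  (BdL (-1) H1 (BdL ((-1) ^ e2) H2 E1))))))).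
by congr Bd; rewrite /e1 /e2 /e; lincomb k V.
Qed.

Lemma Bd_sub_trans u v w : Bd (u - v) -> Bd (v - w) -> Bd (u - w).
Proof. by move=> h h'; have := BdL 1 h h'; congr Bd; lincomb k V. Qed.

Lemma Bd_sub_lin c u v w v' w' : Bd (u - (c *: v + w)) -> Bd (v' - v) ->
  Bd (w' - w) -> Bd (u - (c *: v' + w')).
Proof.
move=> h hv hw; have := BdL (- c) hv (BdL (-1) hw h).
by congr Bd; lincomb k V.
Qed.

Lemma stable_sub T u v : stable_op T -> Zc u -> Zc v -> Bd (u - v) -> Bd (T u - T v).
Proof.
move=> sT hu hv h; have [_ T2 _] := sT; have := T2 _ h.
by rewrite -[X in u - X]scale1r stable_opB // scale1r.
Qed.

(** Evaluate Cartan's formula at a vector [w] whose image under [B] is a coboundary: the term ending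
    in [B w] drops out and three remain. The formula produces [Y (B (X w))], represented by [v4],
    while the BV identity has the product in the other order, [v2]; graded commutativity links the
    two. *)
Lemma derived_bracket_BV p q X Y I w v1 v2 v3 v4 :
  stable_op X -> stable_op Y -> derived_bracket p q X Y I -> Zc w -> Bd (B w) ->
  Bd (v1 - B (X (Y w))) -> Bd (v2 - (-1) ^ ((p - 1) * q) *: v4) ->
  Bd (v4 - Y (B (X w))) -> Bd (v3 - X (B (Y w))) ->
  Bd (I w - ((-1) ^ p *: v1 - (-1) ^ p *: v2 - v3)).
Proof.
move=> sX sY br hw bBw b1 b2 b4 b3; have := br w hw.
have [[X1 X2 _] [Y1 Y2 _] [B1 _ _]] := And3 sX sY sB.
have -> : Y (lie_op p X w) = (-1) ^ p *: Y (B (X w)) - Y (X (B w)).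
  have h1 := B1 _ (X1 _ hw).
  rewrite -(stable_opZ _ sY h1) /lie_op -[X (B w)]scale1r stable_opB // ?scale1r //.
    by rewrite -[_ *: _]addr0; apply/ZcL/BdZ.
  exact/X1/B1.
have b5 := Y2 _ (X2 _ bBw); move=> b.
have := BdL (- (-1) ^ p) b1 (BdL ((-1) ^ p) b2
  (BdL ((-1) ^ (p + (p - 1) * q)) b4 (BdL 1 b3 (BdL ((-1) ^ ((p - 1) * q)) b5 b)))).
by congr Bd; rewrite /lie_op; lincomb k V.
Qed.

End GradedOperators.

(** * Contractions and Connes' operator on families of cochains *)

Section TotalOperators.
Variables (k : fieldType) (A : augDGA k).
Implicit Types (x y z : seq (helt A) -> A) (s : seq (helt A)).
Local Notation C := (seq (helt A) -> dual A).
Implicit Types w : int -> C.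

(* The families of cochains indexed by their degree turn the operations of
   various degrees into endomorphisms of a single space. *)
Definition tot_cocycle w : Prop := forall n, cocycle (dual A) n (w n).
Definition tot_coboundary w : Prop := forall n, coboundary (dual A) n (w n).
Definition tot_cap (p : int) x w : int -> C := fun n => cap p (n - p) x (w (n - p)).
Definition tot_connes w : int -> C := fun n => connes_dual (n + 1) (w (n + 1)).

Lemma tot_cocycleL c w w' : tot_cocycle w -> tot_cocycle w' -> tot_cocycle (c *: w + w').
Proof. by move=> h h' n; apply: cocycleL. Qed.

Lemma tot_coboundary0 : tot_coboundary 0.
Proof. by move=> n; apply: coboundary0. Qed.

Lemma tot_coboundaryL c w w' :
  tot_coboundary w -> tot_coboundary w' -> tot_coboundary (c *: w + w').
Proof. by move=> h h' n; apply: coboundaryL. Qed.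

Lemma tot_coboundary_cocycle w : tot_coboundary w -> tot_cocycle w.
Proof. by move=> h n; apply: coboundary_cocycle. Qed.

Lemma connes_dualL m c (f g : C) :
  connes_dual m (c *: f + g) = c *: connes_dual m f + connes_dual m g.
Proof.
apply/funext => s; apply/funext => b.
rewrite -[RHS]/((c : k) * (connes_dual m f s b : k) + (connes_dual m g s b : k)).
rewrite /connes_dual /of_form /eval_chain /connes !big_map.
rewrite (mulrCA c) -mulrDr; congr (_ * _).
rewrite (mulrCA c) -mulrDr; congr (_ * _); rewrite !mulr_sumr -big_split /=.
apply: eq_bigr => i _; rewrite /to_form -[(c *: f + g) _ _]/(c * _ + _).
by rewrite !mulrDr !(mulrCA c).
Qed.

Lemma connes_cocycle m (f : C) : cocycle (dual A) m f ->
  cocycle (dual A) (m - 1) (connes_dual m f).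
Proof.
move=> [hf df]; split; first exact: connes_cochain.
rewrite delta_connes ?df //; last exact: cochain0.
have := connes_dualL (m + 1) (-1) 0 0.
by rewrite scaler0 addr0 scaleN1r addNr => ->; rewrite oppr0.
Qed.

Lemma connes_coboundary m (f : C) : coboundary (dual A) m f ->
  coboundary (dual A) (m - 1) (connes_dual m f).
Proof.
move=> [h hh ->]; exists (- connes_dual (m - 1) h).
  by rewrite -scaleN1r; apply/cochainZ/connes_cochain.
have hB := connes_cochain hh.
rewrite -scaleN1r deltaZ // scaleN1r (delta_connes hh (delta_cochain hh)).
by rewrite opprK subrK.
Qed.

Lemma stable_tot_connes : stable_op tot_cocycle tot_coboundary tot_connes.
Proof.
split=> [w hw n|w hw n|c w w' _ _].
- by rewrite /tot_connes -[in cocycle _ n](addrK 1 n); apply: connes_cocycle.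
- by rewrite /tot_connes -[in coboundary _ n](addrK 1 n); apply: connes_coboundary.
by apply/funext => n; rewrite /tot_connes connes_dualL.
Qed.

Lemma tot_connes_connes w : tot_cocycle w -> tot_connes (tot_connes w) = 0.
Proof.
move=> hw; apply/funext => n; have [h _] := hw (n + 1 + 1).
by have := connes_connes h; rewrite addrK.
Qed.

Lemma capE_lcup p m x (f : C) : cochain (reg A) p x -> cochain (dual A) m f ->
  cap p m x f = (-1) ^ p *: lcup p m x f.
Proof. by move=> hx hf; apply: cap_lcup => // s; apply: (cochain_hom hf). Qed.

Lemma cap_cocycle p m x (f : C) : cocycle (reg A) p x -> cocycle (dual A) m f ->
  cocycle (dual A) (p + m) (cap p m x f).
Proof.
move=> cx cf; rewrite (capE_lcup (proj1 cx) (proj1 cf)).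
exact/cocycleZ/lcup_cocycle.
Qed.

Lemma stable_tot_cap p x : cocycle (reg A) p x ->
  stable_op tot_cocycle tot_coboundary (tot_cap p x).
Proof.
move=> cx; have [hx _] := cx.
split=> [w hw n|w hw n|c w w' hw hw'].
- have := cap_cocycle cx (hw (n - p)); rewrite /tot_cap.
  by rewrite (_ : p + (n - p) = n) // addrC subrK.
- have bw := hw (n - p); have [hf _] := coboundary_cocycle bw.
  rewrite /tot_cap (capE_lcup hx hf) -[in coboundary _ n](subrK p n) [_ + p]addrC.
  exact/coboundaryZ/lcup_coboundary_r.
apply/funext => n; have [[h _] [h' _]] := (hw (n - p), hw' (n - p)).
rewrite -[RHS]/(c *: tot_cap p x w n + tot_cap p x w' n) /tot_cap.
rewrite !capE_lcup //; last exact: cochainL.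
by rewrite (lcupDr p x c h h') scalerDr !scalerA mulrC.
Qed.

Lemma tot_capL p c x y w : cocycle (reg A) p x -> cocycle (reg A) p y -> tot_cocycle w ->
  tot_cap p (c *: (x : seq (helt A) -> reg A) + y) w =
  c *: tot_cap p x w + tot_cap p y w.
Proof.
move=> [hx _] [hy _] hw; apply/funext => n; have [h _] := hw (n - p).
rewrite -[RHS]/(c *: tot_cap p x w n + tot_cap p y w n) /tot_cap.
rewrite !capE_lcup //; last exact: (cochainL (M := reg A)).
by rewrite (lcupDl p x y c h) scalerDr !scalerA mulrC.
Qed.

Lemma tot_cap_coboundary p x w : coboundary (reg A) p x -> tot_cocycle w ->
  tot_coboundary (tot_cap p x w).
Proof.
move=> bx hw n; have [hx _] := coboundary_cocycle bx; have [h _] := hw (n - p).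
rewrite /tot_cap (capE_lcup hx h) -[in coboundary _ n](subrK p n) [_ + p]addrC.
exact/coboundaryZ/lcup_coboundary_l.
Qed.

Lemma tot_cap_cup p q x y w : cocycle (reg A) p x -> cocycle (reg A) q y ->
  tot_cocycle w -> tot_cap (p + q) (cup q x y) w = tot_cap p x (tot_cap q y w).
Proof.
move=> [hx _] [hy _] hw; apply/funext => n; rewrite /tot_cap.
rewrite (_ : n - p - q = n - (p + q)); last by rewrite opprD addrA.
set m := n - (p + q); have [h _] := hw m.
rewrite (_ : n - p = q + m); last by rewrite /m; ring.
rewrite (capE_lcup (cup_cochain hx hy) h) (capE_lcup hy h).
rewrite capE_lcup //; last first.
  exact/cochainZ/lcup_cochain.
rewrite -[_ *: lcup q m y _]addr0 lcupDr //; [|exact: lcup_cochain|exact: cochain0].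
rewrite lcup0r addr0 sgnM -scalerA; congr (_ *: (_ *: _)).
by apply/funext => s; rewrite lcup_assoc.
Qed.

Lemma tot_cartan p q x y : cocycle (reg A) p x -> cocycle (reg A) q y ->
  derived_bracket tot_cocycle tot_coboundary tot_connes p q
    (tot_cap p x) (tot_cap q y) (tot_cap (p + q - 1) (gerst p q x y)).
Proof.
(* In component [n] of the family, [m] is the degree of the argument to which the contraction with
   the bracket is applied; the other degrees are then rewritten in terms of [m]. *)
move=> cx cy w hw n; pose m := n - (p + q - 1).
have [H hH E] := cartan cx cy (hw m).
exists H; first by move: hH; rewrite /m; congr (cochain _ _ H); ring.
have sY := stable_tot_cap cy; have sX := stable_tot_cap cx.
have [X1 _ _] := sX; have [B1 _ _] := stable_tot_connes.
have h1 := B1 _ (X1 _ hw); have h2 := X1 _ (B1 _ hw).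
have -> : tot_cap q y (lie_op tot_connes p (tot_cap p x) w) =
    (-1) ^ p *: tot_cap q y (tot_connes (tot_cap p x w))
    - tot_cap q y (tot_cap p x (tot_connes w)).
  have [_ _ L] := sY; rewrite /lie_op addrC -scaleN1r L //; last first.
    have := tot_cocycleL ((-1) ^ p) h1 (tot_coboundary_cocycle tot_coboundary0).
    by rewrite addr0.
  rewrite (stable_opZ tot_coboundary0 tot_coboundary_cocycle _ sY h1).
  by rewrite scaleN1r addrC.
pose W1 := tot_connes (tot_cap p x (tot_cap q y w)) n.
pose W2 := tot_cap p x (tot_connes (tot_cap q y w)) n.
pose W3 := tot_cap q y (tot_connes (tot_cap p x w)) n.
pose W4 := tot_cap q y (tot_cap p x (tot_connes w)) n.
pose W0 := tot_cap (p + q - 1) (gerst p q x y) w n.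
transitivity (W0 - ((-1) ^ p *: W1 - W2
  - (-1) ^ ((p - 1) * q) *: ((-1) ^ p *: W3 - W4))); first by [].
have -> : W0 = cap (p + q - 1) m (gerst p q x y) (w m) by [].
have e1 : n + 1 - p - q = m by rewrite /m; ring.
have e2 : n - p + 1 - q = m by rewrite /m; ring.
have e3 : n - q + 1 - p = m by rewrite /m; ring.
have e4 : n - q - p + 1 = m by rewrite /m; ring.
have -> : W1 = connes_dual (p + (q + m)) (cap p (q + m) x (cap q m y (w m))).
  rewrite /W1 /tot_connes /tot_cap e1 (_ : n + 1 - p = q + m); last by rewrite /m; ring.
  by rewrite (_ : n + 1 = p + (q + m)) //; rewrite /m; ring.
have -> : W2 = cap p (q + m - 1) x (connes_dual (q + m) (cap q m y (w m))).
  rewrite /W2 /tot_connes /tot_cap e2 (_ : n - p + 1 = q + m); last by rewrite /m; ring.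
  by rewrite (_ : n - p = q + m - 1) //; rewrite /m; ring.
have -> : W3 = cap q (p + m - 1) y (connes_dual (p + m) (cap p m x (w m))).
  rewrite /W3 /tot_connes /tot_cap e3 (_ : n - q + 1 = p + m); last by rewrite /m; ring.
  by rewrite (_ : n - q = p + m - 1) //; rewrite /m; ring.
have -> : W4 = cap q (p + (m - 1)) y (cap p (m - 1) x (connes_dual m (w m))).
  rewrite /W4 /tot_connes /tot_cap e4 (_ : n - q - p = m - 1); last by rewrite /m; ring.
  by rewrite (_ : n - q = p + (m - 1)) //; rewrite /m; ring.
rewrite E (_ : p + q - 1 + m - 1 = n - 1); last by rewrite /m; ring.
have comb (V : lmodType k) (a b : k) (v1 v2 v3 v4 v : V) :
    a *: v1 - v2 - (b * a) *: v3 + b *: v4 + v - (a *: v1 - v2 - b *: (a *: v3 - v4)) = v.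
  by lincomb k V.
by rewrite sgnM comb.
Qed.

End TotalOperators.

(** * The cup product and the bracket on cohomology *)

Section RegularCohomology.
Variables (k : fieldType) (A : augDGA k).
Local Notation C := (seq (helt A) -> reg A).
Implicit Types (x y z : C) (s : seq (helt A)).

Lemma cup_lcup p q x y : cochain (reg A) p x ->
  cup q x y = lcup (M := reg A) p q x y :> C.
Proof. by move=> hx; apply/funext => s; apply: cupE. Qed.

Lemma cup_cocycle p q x y : cocycle (reg A) p x -> cocycle (reg A) q y ->
  cocycle (reg A) (p + q) (cup q x y).
Proof. by move=> cx cy; rewrite (cup_lcup _ _ (proj1 cx)); apply: lcup_cocycle. Qed.

Lemma lcup_cohomologous (M : dgbimod A) p q x x' (f f' : seq (helt A) -> M) :
  cocycle (reg A) p x -> cocycle (reg A) p x' -> cocycle M q f -> cocycle M q f' ->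
  coboundary (reg A) p (x - x') -> coboundary M q (f - f') ->
  coboundary M (p + q) (lcup p q x f - lcup p q x' f').
Proof.
move=> cx cx' cf cf' bx bf; have [[hf _] [hf' _]] := (cf, cf').
have := coboundaryD (lcup_coboundary_r cx bf) (lcup_coboundary_l bx cf').
rewrite (_ : lcup p q x (f - f') = lcup p q x f - lcup p q x f'); last first.
  by rewrite [f - f']addrC -scaleN1r lcupDr // scaleN1r addrC.
rewrite (_ : lcup p q (x - x') f' = lcup p q x f' - lcup p q x' f'); last first.
  by rewrite [x - x']addrC -scaleN1r lcupDl // scaleN1r addrC.
by rewrite addrA subrK.
Qed.

Lemma cup_cohomologous p q x x' y y' :
  cocycle (reg A) p x -> cocycle (reg A) p x' -> cocycle (reg A) q y ->
  cocycle (reg A) q y' -> coboundary (reg A) p (x - x') ->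
  coboundary (reg A) q (y - y') ->
  coboundary (reg A) (p + q) ((cup q x y : C) - cup q x' y').
Proof.
move=> cx cx' cy cy' bx bz.
rewrite (cup_lcup _ _ (proj1 cx)) (cup_lcup _ _ (proj1 cx')).
exact: lcup_cohomologous.
Qed.

Lemma cupDl p q c x x' y : cochain (reg A) p x -> cochain (reg A) p x' ->
  cochain (reg A) q y ->
  cup q (c *: x + x') y = c *: (cup q x y : C) + cup q x' y :> C.
Proof.
move=> hx hx' hy; rewrite !(@cup_lcup p) //; last exact: cochainL.
exact: lcupDl.
Qed.

Lemma cupDr p q c x y y' : cochain (reg A) p x -> cochain (reg A) q y ->
  cochain (reg A) q y' ->
  cup q x (c *: y + y') = c *: (cup q x y : C) + cup q x y' :> C.
Proof. by move=> hx hy hy'; rewrite !(@cup_lcup p) //; apply: lcupDr. Qed.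

Lemma circDl q c x x' y :
  circ q (c *: x + x') y = c *: (circ q x y : C) + circ q x' y :> C.
Proof.
apply/funext => s; rewrite -[RHS]/(c *: (circ q x y s : reg A) + circ q x' y s).
by rewrite !circ_reg -insopZ -insopD.
Qed.

Lemma circDr p q c x y y' : cochain (reg A) p x ->
  circ q x (c *: y + y') = c *: (circ q x y : C) + circ q x y' :> C.
Proof.
move=> hx; apply/funext => s.
rewrite -[RHS]/(c *: (circ q x y s : reg A) + circ q x y' s).
by rewrite !circ_reg -insop_vD //; apply: cochain_multilinear hx.
Qed.

Lemma gerst_circ p q x y :
  gerst p q x y = (circ q x y : C) - (-1) ^ ((p + 1) * (q + 1)) *: (circ p y x : C).
Proof. by []. Qed.

Lemma gerstDl p q c x x' y : cochain (reg A) q y ->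
  gerst p q (c *: x + x') y = c *: (gerst p q x y : C) + gerst p q x' y :> C.
Proof.
move=> hy; rewrite !gerst_circ circDl (circDr _ _ _ _ hy).
rewrite scalerBr !scalerDr opprD !scalerA mulrC addrACA.
by [].
Qed.

Lemma gerstDr p q c x y y' : cochain (reg A) p x ->
  gerst p q x (c *: y + y') = c *: (gerst p q x y : C) + gerst p q x y' :> C.
Proof.
move=> hx; rewrite !gerst_circ circDl (circDr _ _ _ _ hx).
rewrite scalerBr !scalerDr opprD !scalerA mulrC addrACA.
by [].
Qed.

Lemma gerst0l p q y : cochain (reg A) q y -> gerst p q (0 : C) y = 0 :> C.
Proof.
move=> hy; have := gerstDl p (-1) 0 0 hy.
by rewrite scaler0 addr0 scaleN1r addNr.
Qed.

Lemma gerst0r p q x : cochain (reg A) p x -> gerst p q x (0 : C) = 0 :> C.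
Proof.
move=> hx; have := gerstDr q (-1) 0 0 hx.
by rewrite scaler0 addr0 scaleN1r addNr.
Qed.

Lemma delta_gerstE p q x y : cochain (reg A) p x -> cochain (reg A) q y ->
  delta (reg A) (p + q - 1) (gerst p q x y) =
    (gerst (p + 1) q (delta (reg A) p x) y : C)
  - (-1) ^ p *: (gerst p (q + 1) x (delta (reg A) q y) : C).
Proof. by move=> hx hy; apply/funext => s; apply: delta_gerst. Qed.

Lemma gerst_cocycle p q x y : cocycle (reg A) p x -> cocycle (reg A) q y ->
  cocycle (reg A) (p + q - 1) (gerst p q x y).
Proof.
move=> [hx dx] [hy dy]; split; first exact: gerst_cochain.
by rewrite delta_gerstE // dx dy gerst0l // gerst0r // scaler0 subr0.
Qed.

Lemma gerst_coboundary_l p q x y : coboundary (reg A) p x -> cocycle (reg A) q y ->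
  coboundary (reg A) (p + q - 1) (gerst p q x y).
Proof.
move=> [h hh ->] [hy dy]; have e : p + q - 1 - 1 = p - 1 + q - 1 by ring.
exists (gerst (p - 1) q h y); rewrite e; first exact: gerst_cochain.
by rewrite delta_gerstE // dy gerst0r // scaler0 subr0 subrK.
Qed.

Lemma gerst_coboundary_r p q x y : cocycle (reg A) p x -> coboundary (reg A) q y ->
  coboundary (reg A) (p + q - 1) (gerst p q x y).
Proof.
move=> [hx dx] [h hh ->]; have e : p + q - 1 - 1 = p + (q - 1) - 1 by ring.
have hg := gerst_cochain hx hh.
exists (- (-1) ^ p *: (gerst p (q - 1) x h : C)).
  by rewrite e; apply: cochainZ.
rewrite e deltaZ // delta_gerstE // dx gerst0l // sub0r subrK.
by rewrite scaleNr scalerN opprK scalerA sgn2 scale1r.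
Qed.

Lemma gerst_cohomologous p q x x' y y' :
  cocycle (reg A) p x -> cocycle (reg A) p x' -> cocycle (reg A) q y ->
  cocycle (reg A) q y' -> coboundary (reg A) p (x - x') ->
  coboundary (reg A) q (y - y') ->
  coboundary (reg A) (p + q - 1) ((gerst p q x y : C) - gerst p q x' y').
Proof.
move=> cx cx' cy cy' bx bz.
have := coboundaryD (gerst_coboundary_r cx bz) (gerst_coboundary_l bx cy').
rewrite (_ : gerst p q x (y - y') = (gerst p q x y : C) - gerst p q x y'); last first.
  by rewrite [y - y']addrC -scaleN1r (gerstDr _ _ _ _ (proj1 cx)) scaleN1r addrC.
rewrite (_ : gerst p q (x - x') y' = (gerst p q x y' : C) - gerst p q x' y'); last first.
  by rewrite [x - x']addrC -scaleN1r (gerstDl _ _ _ _ (proj1 cy')) scaleN1r addrC.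
by rewrite addrA subrK.
Qed.

Lemma gerst_antisymmetric p q x y :
  gerst p q x y = - ((-1) ^ ((p - 1) * (q - 1)) *: (gerst q p y x : C)).
Proof.
apply/funext => s; rewrite /gerst.
rewrite -[RHS]/(- (_ *: ((circ p y x s : reg A) - _ *: circ q x y s))).
by lincomb k (reg A).
Qed.

Lemma cup_commutative p q x y : cocycle (reg A) p x -> cocycle (reg A) q y ->
  coboundary (reg A) (p + q) ((cup q x y : C) - (-1) ^ (p * q) *: (cup p y x : C)).
Proof.
move=> [hx dx] [hy dy]; have hc := circ_cochain hx hy.
(* For cocycles the terms with [delta] in [delta_circ] vanish, so a sign times [circ q x y] is a
   primitive of the graded commutator. *)
exists (- (-1) ^ p *: (circ q x y : C)).
  exact: cochainZ.
have circ0l r z : circ r (0 : C) z = 0 :> C.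
  by have := circDl r (-1) 0 0 z; rewrite scaler0 addr0 scaleN1r addNr.
have circ0r r z : cochain (reg A) p z -> circ r z (0 : C) = 0 :> C.
  by move=> hz; have := circDr r (-1) 0 0 hz; rewrite scaler0 addr0 scaleN1r addNr.
rewrite deltaZ //; apply/funext => s.
rewrite -[RHS]/(_ *: delta (reg A) _ _ s) delta_circ // dx dy circ0l circ0r //.
rewrite -[LHS]/((cup q x y s : reg A) - (-1) ^ (p * q) *: cup p y x s).
rewrite -[(0 : C) s]/(0 : reg A).
by lincomb k (reg A).
Qed.

End RegularCohomology.

(** * Cohomology classes and their representatives *)

Section Representatives.
Variables (k : fieldType) (A : augDGA k) (M : dgbimod A).
Implicit Types (p q : int) (f g : seq (helt A) -> M).

Definition represents p (z : HH M p) f : Prop := exists Z : cocycle M p f, z = class Z.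

Lemma represents_cocycle p (z : HH M p) f : represents z f -> cocycle M p f.
Proof. by case. Qed.

Lemma represents_eq p (z w : HH M p) f g : represents z f -> represents w g ->
  z = w <-> coboundary M p (f - g).
Proof. by move=> [Zf ->] [Zg ->]; apply: class_eq. Qed.

Lemma represents_inj p (z w : HH M p) f : represents z f -> represents w f -> z = w.
Proof.
by move=> hz hw; apply/(represents_eq hz hw); rewrite subrr; apply: coboundary0.
Qed.

Lemma represents_cohomologous p (z : HH M p) f g : represents z f -> cocycle M p g ->
  coboundary M p (f - g) -> represents z g.
Proof. by move=> [Zf ->] Zg b; exists Zg; apply/class_eq. Qed.

Lemma representsL p c (z w : HH M p) f g : represents z f -> represents w g ->
  represents (c *: z + w) (c *: f + g).
Proof.
move=> [Zf ->] [Zg ->]; exists (cocycleL c Zf Zg).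
rewrite /class -[_ *: _]HH_piZ -HH_piD.
by congr (\pi_(HH M p) _)%qT; apply: val_inj.
Qed.

Lemma represents0 p : represents (0 : HH M p) 0.
Proof.
pose Z := cocycle0 M p; have h : represents (class Z) 0 by exists Z.
by have := representsL (-1) h h; rewrite !scaleN1r !addNr.
Qed.

Lemma representsZ p c (z : HH M p) f : represents z f -> represents (c *: z) (c *: f).
Proof. by move=> h; have := representsL c h (represents0 p); rewrite !addr0. Qed.

Lemma representsD p (z w : HH M p) f g : represents z f -> represents w g ->
  represents (z + w) (f + g).
Proof. by move=> h h'; have := representsL 1 h h'; rewrite !scale1r. Qed.

Lemma representsN p (z : HH M p) f : represents z f -> represents (- z) (- f).
Proof. by move=> h; have := representsZ (-1) h; rewrite !scaleN1r. Qed.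

Lemma represents_castd p q (e : p = q) (z : HH M p) f : represents z f ->
  represents (castd (V := fun n => HH M n : lmodType k) e z) f.
Proof. by case: q / e. Qed.

Definition rep p (z : HH M p) : seq (helt A) -> M := cocycle_val (repr z).

Lemma represents_rep p (z : HH M p) : represents z (rep z).
Proof.
exists (asboolW (cocycle_valP (repr z))).
rewrite /class -{1}[z]reprK; congr (\pi_(HH M p) _)%qT.
exact: val_inj.
Qed.

(** Total in [f], so that operations on classes can be defined before their values are known to be
    cocycles; the value 0 is a default for other cochains. *)
Definition HH_of p f : HH M p :=
  if pselect (cocycle M p f) is left Z then class Z else 0.

Lemma represents_HH_of p f g : cocycle M p f -> cocycle M p g ->
  coboundary M p (f - g) -> represents (HH_of p f) g.
Proof.
move=> Zf Zg b; apply: represents_cohomologous b => //.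
by rewrite /HH_of; case: pselect => // Z; exists Z.
Qed.

End Representatives.

(** * The operations on cohomology and the BV identities *)

Section BVStructure.
Variables (k : fieldType) (A : augDGA k) (d : int) (F : seq (helt A) -> dual A).
Hypothesis cF : cocycle (dual A) (- d) F.
Hypothesis BF : coboundary (dual A) (- d - 1) (connes_dual (- d) F).
Hypothesis F_inj : forall p x, cocycle (reg A) p x ->
  coboundary (dual A) (p - d) (cap p (- d) x F) -> coboundary (reg A) p x.
Hypothesis F_surj : forall p G, cocycle (dual A) (p - d) G ->
  exists2 x, cocycle (reg A) p x & coboundary (dual A) (p - d) (G - cap p (- d) x F).
Local Notation HA := (HH (reg A)).
Local Notation HD := (HH (dual A)).
Local Notation C := (seq (helt A) -> reg A).

Definition HH_mul p q (z : HA p) (w : HA q) : HA (p + q) :=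
  HH_of (M := reg A) (p + q) (cup q (rep z) (rep w)).
Definition HH_brk p q (z : HA p) (w : HA q) : HA (p + q - 1) :=
  HH_of (M := reg A) (p + q - 1) (gerst p q (rep z) (rep w)).
Definition HH_connes m (z : HD m) : HD (m - 1) :=
  HH_of (m - 1) (connes_dual m (rep z)).
Definition HH_cap p (z : HA p) : HD (p - d) :=
  HH_of (p - d) (cap p (- d) (rep z) F).

Lemma represents_mul p q (z : HA p) (w : HA q) x y :
  represents z x -> represents w y -> represents (HH_mul z w) (cup q x y : C).
Proof.
move=> hz hw; have [hz' hw'] := (represents_rep z, represents_rep w).
have [[cx cx'] [cy cy']] := ((represents_cocycle hz, represents_cocycle hz'),
  (represents_cocycle hw, represents_cocycle hw')).
apply: represents_HH_of; [exact: cup_cocycle | exact: cup_cocycle |].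
by apply: cup_cohomologous => //; [exact/(represents_eq hz' hz) | exact/(represents_eq hw' hw)].
Qed.

Lemma represents_brk p q (z : HA p) (w : HA q) x y :
  represents z x -> represents w y -> represents (HH_brk z w) (gerst p q x y : C).
Proof.
move=> hz hw; have [hz' hw'] := (represents_rep z, represents_rep w).
have [[cx cx'] [cy cy']] := ((represents_cocycle hz, represents_cocycle hz'),
  (represents_cocycle hw, represents_cocycle hw')).
apply: represents_HH_of; [exact: gerst_cocycle | exact: gerst_cocycle |].
by apply: gerst_cohomologous => //; [exact/(represents_eq hz' hz) | exact/(represents_eq hw' hw)].
Qed.

Lemma represents_connes m (z : HD m) f :
  represents z f -> represents (HH_connes z) (connes_dual m f).
Proof.
move=> hz; have hz' := represents_rep z.
have [cf cf'] := (represents_cocycle hz, represents_cocycle hz').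
apply: represents_HH_of; [exact: connes_cocycle | exact: connes_cocycle |].
have /connes_coboundary := (represents_eq hz' hz).1 erefl.
rewrite (_ : connes_dual m (rep z - f) = connes_dual m (rep z) - connes_dual m f) //.
by rewrite [rep z - f]addrC -scaleN1r connes_dualL scaleN1r addrC.
Qed.

Lemma represents_cap p (z : HA p) x G : represents z x -> cocycle (dual A) (- d) G ->
  coboundary (dual A) (- d) (F - G) -> represents (HH_cap z) (cap p (- d) x G).
Proof.
move=> hz cG FG; have hz' := represents_rep z.
have [cx cx'] := (represents_cocycle hz, represents_cocycle hz').
apply: represents_HH_of; [exact: cap_cocycle | exact: cap_cocycle |].
rewrite (capE_lcup (proj1 cx') (proj1 cF)) (capE_lcup (proj1 cx) (proj1 cG)).
rewrite -scalerBr; apply/coboundaryZ/lcup_cohomologous => //.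
exact/(represents_eq hz' hz).
Qed.

Let F_surj' : exists S : forall p : int, (seq (helt A) -> dual A) -> C,
  forall p G, cocycle (dual A) (p - d) G -> cocycle (reg A) p (S p G) /\
    coboundary (dual A) (p - d) (G - cap p (- d) (S p G) F).
Proof.
have /choice[S SP] : forall t : int * (seq (helt A) -> dual A), exists x : C,
    cocycle (dual A) (t.1 - d) t.2 -> cocycle (reg A) t.1 x /\
    coboundary (dual A) (t.1 - d) (t.2 - cap t.1 (- d) x F).
  move=> [p G]; have [/F_surj[x cx bx]|nG] := pselect (cocycle (dual A) (p - d) G).
    by exists x.
  by exists 0 => /nG.
by exists (fun p G => S (p, G)) => p G cG; apply: (SP (p, G)).
Qed.

(** The inverse of the cap must be a function, whereas [F_surj] only asserts existence. A preimage
    is chosen for every degree and every cochain, and is meaningful on cocycles. *)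
Definition cap_section : int -> (seq (helt A) -> dual A) -> C := projT1 (cid F_surj').

Lemma cap_sectionP p G : cocycle (dual A) (p - d) G ->
  cocycle (reg A) p (cap_section p G) /\
  coboundary (dual A) (p - d) (G - cap p (- d) (cap_section p G) F).
Proof. exact: projT2 (cid F_surj') p G. Qed.

Definition HH_uncap p (z : HD (p - d)) : HA p :=
  HH_of (M := reg A) p (cap_section p (rep z)).

Lemma represents_uncap p (z : HD (p - d)) G : represents z G ->
  exists2 g, represents (HH_uncap z) g &
    coboundary (dual A) (p - d) (G - cap p (- d) g F).
Proof.
move=> hG; have hz := represents_rep z.
have [cg bg] := cap_sectionP (represents_cocycle hz).
exists (cap_section p (rep z)).
  by apply: represents_HH_of => //; rewrite subrr; apply: coboundary0.
have := coboundaryD ((represents_eq hG hz).1 erefl) bg.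
by rewrite addrA subrK.
Qed.

(** The class as one vector of the space of families, on which all operators can be evaluated; its
    cap with a cocycle of degree [p] is concentrated in degree [p - d]. *)
Definition fundamental_family (n : int) : seq (helt A) -> dual A :=
  if n == - d then F else 0.
Local Notation w0 := fundamental_family.
Local Notation "f ~~ g" := (tot_coboundary (f - g)) (at level 70).

Lemma fundamental_cocycle : tot_cocycle w0.
Proof. by move=> n; rewrite /w0; case: eqP => [->|_] //; apply: cocycle0. Qed.

Lemma fundamental_cap p x : tot_cap p x w0 (p - d) = cap p (- d) x F.
Proof. by rewrite /tot_cap (_ : p - d - p = - d) ?/w0 ?eqxx // addrAC subrr add0r. Qed.

Lemma fundamental_cap0 p x n : cocycle (reg A) p x -> n != p - d ->
  tot_cap p x w0 n = 0.
Proof.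
move=> [hx _] ne; rewrite /tot_cap /w0 (_ : (n - p == - d) = false); last first.
  by apply: contra_neqF ne => /eqP e; rewrite -[n](subrK p) e addrC.
rewrite capE_lcup //; last exact: cochain0.
by rewrite lcup0r scaler0.
Qed.

Lemma fundamental_connes : tot_coboundary (tot_connes w0).
Proof.
move=> n; rewrite /tot_connes /w0; case: eqP => [e|_].
  by rewrite e (_ : n = - d - 1) // -e addrK.
have := connes_dualL (n + 1) (-1) 0 (0 : seq (helt A) -> dual A).
rewrite scaler0 addr0 scaleN1r addNr => ->.
exact: coboundary0.
Qed.

(** This reduces equalities in the cohomology of [A] to relations between operators applied to one
    vector. *)
Lemma fundamental_faithful p x y : cocycle (reg A) p x -> cocycle (reg A) p y ->
  tot_cap p x w0 ~~ tot_cap p y w0 -> coboundary (reg A) p (x - y).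
Proof.
move=> cx cy /(_ (p - d)) E; apply: F_inj; first exact: cocycleB.
rewrite -fundamental_cap (_ : tot_cap p (x - y) w0 = tot_cap p x w0 - tot_cap p y w0) //.
rewrite [x - y]addrC -scaleN1r tot_capL //; last exact: fundamental_cocycle.
by rewrite scaleN1r addrC.
Qed.

Definition HH_Delta p (z : HA p) : HA (p - 1) :=
  HH_uncap (castd (V := fun n => HD n : lmodType k) (addrAC p (- d) (- 1))
    (HH_connes (HH_cap z))).

(** Describes [HH_Delta] without transport between degrees: capping with a representative of the
    result is Connes' operator after capping with [x], modulo coboundaries. Outside the one relevant
    degree both families vanish. *)
Lemma represents_Delta p (z : HA p) x : represents z x ->
  exists2 g, represents (HH_Delta z) g &
    tot_cap (p - 1) g w0 ~~ tot_connes (tot_cap p x w0).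
Proof.
move=> hz; have cx := represents_cocycle hz.
have hc : represents (HH_cap z) (cap p (- d) x F).
  by apply: (represents_cap hz cF); rewrite subrr; apply: coboundary0.
have [g hg E] := represents_uncap
  (represents_castd (addrAC p (- d) (- 1)) (represents_connes hc)).
exists g; [exact: hg | move=> n].
have [-> |ne] := eqVneq n (p - 1 - d).
  rewrite -[(_ - _) _]/(tot_cap (p - 1) g w0 (p - 1 - d) - tot_connes _ (p - 1 - d)).
  rewrite fundamental_cap /tot_connes.
  rewrite (_ : p - 1 - d + 1 = p - d); last by ring.
  by rewrite fundamental_cap; have := coboundaryN E; rewrite opprB.
rewrite -[(_ - _) _]/(tot_cap (p - 1) g w0 n - connes_dual (n + 1) (tot_cap p x w0 (n + 1))).
have ne' : n + 1 != p - d.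
  by apply: contraNneq ne => e; rewrite -[n](addrK 1) e addrAC.
rewrite (fundamental_cap0 (represents_cocycle hg) ne) (fundamental_cap0 cx ne').
have := connes_dualL (n + 1) (-1) 0 (0 : seq (helt A) -> dual A).
rewrite scaler0 addr0 scaleN1r addNr => ->.
by rewrite subrr; apply: coboundary0.
Qed.

Lemma tot_capZ p c x w : cocycle (reg A) p x -> tot_cocycle w ->
  tot_cap p (c *: x) w = c *: tot_cap p x w.
Proof.
move=> cx hw; have c0 := cocycle0 (reg A) p.
have := tot_capL c cx c0 hw; rewrite addr0 => ->.
have := tot_capL (-1) c0 c0 hw; rewrite scaler0 addr0 scaleN1r addNr => ->.
by rewrite addr0.
Qed.

Lemma tot_cap0 p w : tot_cocycle w -> tot_cap p (0 : C) w = 0.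
Proof.
move=> hw; have := tot_capZ 0 (cocycle0 (reg A) p) hw.
by rewrite !scale0r.
Qed.

Lemma tot_capB p x y w : cocycle (reg A) p x -> cocycle (reg A) p y -> tot_cocycle w ->
  tot_cap p (x - y) w = tot_cap p x w - tot_cap p y w.
Proof.
by move=> cx cy hw; rewrite [x - y]addrC -scaleN1r tot_capL // scaleN1r addrC.
Qed.

Lemma tot_capD p x y w : cocycle (reg A) p x -> cocycle (reg A) p y -> tot_cocycle w ->
  tot_cap p (x + y) w = tot_cap p x w + tot_cap p y w.
Proof.
move=> cx cy hw; have := tot_capL 1 cx cy hw.
by rewrite !scale1r.
Qed.

Lemma eq_represented p (z w : HA p) x y : represents z x -> represents w y ->
  tot_cap p x w0 ~~ tot_cap p y w0 -> z = w.
Proof.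
move=> hz hw E; apply/(represents_eq hz hw)/fundamental_faithful => //.
  exact: represents_cocycle hz.
exact: represents_cocycle hw.
Qed.

Local Notation castA e z := (castd (V := fun n => HA n : lmodType k) e z).
Let trans := @Bd_sub_trans k _ _ (@tot_coboundaryL k A).
Let hw0 := fundamental_cocycle.

Lemma HH_Delta_linear p c (z w : HA p) :
  HH_Delta (c *: z + w) = c *: HH_Delta z + HH_Delta w.
Proof.
have [hz hw] := (represents_rep z, represents_rep w).
have [[g hg Eg] [g' hg' Eg']] := (represents_Delta hz, represents_Delta hw).
have [h hh Eh] := represents_Delta (representsL c hz hw).
apply: (eq_represented hh (representsL c hg hg')).
have [cg cg'] := (represents_cocycle hg, represents_cocycle hg').
have [cx cy] := (represents_cocycle hz, represents_cocycle hw).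
rewrite (tot_capL c cg cg' hw0).
apply: (Bd_sub_lin (@tot_coboundaryL k A)) Eg Eg'.
have [[X1 _ _] [Y1 _ _]] := (stable_tot_cap cx, stable_tot_cap cy).
have [_ _ <-] := stable_tot_connes A; [| exact: X1 | exact: Y1].
by rewrite -tot_capL.
Qed.

Lemma HH_Delta_Delta p (z : HA p) : HH_Delta (HH_Delta z) = 0.
Proof.
have hz := represents_rep z; have cx := represents_cocycle hz.
have [g hg Eg] := represents_Delta hz; have [h hh Eh] := represents_Delta hg.
apply: (eq_represented hh (represents0 _ _)); rewrite tot_cap0 //.
have [X1 _ _] := stable_tot_cap cx; have [B1 _ _] := stable_tot_connes A.
have [G1 _ _] := stable_tot_cap (represents_cocycle hg).
apply: trans Eh _; rewrite -(tot_connes_connes (X1 _ hw0)).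
by apply: (stable_sub (stable_tot_connes A)) Eg; [exact: G1 | exact/B1/X1].
Qed.

Lemma HH_mul_bilinear : bilinear2 (V := fun n => HA n : lmodType k) HH_mul.
Proof.
move=> p q; split=> c u v w.
  have [[hx hy] hz] := ((represents_rep u, represents_rep v), represents_rep w).
  have [[[hx' _] [hy' _]] [hz' _]] := ((represents_cocycle hx, represents_cocycle hy),
    represents_cocycle hz).
  apply: represents_inj (represents_mul (representsL c hx hy) hz) _.
  by rewrite (cupDl c hx' hy' hz'); apply: representsL; apply: represents_mul.
have [[hx hy] hz] := ((represents_rep v, represents_rep w), represents_rep u).
have [[[hx' _] [hy' _]] [hz' _]] := ((represents_cocycle hx, represents_cocycle hy),
  represents_cocycle hz).
apply: represents_inj (represents_mul hz (representsL c hx hy)) _.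
by rewrite (cupDr c hz' hx' hy'); apply: representsL; apply: represents_mul.
Qed.

Lemma HH_brk_bilinear : bilinear2 (V := fun n => HA n : lmodType k) HH_brk.
Proof.
move=> p q; split=> c u v w.
  have [[hx hy] hz] := ((represents_rep u, represents_rep v), represents_rep w).
  have [hz' _] := represents_cocycle hz.
  apply: represents_inj (represents_brk (representsL c hx hy) hz) _.
  by rewrite (gerstDl p c _ _ hz'); apply: representsL; apply: represents_brk.
have [[hx hy] hz] := ((represents_rep v, represents_rep w), represents_rep u).
have [hz' _] := represents_cocycle hz.
apply: represents_inj (represents_brk hz (representsL c hx hy)) _.
by rewrite (gerstDr q c _ _ hz'); apply: representsL; apply: represents_brk.
Qed.

Lemma HH_mul_assoc p q r (z1 : HA p) (z2 : HA q) (z3 : HA r)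
    (e : p + q + r = p + (q + r)) :
  HH_mul z1 (HH_mul z2 z3) = castA e (HH_mul (HH_mul z1 z2) z3).
Proof.
have [[h1 h2] h3] := ((represents_rep z1, represents_rep z2), represents_rep z3).
apply: represents_inj (represents_mul h1 (represents_mul h2 h3)) _.
have := represents_castd e (represents_mul (represents_mul h1 h2) h3).
congr (represents _ _); have [[c1 _] [c2 _]] := (represents_cocycle h1, represents_cocycle h2).
have [c3 _] := represents_cocycle h3.
rewrite (cup_lcup r _ (cup_cochain c1 c2)) (cup_lcup (q + r) _ c1) (cup_lcup r _ c2).
by apply/funext => s; rewrite (lcup_assoc s c1 c2 c3).
Qed.

Lemma HH_mul_comm p q (z1 : HA p) (z2 : HA q) (e : q + p = p + q) :
  HH_mul z1 z2 = (-1) ^ (p * q) *: castA e (HH_mul z2 z1).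
Proof.
have [h1 h2] := (represents_rep z1, represents_rep z2).
apply/(represents_eq (represents_mul h1 h2)
  (representsZ ((-1) ^ (p * q)) (represents_castd e (represents_mul h2 h1)))).
exact: (cup_commutative (represents_cocycle h1) (represents_cocycle h2)).
Qed.

Lemma HH_brk_antisym p q (z1 : HA p) (z2 : HA q) (e : q + p - 1 = p + q - 1) :
  HH_brk z1 z2 = - ((-1) ^ ((p - 1) * (q - 1)) *: castA e (HH_brk z2 z1)).
Proof.
have [h1 h2] := (represents_rep z1, represents_rep z2).
apply: represents_inj (represents_brk h1 h2) _.
rewrite gerst_antisymmetric; apply/representsN/representsZ/represents_castd.
exact: represents_brk.
Qed.

Lemma HH_jacobi p q r (z1 : HA p) (z2 : HA q) (z3 : HA r)
    (e1 : p + q - 1 + r - 1 = p + (q + r - 1) - 1)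
    (e2 : q + (p + r - 1) - 1 = p + (q + r - 1) - 1) :
  HH_brk z1 (HH_brk z2 z3) = castA e1 (HH_brk (HH_brk z1 z2) z3)
    + (-1) ^ ((p - 1) * (q - 1)) *: castA e2 (HH_brk z2 (HH_brk z1 z3)).
Proof.
have [[h1 h2] h3] := ((represents_rep z1, represents_rep z2), represents_rep z3).
set x := rep z1 in h1; set y := rep z2 in h2; set z := rep z3 in h3.
have [h12 h13 h23] := And3 (represents_brk h1 h2) (represents_brk h1 h3)
  (represents_brk h2 h3).
have r2 := represents_castd e1 (represents_brk h12 h3).
have r3 := represents_castd e2 (represents_brk h2 h13).
apply: eq_represented (represents_brk h1 h23) (representsD r2 (representsZ _ r3)) _.
have [c1 c2 c3] := And3 (represents_cocycle h1) (represents_cocycle h2)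
  (represents_cocycle h3).
have [c12 c13 c23] := And3 (represents_cocycle h12) (represents_cocycle h13)
  (represents_cocycle h23).
have [d2 d3] := (represents_cocycle r2, represents_cocycle r3).
rewrite tot_capD ?tot_capZ //; last exact: cocycleZ.
have b2 := tot_cartan c12 c3; have b3 := tot_cartan c2 c13.
(* [tot_cap] takes the degree of its cochain as a parameter, so the brackets have to be stated in
   the degrees of the transported classes. *)
rewrite e1 in b2; rewrite e2 in b3.
exact: (derived_bracket_jacobi (@tot_cocycleL k A) (@tot_coboundary0 k A)
  (@tot_coboundaryL k A) (@tot_coboundary_cocycle k A) (stable_tot_connes A)
  (@tot_connes_connes k A) (stable_tot_cap c1) (stable_tot_cap c2) (stable_tot_cap c3)
  (stable_tot_cap c12) (stable_tot_cap c13) (stable_tot_cap c23)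
  (tot_cartan c1 c2) (tot_cartan c1 c3) (tot_cartan c2 c3) (tot_cartan c1 c23) b2 b3 hw0).
Qed.

Lemma HH_poisson p q r (z1 : HA p) (z2 : HA q) (z3 : HA r)
    (e1 : p + q - 1 + r = p + (q + r) - 1) (e2 : q + (p + r - 1) = p + (q + r) - 1) :
  HH_brk z1 (HH_mul z2 z3) = castA e1 (HH_mul (HH_brk z1 z2) z3)
    + (-1) ^ ((p - 1) * q) *: castA e2 (HH_mul z2 (HH_brk z1 z3)).
Proof.
have [[h1 h2] h3] := ((represents_rep z1, represents_rep z2), represents_rep z3).
set x := rep z1 in h1; set y := rep z2 in h2; set z := rep z3 in h3.
have [h12 h13 h23] := And3 (represents_brk h1 h2) (represents_brk h1 h3)
  (represents_mul h2 h3).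
have r2 := represents_castd e1 (represents_mul h12 h3).
have r3 := represents_castd e2 (represents_mul h2 h13).
apply: eq_represented (represents_brk h1 h23) (representsD r2 (representsZ _ r3)) _.
have [c1 c2 c3] := And3 (represents_cocycle h1) (represents_cocycle h2)
  (represents_cocycle h3).
have [c12 c13 c23] := And3 (represents_cocycle h12) (represents_cocycle h13)
  (represents_cocycle h23).
have [d2 d3] := (represents_cocycle r2, represents_cocycle r3).
rewrite tot_capD ?tot_capZ //; last exact: cocycleZ.
rewrite -[X in tot_cap X (cup r _ _)]e1 -[X in tot_cap X (cup (p + r - 1) _ _)]e2.
rewrite !tot_cap_cup //.
apply: (derived_bracket_poisson (@tot_cocycleL k A) (@tot_coboundary0 k A)
  (@tot_coboundaryL k A) (@tot_coboundary_cocycle k A) (stable_tot_connes A)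
  (stable_tot_cap c1) (stable_tot_cap c2) (stable_tot_cap c3)
  (stable_tot_cap c13) (tot_cartan c1 c2) (tot_cartan c1 c3) _ hw0).
(* The remaining hypothesis is Cartan's formula for [x] and the cup product of [y] and [z], which
   acts as the composite of the two caps. *)
move=> w hw; have := tot_cartan c1 c23 hw.
have sX := stable_lie_op (@tot_cocycleL k A) (@tot_coboundary0 k A)
  (@tot_coboundaryL k A) (@tot_coboundary_cocycle k A) (stable_tot_connes A) p
  (stable_tot_cap c1).
have [L1 _ _] := sX.
by rewrite (tot_cap_cup c2 c3 hw) (tot_cap_cup c2 c3 (L1 _ hw)).
Qed.

Lemma HH_BV_identity p q (z1 : HA p) (z2 : HA q)
    (e1 : p - 1 + q = p + q - 1) (e2 : p + (q - 1) = p + q - 1) :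
  HH_brk z1 z2 = (-1) ^ p *: HH_Delta (HH_mul z1 z2)
    - (-1) ^ p *: castA e1 (HH_mul (HH_Delta z1) z2)
    - castA e2 (HH_mul z1 (HH_Delta z2)).
Proof.
have [h1 h2] := (represents_rep z1, represents_rep z2).
set x := rep z1 in h1; set y := rep z2 in h2.
have [c1 c2] := (represents_cocycle h1, represents_cocycle h2).
have h12 := represents_mul h1 h2.
have [g h E] := represents_Delta h12.
have [[g1 k1 E1] [g2 k2 E2]] := (represents_Delta h1, represents_Delta h2).
have r1 := represents_castd e1 (represents_mul k1 h2).
have r2 := represents_castd e2 (represents_mul h1 k2).
apply: eq_represented (represents_brk h1 h2)
  (representsD (representsD (representsZ _ h) (representsN (representsZ _ r1)))
     (representsN r2)) _.
have [[cg cg1] cg2] := ((represents_cocycle h, represents_cocycle k1),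
  represents_cocycle k2).
have [d1 d2] := (represents_cocycle r1, represents_cocycle r2).
have [sX sY] := (stable_tot_cap c1, stable_tot_cap c2).
have [[X1 _ _] [Y1 _ _] [B1 _ _]] := And3 sX sY (stable_tot_connes A).
have [[G1 _ _] [G2 _ _]] := (stable_tot_cap cg1, stable_tot_cap cg2).
set G := gerst p q x y.
have cZ := cocycleZ ((-1) ^ p) cg; have dZ := cocycleZ ((-1) ^ p) d1.
rewrite (tot_capB (cocycleB cZ dZ) d2 hw0) (tot_capB cZ dZ hw0).
rewrite (tot_capZ _ cg hw0) (tot_capZ _ d1 hw0); apply: (derived_bracket_BV (@tot_cocycleL k A) (@tot_coboundary0 k A)
  (@tot_coboundaryL k A) (@tot_coboundary_cocycle k A) (stable_tot_connes A)
  sX sY (tot_cartan c1 c2) hw0 fundamental_connes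
  (v4 := tot_cap q y (tot_cap (p - 1) g1 w0))).
- by rewrite -tot_cap_cup.
(* Cartan's formula yields the product of [y] with the representative [g1] of [HH_Delta z1]; the BV
   identity has these two factors in the opposite order. *)
- have cc := cup_commutative cg1 c2.
  have c12 := cup_cocycle cg1 c2; have c21 := cup_cocycle c2 cg1.
  have := tot_cap_coboundary cc hw0; rewrite [q + _]addrC in c21.
  rewrite (tot_capB c12 (cocycleZ _ c21) hw0) (tot_capZ _ c21 hw0).
  by rewrite -e1 -(tot_cap_cup c2 cg1 hw0) [q + _]addrC.
- by apply: (stable_sub sY) E1; [exact: G1 | exact/B1/X1].
rewrite -e2 tot_cap_cup //.
by apply: (stable_sub sX) E2; [exact: G2 | exact/B1/Y1].
Qed.

Lemma HH_is_BV : is_BV (V := fun n => HA n : lmodType k) HH_mul HH_brk HH_Delta.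
Proof.
split; [split; [split; [exact: HH_mul_bilinear | exact: HH_brk_bilinear] |] | | |].
- split; [exact: HH_mul_assoc | exact: HH_mul_comm | exact: HH_brk_antisym
    | exact: HH_jacobi | exact: HH_poisson].
- exact: HH_Delta_linear.
- exact: HH_Delta_Delta.
exact: HH_BV_identity.
Qed.

Lemma HH_capK p : cancel (@HH_cap p) (@HH_uncap p).
Proof.
move=> z; have hz := represents_rep z; have cx := represents_cocycle hz.
have hc : represents (HH_cap z) (cap p (- d) (rep z) F).
  by apply: (represents_cap hz cF); rewrite subrr; apply: coboundary0.
have [g hg E] := represents_uncap hc; have cg := represents_cocycle hg.
apply/(represents_eq hg hz)/F_inj; first exact: cocycleB.
rewrite -fundamental_cap (tot_capB cg cx fundamental_cocycle).
rewrite -[(_ - _) _]/(tot_cap p g w0 _ - tot_cap p (rep z) w0 _).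
by rewrite !fundamental_cap; have := coboundaryN E; rewrite opprB.
Qed.

Lemma HH_uncapK p : cancel (@HH_uncap p) (@HH_cap p).
Proof.
move=> z; have hz := represents_rep z; have [g hg E] := represents_uncap hz.
have hc : represents (HH_cap (HH_uncap z)) (cap p (- d) g F).
  by apply: (represents_cap hg cF); rewrite subrr; apply: coboundary0.
apply/(represents_eq hc hz); have := coboundaryN E.
by rewrite opprB.
Qed.

End BVStructure.

Theorem theorem4p6 (k : fieldType) (A : augDGA k) (d : int)
    (c : HH (dual A) (- d)) (hc : DPD d c) :
  exists (mul : forall p q,
            HH (reg A) p -> HH (reg A) q -> HH (reg A) (p + q))
         (brk : forall p q,
            HH (reg A) p -> HH (reg A) q -> HH (reg A) (p + q - 1))
         (Bv : forall m, HH (dual A) m -> HH (dual A) (m - 1))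
         (capc : forall p, HH (reg A) p -> HH (dual A) (p - d))
         (D : forall p, HH (dual A) (p - d) -> HH (reg A) p),
    [/\ induced_cup mul, induced_gerst brk, induced_connes Bv
      & induced_cap c capc] /\
    (forall p, cancel (capc p) (D p) /\ cancel (D p) (capc p)) /\
    is_BV mul brk
      (fun p x =>
         D (p - 1) (castd (addrAC p (- d) (- 1)) (Bv (p - d) (capc p x)))).
Proof.
case: hc => -[P [eps [psi [_ qeps qpsi [t [ct eps_t [Zt cE]]]]]]] [F [cF [cE' BF]]].
(* The representative [F] whose image under Connes' operator is a coboundary need not be the one
   read off from the resolution; both represent [c], so they are cohomologous. *)
have psi_t : coboundary (dual A) (- d) (F - (psi \o t)).
  by apply/(class_eq cF Zt); rewrite -cE'.
have F_inj := cap_inj qeps qpsi ct eps_t cF psi_t.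
have F_surj := cap_surj qeps qpsi ct eps_t cF psi_t.
exists (@HH_mul k A), (@HH_brk k A), (@HH_connes k A), (@HH_cap k A d F).
exists (@HH_uncap k A d F F_surj).
split; first split.
- move=> p q x y Zx Zy; apply: represents_mul; [by exists Zx | by exists Zy].
- move=> p q x y Zx Zy; apply: represents_brk; [by exists Zx | by exists Zy].
- by move=> m f Zf; apply: represents_connes; exists Zf.
- move=> p x f Zx Zf cf; apply: represents_cap => //; first by exists Zx.
  by apply/(class_eq cF Zf); rewrite -cE'.
split=> [p|]; last exact: HH_is_BV.
by split; [exact: HH_capK | exact: HH_uncapK].
Qed.
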